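(* Let $\mathbb{H}$ be a separable real Hilbert space, $A:\mathbb{H}\rightrightarrows\mathbb{H}$ a maximal monotone operator with $\mathrm{Int}(\mathrm{D}(A))\neq\emptyset$, and $m\in\mathbb{D}(\mathbb{R}^{+},\mathbb{H})$ with $m_{0}\in\overline{\mathrm{D}(A)}$. For $\varepsilon>0$ let $x^{\varepsilon}$ be the unique càdlàg solution of $$x^{\varepsilon}_{t}+\int_{0}^{t}A_{\varepsilon}(x^{\varepsilon}_{s})\,ds=m_{t},\qquad t\in\mathbb{R}^{+},$$ and let $(x,k)=\mathcal{SP}(A,\Pi_{\overline{\mathrm{D}(A)}};m)$, where $\Pi_{\overline{\mathrm{D}(A)}}$ is the orthogonal projection on $\overline{\mathrm{D}(A)}$. Then for every $t\in\mathbb{R}^{+}$, as $\varepsilon\searrow0$, $$x^{\varepsilon}_{t}\longrightarrow x_{t}\,\mathbf{1}_{|\Delta m_{t}|=0}+(x_{t-}+\Delta m_{t})\,\mathbf{1}_{|\Delta m_{t}|>0}.$$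
   Context: $\mathbb{R}^{+}=[0,\infty)$. $\mathrm{D}(A)=\{z\in\mathbb{H}:A(z)\neq\emptyset\}$, $\mathrm{Gr}(A)=\{(z,y):y\in A(z)\}$; $\overline{\mathrm{D}(A)}$ is closed and convex. Yosida approximation: $J_{\varepsilon}(z)=(I+\varepsilon A)^{-1}(z)$ and $A_{\varepsilon}(z)=\frac1\varepsilon(z-J_{\varepsilon}(z))$, single-valued Lipschitz maps on $\mathbb{H}$. $\mathbb{D}(\mathbb{R}^{+},\mathbb{H})$ is the set of càdlàg functions $\mathbb{R}^{+}\to\mathbb{H}$; by convention $x_{0-}=x_{0}$, and $\Delta x_{t}=x_{t}-x_{t-}$. $\mathrm{BV}_{loc}(\mathbb{R}^{+};\mathbb{H})$ is the set of functions with finite total variation on every $[0,T]$. For a càdlàg $k\in\mathrm{BV}_{loc}(\mathbb{R}^{+};\mathbb{H})$ put $k^{d}_{t}=\sum_{0\le s\le t}\Delta k_{s}$ and $k^{c}=k-k^{d}$. Integrals $\int_{s}^{t}$ with respect to $dk$ are Lebesgue–Stieltjes integrals over $(s,t]$. ''$d\ell_{t}\in A(y_{t})(dt)$'' means $\int_{s}^{t}\langle y_{r}-\alpha,d\ell_{r}-\beta\,dr\rangle\ge 0$ for all $0\le s\le t$ and all $(\alpha,\beta)\in\mathrm{Gr}(A)$. For $\Pi:\mathbb{H}\to\overline{\mathrm{D}(A)}$ nonexpansive and equal to the identity on $\overline{\mathrm{D}(A)}$ (e.g. $\Pi=\Pi_{\overline{\mathrm{D}(A)}}$), $(x,k)=\mathcal{SP}(A,\Pi;m)$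 denotes the unique pair with: $x,k\in\mathbb{D}(\mathbb{R}^{+},\mathbb{H})$; $x_{t}\in\overline{\mathrm{D}(A)}$ for all $t\ge0$; $k\in\mathrm{BV}_{loc}(\mathbb{R}^{+};\mathbb{H})$, $k_{0}=0$; $x_{t}+k_{t}=m_{t}$ for all $t\ge0$; $dk^{c}_{t}\in A(x_{t})(dt)$; and $x_{t}=\Pi(x_{t-}+\Delta m_{t})$ for all $t\ge0$. *)

(* Defs.v *)
From HB Require Import structures.
From mathcomp Require Import all_boot all_order all_algebra.
From mathcomp Require Import all_classical all_reals all_analysis.
From mathcomp.analysis.showcase Require summability.

Set Implicit Arguments.
Unset Strict Implicit.
Unset Printing Implicit Defensive.

Import Order.TTheory GRing.Theory Num.Theory.
Import numFieldNormedType.Exports.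

Local Open Scope classical_set_scope.
Local Open Scope ring_scope.

(* Functions on [0, oo[ are represented by functions R -> V; every notion below
   only depends on their values on [0, oo[. *)

Section paths.
Context {R : realType} {V : normedModType R}.
Implicit Types (x k : R -> V) (a b s t : R).

Definition cadlag x :=
  (forall t : R, 0 <= t -> x s @[s --> t^'+] --> x t) /\
  (forall t : R, 0 < t -> cvg (x s @[s --> t^'-])).

(* x_{t-}, with the convention x_{0-} = x_0 *)
Definition left_lim x t : V :=
  if 0 < t then lim (x s @[s --> t^'-]) else x t.

Definition jump_at x t : V := x t - left_lim x t.

(* total variation on [a, b] *)
Definition tvar x a b : \bar R :=
  ereal_sup [set (\sum_(i < size p)
      `|x (nth b (a :: p) i.+1) - x (nth b (a :: p) i)|)%:E
    | p in itv_partition a b].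

Definition BV_loc x := forall T : R, 0 <= T -> (tvar x 0 T < +oo)%E.

(* The sum over the uncountable index set [0, t] is the limit of the net of
   finite partial sums. *)
Definition jump_part k t : V :=
  summability.sum (fun s : R => if 0 <= s <= t then jump_at k s else 0).

Definition cont_part k t : V := k t - jump_part k t.

End paths.

(* Lebesgue-Stieltjes integrals over ]s, t] of a vector-valued integrand f
   against a vector-valued integrator g, the values being paired by a bilinear
   map op.  The integral is the continuous extension, for the L^1-seminorm of
   the variation measure of g, of
     sum_j u_j 1_{]a_j, b_j]} |-> sum_j op u_j (g b_j - g a_j). *)
Section integral.
Context {R : realType} {U V W : normedModType R}.
Implicit Types (p : seq (R * R * U)) (f : R -> U) (g : R -> V) (s t : R).

Definition step_fun p (r : R) : U :=
  \sum_(q <- p | (q.1.1 < r) && (r <= q.1.2)) q.2.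

Definition step_int (op : U -> V -> W) g p : W :=
  \sum_(q <- p) op q.2 (g q.1.2 - g q.1.1).

Definition step_in s t p :=
  forall q, q \in p -> [/\ s <= q.1.1, q.1.1 <= q.1.2 & q.1.2 <= t].

Definition has_integral (mu : {measure set (measurableTypeR R) -> \bar R})
    (op : U -> V -> W) f g s t (v : W) :=
  exists p_ : nat -> seq (R * R * U),
    [/\ forall n, step_in s t (p_ n),
        forall n, measurable_fun (`]s, t]%classic : set (measurableTypeR R))
          (fun r => `|f r - step_fun (p_ n) r|),
        ((\int[mu]_(r in `]s, t]%classic) (`|f r - step_fun (p_ n) r|)%:E)%E
          @[n --> \oo] --> (0 : \bar R)%E) &
        step_int op g (p_ n) @[n --> \oo] --> v].

(* F is the variation function of g on [0, oo[, so that
   lebesgue_stieltjes_measure F is |dg| on the Borel subsets of ]0, oo[. *)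
Definition has_LS_integral (op : U -> V -> W) f g s t (v : W) :=
  exists F : cumulative R R,
    (forall r : R, 0 <= r -> (F r)%:E = tvar g 0 r) /\
    has_integral (lebesgue_stieltjes_measure F) op f g s t v.

End integral.

(* The Bochner integral of f over ]s, t] for Lebesgue measure is v. *)
Definition has_Bochner_integral {R : realType} {V : normedModType R}
    (f : R -> V) (s t : R) (v : V) :=
  has_integral (@lebesgue_measure R) (fun (u : V) (r : R^o) => r *: u)
    f idfun s t v.

Section monotone_operators.
Context {R : realType} {H : normedModType R} (dot : {dot H for idfun}).
Implicit Types (A : H -> set H) (x y l m k : R -> H).

Definition Dom A : set H := [set z | A z !=set0].

Definition monotone_op A :=
  forall z z' y y' : H, A z y -> A z' y' -> 0 <= dot (z - z') (y - y').

Definition maximal_monotone A :=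
  monotone_op A /\
  forall B : H -> set H, monotone_op B ->
    (forall z, A z `<=` B z) -> forall z, B z `<=` A z.

(* [get] selects the unique element of the set (I + eps A)^-1 (z). *)
Definition resolvent A (eps : R) (z : H) : H :=
  get [set u | exists2 y, A u y & u + eps *: y = z].

Definition yosida A (eps : R) (z : H) : H :=
  eps^-1 *: (z - resolvent A eps z).

Definition projection (C : set H) (z : H) : H :=
  get [set p | C p /\ forall c, C c -> `|z - p| <= `|z - c|].

Definition yosida_solution A (eps : R) m x :=
  cadlag x /\
  forall t : R, 0 <= t ->
    exists2 v, has_Bochner_integral (fun s => yosida A eps (x s)) 0 t v
      & x t + v = m t.

(* dl_t \in A(y_t)(dt) *)
Definition driven_by A y l :=
  forall s t : R, 0 <= s -> s <= t -> forall alpha beta, A alpha beta ->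
    exists2 v : R^o,
      has_LS_integral (W := R^o) dot (fun r => y r - alpha)
        (fun r => l r - r *: beta) s t v
      & 0 <= v.

(* (x, k) = SP(A, Pi; m) *)
Definition SP A (Pi : H -> H) m x k :=
  [/\ cadlag x /\ cadlag k,
      forall t : R, 0 <= t -> closure (Dom A) (x t),
      BV_loc k /\ k 0 = 0,
      forall t : R, 0 <= t -> x t + k t = m t &
      driven_by A x (cont_part k) /\
      forall t : R, 0 <= t -> x t = Pi (left_lim x t + jump_at m t)].

End monotone_operators.

(* Main.v *)
Require Import Defs.
From HB Require Import structures.
From mathcomp Require Import all_boot all_order all_algebra.
From mathcomp Require Import finmap.
From mathcomp Require Import all_classical all_reals all_analysis.
From mathcomp Require Import measurable_realfun ring lra.
From mathcomp.analysis.showcase Require summability.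

Set Implicit Arguments.
Unset Strict Implicit.
Unset Printing Implicit Defensive.

Import Order.TTheory GRing.Theory Num.Theory.
Import numFieldNormedType.Exports.

Local Open Scope classical_set_scope.
Local Open Scope ring_scope.

(** Write [K = m - xe], [g = yosida A eps xe] and [e = k - K = xe - x], and let
[C] be the closure of the domain.  Since the jumps of [k] are normal to [C], the
inclusion [dk in A(x) dt] also holds for the jump part, evaluated at the
right limit [x_t].  With [eps g = xe - J xe] and monotonicity of [A] this gives
formally [d|e|^2 <= 2 eps |g| d|k| - 2 eps |g|^2 dt].

As the domain has an interior point, the variation of [K] on bounded intervals
is bounded uniformly in [eps].  On an interval where [m] oscillates little,
comparing [xe] with its own time translates shows that [eps |g|] becomes small
after an arbitrarily short initial layer.  In the layer the term
[2 eps |g|^2 dt] dominates the decrease of [dist(xe, C)^2], and a jump turns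
[|xe - x|^2] before the jump into [|xe - x|^2 - dist(xe, C)^2] after it, so the
left limits of [xe - x] propagate across jumps.  Hence [K t] tends to the left
limit of [k] at [t] for every [t], which is the claim. *)

(** No differential inequality is integrated directly. Each is checked to first order on the right
    of every point, with an error [w * (t - s + (V t - V s))] for arbitrary [w], and at left limits;
    [nonincreasing_of_right_approx] then gives monotonicity. The integrals of the definitions enter
    only through the first-order estimate [has_integral_approx]. The obstacle is the layer after a
    jump of [m]. There [eps |g|] is merely bounded, however small [eps] is, so the error
    [2 eps |g| d|k|] is controlled by a layer so short that [k] varies little in it; this uses that
    the variation of [k] is right continuous. The length of the layer is fixed before [eps]. Over an
    interval where [m] oscillates by at most [sigma ^+ 2], the squared gap between the left limit of
    [k] and [K] grows by multiples of [sigma] and [sigma ^+ 2] times the increments of the two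
    variations, plus an arbitrarily small [kap]. The former errors telescope and [kap] is chosen
    after [sigma], so the number of intervals, which depends on [sigma], is harmless. *)

Section chaining.
Context {R : realType}.

(** * Induction along a real interval *)

Lemma exists_gt_near (s b d : R) : s < b -> 0 < d ->
  exists2 t, s < t < s + d & t <= b.
Proof.
move=> sb d0; case: (leP (s + d / 2) b) => h.
  by exists (s + d / 2); lra.
by exists b; lra.
Qed.

(** A supremum argument that replaces finite partitions. The condition at [t] concerns only
    intervals that end at [t], so that it can be verified by left limits even if a path jumps at
    [t]. *)
Lemma interval_chain (P : R -> R -> Prop) (a b : R) : a < b ->
  (forall s u t, a <= s -> s < u -> u < t -> t <= b ->
    P s u -> P u t -> P s t) ->
  (forall s, a <= s < b ->
    exists2 d, 0 < d & forall t, s < t < s + d -> t <= b -> P s t) ->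
  (forall t, a < t <= b ->
    exists2 d, 0 < d & forall s, t - d < s < t -> a <= s -> P s t) ->
  P a b.
Proof.
move=> ab Ptr Pr Pl.
pose S := [set t | a < t <= b /\ P a t].
have step s : a <= s < b -> exists2 t, s < t <= b & P s t.
  move=> sab; have [d d0 Pd] := Pr s sab.
  have [t st tb] := @exists_gt_near s b d ltac:(lra) d0.
  by exists t; [lra | apply: Pd].
have [n0 n0ab Pan0] := step a ltac:(lra).
have Sn : S n0 by split.
have ubS : ubound S b by move=> t [] /andP[].
have hS : has_sup S by split; [exists n0 | exists b].
have acb : a < sup S <= b.
  have := ub_le_sup hS.2 Sn.
  have : sup S <= b by apply: ge_sup => //; exists n0.
  lra.
have Pc : P a (sup S).
  have [e e0 Pe] := Pl _ acb.
  have [t [/andP[at_ tb] Pat] tS] := sup_adherent e0 hS.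
  have tc : t <= sup S by apply: (ub_le_sup hS.2); split; [lra|].
  move: tc; rewrite le_eqVlt => /orP[/eqP <- //|tc].
  by apply: (Ptr a t) => //; [lra | apply: Pe; lra].
case: (ltP (sup S) b) => cb; last by rewrite (_ : b = sup S) //; lra.
have [t tab Pt] := step (sup S) ltac:(lra).
have : S t.
  split; first lra.
  by apply: (Ptr a (sup S)) => //; lra.
by move=> /(ub_le_sup hS.2); lra.
Qed.

(** The condition on the left asks only that common upper bounds pass to [t]; it is weaker than left
    continuity and permits downward jumps. *)
Lemma nonincreasing_of_right (f : R -> R) (a b : R) : a <= b ->
  (forall s, a <= s < b ->
    exists2 d, 0 < d & forall t, s < t < s + d -> t <= b -> f t <= f s) ->
  (forall t c, a < t <= b -> (forall u, a <= u < t -> f u <= c) -> f t <= c) ->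
  f b <= f a.
Proof.
move=> ab fr fl.
move: ab; rewrite le_eqVlt => /orP[/eqP -> //|ab].
pose S := [set t | a <= t <= b /\ forall u, a <= u <= t -> f u <= f a].
have Sa : S a by split=> [|u ?]; [lra | rewrite (_ : u = a) //; lra].
have ubS : ubound S b by move=> t [] /andP[].
have hS : has_sup S by split; [exists a | exists b].
have acb : a <= sup S <= b.
  have := ub_le_sup hS.2 Sa.
  have : sup S <= b by apply: ge_sup => //; exists a.
  lra.
have below u : a <= u < sup S -> f u <= f a.
  move=> uc; have e0 : 0 < sup S - u by lra.
  have [t [tab ft] tS] := sup_adherent e0 hS.
  by apply: ft; lra.
have fc : f (sup S) <= f a.
  case: (ltP a (sup S)) => ac; last by rewrite (_ : sup S = a) //; lra.
  by apply: fl => //; lra.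
case: (ltP (sup S) b) => cb; last by rewrite (_ : b = sup S) //; lra.
have [d d0 fd] := fr (sup S) ltac:(lra).
have [t t1 t2] := exists_gt_near cb d0.
have : S t.
  split=> [|u ut]; first lra.
  case: (ltP u (sup S)) => uc; first by apply: below; lra.
  case: (ltP (sup S) u) => uc'; last by rewrite (_ : u = sup S) //; lra.
  by apply: le_trans fc; apply: fd; lra.
by move=> /(ub_le_sup hS.2); lra.
Qed.

(** [nonincreasing_of_right] applies to [f t - w * (t + V t)], then [w] tends to 0. An upward jump
    of [V] at [t] only lowers this function, so the left condition survives. *)
Lemma nonincreasing_of_right_approx (f V : R -> R) (a b : R) : a <= b ->
  (forall s t, a <= s -> s <= t -> t <= b -> V s <= V t) ->
  (forall w s, 0 < w -> a <= s < b ->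
    exists2 d, 0 < d & forall t, s < t < s + d -> t <= b ->
      f t <= f s + w * (t - s + (V t - V s))) ->
  (forall t c, a < t <= b -> (forall u, a <= u < t -> f u <= c) -> f t <= c) ->
  f b <= f a.
Proof.
move=> ab Vnd fr fl.
have H w : 0 < w -> f b - w * (b + V b) <= f a - w * (a + V a).
  move=> w0.
  apply: (@nonincreasing_of_right (fun t => f t - w * (t + V t))) => //.
    move=> s sab; have [d d0 fd] := fr w s w0 sab.
    by exists d => // t st tb; have := fd t st tb; lra.
  move=> t c tab fu; rewrite lerBlDr; apply: fl => // u ut.
  rewrite -lerBlDr; apply: le_trans (fu u ut).
  have h : V u <= V t by apply: Vnd; lra.
  by rewrite lerD2l lerN2 ler_pM2l // lerD //; lra.
apply/ler_addgt0Pr => e e0.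
have Vab := Vnd a b (lexx _) ab (lexx _).
have den : 0 < b - a + (V b - V a) + 1 by lra.
have := H (e / (b - a + (V b - V a) + 1)) ltac:(by apply: divr_gt0).
have -> : e / (b - a + (V b - V a) + 1) * (b + V b) =
  e / (b - a + (V b - V a) + 1) * (a + V a) +
  (e - e / (b - a + (V b - V a) + 1)) by field; lra.
have : 0 < e / (b - a + (V b - V a) + 1) by apply: divr_gt0.
lra.
Qed.

End chaining.

(** * Cadlag paths in epsilon-delta form *)

Section cadlag_facts.
Context {R : realType} {V : normedModType R}.
Implicit Types (x y : R -> V).

Definition right_cont x s := forall w, 0 < w ->
  exists2 d, 0 < d & forall r, s <= r < s + d -> `|x r - x s| <= w.

Definition has_left_lim x t l := forall w, 0 < w ->
  exists2 d, 0 < d & forall r, t - d < r < t -> `|x r - l| <= w.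

Lemma cadlag_right_cont x s : cadlag x -> 0 <= s -> right_cont x s.
Proof.
move=> [xr _] s0 w w0; have /cvgrPdist_le /(_ w w0) := xr s s0.
case=> d /= d0 hd; exists d => // r /andP[sr rd].
move: sr; rewrite le_eqVlt => /orP[/eqP <-|sr]; first by rewrite subrr normr0 ltW.
rewrite distrC; apply: hd => //=.
by rewrite distrC ger0_norm; lra.
Qed.

Lemma cadlag_has_left_lim x t : cadlag x -> 0 < t ->
  has_left_lim x t (left_lim x t).
Proof.
move=> [_ xl] t0 w w0; rewrite /left_lim t0.
have /cvgrPdist_le /(_ w w0) := xl t t0.
case=> d /= d0 hd; exists d => // r /andP[tr rt].
rewrite distrC; apply: hd => //=.
by rewrite ger0_norm; lra.
Qed.

Lemma left_lim0 x : left_lim x 0 = x 0.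
Proof. by rewrite /left_lim ltxx. Qed.

Lemma has_left_lim_unique x t l l' :
  has_left_lim x t l -> has_left_lim x t l' -> l = l'.
Proof.
move=> h h'; apply/eqP; rewrite -subr_eq0 -normr_le0; apply/ler_addgt0Pr => e e0.
rewrite add0r.
have [d d0 hd] := h (e / 2) ltac:(lra).
have [d' d0' hd'] := h' (e / 2) ltac:(lra).
have [r [r1 r2]] : exists r, t - d < r < t /\ t - d' < r < t.
  case: (leP d d') => dd.
    by exists (t - d / 2); lra.
  by exists (t - d' / 2); lra.
have -> : l - l' = - (x r - l) + (x r - l') by rewrite opprB addrA subrK.
rewrite (le_trans (ler_normD _ _))// normrN.
have := hd r r1; have := hd' r r2; lra.
Qed.

Lemma has_left_limD x y t l l' : has_left_lim x t l -> has_left_lim y t l' ->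
  has_left_lim (fun r => x r + y r) t (l + l').
Proof.
move=> h h' w w0.
have [d d0 hd] := h (w / 2) ltac:(lra).
have [d' d0' hd'] := h' (w / 2) ltac:(lra).
have [e [e0 ed ed']] : exists e, [/\ 0 < e, e <= d & e <= d'].
  by case: (leP d d') => dd; [exists d | exists d']; split => //; lra.
exists e => // r rt; rewrite opprD addrACA.
rewrite (le_trans (ler_normD _ _))//.
have := hd r ltac:(lra); have := hd' r ltac:(lra); lra.
Qed.

Lemma has_left_lim_closure (C : set V) x t l : closed C ->
  0 < t -> (forall r, 0 <= r < t -> C (x r)) -> has_left_lim x t l -> C l.
Proof.
move=> clC t0 Cx h; apply: clC => B /nbhs_ballP[e /= e0 eB].
have [d d0 hd] := h (e / 2) ltac:(lra).
have [r [r1 r2]] : exists r, t - d < r < t /\ 0 <= r.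
  case: (leP d t) => dd; first by exists (t - d / 2); lra.
  by exists (t / 2); lra.
exists (x r); split; first by apply: Cx; lra.
apply: eB; rewrite -ball_normE /=; apply: (le_lt_trans (y := e / 2)); last lra.
by rewrite distrC hd.
Qed.

Lemma le_of_has_left_lim (phi : R -> R) t l c :
  (forall w, 0 < w -> exists2 d, 0 < d &
     forall r, t - d < r < t -> l - w <= phi r) ->
  (exists2 d, 0 < d & forall r, t - d < r < t -> phi r <= c) -> l <= c.
Proof.
move=> h [d d0 hd]; apply/ler_addgt0Pr => e e0.
have [d' d0' hd'] := h e e0.
have [r [r1 r2]] : exists r, t - d < r < t /\ t - d' < r < t.
  case: (leP d d') => dd.
    by exists (t - d / 2); lra.
  by exists (t - d' / 2); lra.
have := hd r r1; have := hd' r r2; lra.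
Qed.

Lemma cadlag_bounded x T : cadlag x -> 0 <= T ->
  exists2 B, 0 <= B & forall r, 0 <= r <= T -> `|x r| <= B.
Proof.
move=> cx T0; have [T0'|T0'] := leP T 0.
  exists `|x 0| => // r rT; by rewrite (_ : r = 0) //; lra.
pose P s t := exists2 B, 0 <= B & forall r, s <= r <= t -> `|x r| <= B.
apply: (@interval_chain _ P 0 T) => //.
- move=> s u t _ su ut _ [B B0 hB] [B' B0' hB']; exists (B + B') => [|r rst].
    lra.
  case: (leP r u) => ru; first by have := hB r ltac:(lra); lra.
  by have := hB' r ltac:(lra); lra.
- move=> s s0; have [d d0 hd] := @cadlag_right_cont x s cx ltac:(lra) 1 ltac:(lra).
  exists d => // t st tT; exists (`|x s| + 1) => [|r rst].
    by have := normr_ge0 (x s); lra.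
  have := hd r ltac:(lra); have := ler_normD (x r - x s) (x s).
  by rewrite subrK; lra.
- move=> t t0.
  have [d d0 hd] := @cadlag_has_left_lim x t cx ltac:(lra) 1 ltac:(lra).
  exists d => // s st s0; exists (`|left_lim x t| + 1 + `|x t|) => [|r rst].
    by have := normr_ge0 (x t); have := normr_ge0 (left_lim x t); lra.
  case: (ltP r t) => rt; last first.
    rewrite (_ : r = t); last lra.
    by have := normr_ge0 (left_lim x t); lra.
  have := hd r ltac:(lra); have := ler_normD (x r - left_lim x t) (left_lim x t).
  by rewrite subrK; have := normr_ge0 (x t); lra.
Qed.

End cadlag_facts.

Lemma exists_small {R : realType} (a b : R) : 0 < a -> 0 < b ->
  exists2 e, 0 < e & e <= a /\ e <= b.
Proof.
by move=> a0 b0; case: (leP a b) => ab; [exists a | exists b => //; split => //; exact: ltW].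
Qed.

Lemma closureP_norm {R : realType} {V : normedModType R} (C : set V) z :
  (forall e, 0 < e -> exists2 x, C x & `|x - z| < e) <-> closure C z.
Proof.
split=> [h B /nbhs_ballP[e /= e0 eB]|h e e0].
  have [x Cx xz] := h e e0; exists x; split => //; apply: eB.
  by rewrite -ball_normE /= distrC.
have [x [Cx]] := h _ (nbhsx_ballx z e e0).
by rewrite -ball_normE /= distrC => xz; exists x.
Qed.

(** * Inner products, strongly convex minimization and projections *)

Section inner_product.
Context {R : realType} {H : completeNormedModType R}.
Variable dot : {dot H for idfun}.
Hypothesis dot_norm : forall u : H, `|u| ^+ 2 = dot u u.
Implicit Types u v w : H.

Lemma dotC u v : dot u v = dot v u.
Proof. by rewrite [LHS](hermC dot) /= expr0 mul1r. Qed.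

Lemma dotDl u v w : dot (u + v) w = dot u w + dot v w.
Proof. exact: linearDl. Qed.

Lemma dotDr u v w : dot u (v + w) = dot u v + dot u w.
Proof. exact: linearDr. Qed.

Lemma dotNl u v : dot (- u) v = - dot u v.
Proof. exact: linearNl. Qed.

Lemma dotNr u v : dot u (- v) = - dot u v.
Proof. exact: linearNr. Qed.

Lemma dotZl a u v : dot (a *: u) v = a * dot u v.
Proof. exact: linearZl_LR. Qed.

Lemma dotZr a u v : dot u (a *: v) = a * dot u v.
Proof. exact: linearZr_LR. Qed.

Lemma dot0l u : dot 0 u = 0.
Proof. exact: linear0l. Qed.

Lemma dot0r u : dot u 0 = 0.
Proof. exact: linear0r. Qed.

Definition dotE := (dotDl, dotDr, dotNl, dotNr, dotZl, dotZr, dot0l, dot0r).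

Lemma dot_ge0 u : 0 <= dot u u.
Proof. by rewrite -dot_norm exprn_ge0. Qed.

Lemma dot_le_norm u v : dot u v <= `|u| * `|v|.
Proof.
have := dot_ge0 (`|v| *: u - `|u| *: v).
rewrite !dotE -!dot_norm (dotC v u).
have := normr_ge0 u; have := normr_ge0 v.
rewrite le_eqVlt => /orP[/eqP/esym v0|v0].
  by move/normr0_eq0: v0 => ->; rewrite dot0r normr0 mulr0.
rewrite le_eqVlt => /orP[/eqP/esym u0|u0].
  by move/normr0_eq0: u0 => ->; rewrite dot0l normr0 mul0r.
have uv : 0 < `|u| * `|v| by rewrite mulr_gt0.
move=> h; rewrite -(ler_pM2l uv); nra.
Qed.

Lemma dot_ge_norm u v : - (`|u| * `|v|) <= dot u v.
Proof.
by have := dot_le_norm (- u) v; rewrite dotNl normrN => h; rewrite lerNl.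
Qed.

Lemma norm_dot_le u v : `|dot u v| <= `|u| * `|v|.
Proof. by rewrite ler_norml dot_le_norm dot_ge_norm. Qed.

Lemma dot_eq0 u : dot u u <= 0 -> u = 0.
Proof.
rewrite -dot_norm => h; apply: normr0_eq0; apply/eqP.
by rewrite -sqrf_eq0 eq_le h exprn_ge0.
Qed.

Lemma dot_ext u v : (forall w, dot w u = dot w v) -> u = v.
Proof.
move=> h; apply/eqP; rewrite -subr_eq0; apply/eqP; apply: dot_eq0.
by rewrite dotDr dotNr h subrr.
Qed.

(** Polarization reduces the continuity of [dot] to that of the norm. *)
Lemma cvg_dot (u v : nat -> H) a b : u n @[n --> \oo] --> a ->
  v n @[n --> \oo] --> b -> dot (u n) (v n) @[n --> \oo] --> dot a b.
Proof.
move=> ua vb.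
have E n : dot (u n) (v n) =
    2^-1 * (`|u n + v n| ^+ 2 - `|u n| ^+ 2 - `|v n| ^+ 2).
  by rewrite !dot_norm !dotE (dotC (v n)); field.
under eq_fun do rewrite E.
have -> : dot a b = 2^-1 * (`|a + b| ^+ 2 - `|a| ^+ 2 - `|b| ^+ 2).
  by rewrite !dot_norm !dotE (dotC b); field.
have sq (z : nat -> H) c : z n @[n --> \oo] --> c ->
    `|z n| ^+ 2 @[n --> \oo] --> (`|c| ^+ 2 : R).
  by move=> zc; under eq_fun do rewrite expr2; rewrite expr2; apply: cvgM; apply: cvg_norm.
apply: cvgMr; apply: cvgB; last exact: sq.
apply: cvgB; last exact: sq.
by apply: sq; exact: cvgD.
Qed.

Lemma lim_ge_seq (u : nat -> R) (a c : R) : u n @[n --> \oo] --> a ->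
  (forall n, c <= u n) -> c <= a.
Proof.
move=> ua cu; rewrite -(cvg_lim _ ua)//; apply: limr_ge; first by apply/cvg_ex; exists a.
by apply: nearW.
Qed.

Lemma cauchy_cvg (u : nat -> H) (e : nat -> R) : e n @[n --> \oo] --> (0 : R) ->
  (forall n p, `|u n - u p| ^+ 2 <= e n + e p) -> exists l : H, u n @[n --> \oo] --> l.
Proof.
move=> e0 ue; apply/cvg_ex; apply/cauchy_cvgP/cauchy_ballP => d d0.
have d2 : 0 < d ^+ 2 / 2 by rewrite divr_gt0 ?exprn_gt0.
have /cvgrPdist_lt /(_ _ d2) [N _ hN] := e0.
exists ([set x | exists2 n, (N <= n)%N & x = u n],
        [set x | exists2 n, (N <= n)%N & x = u n]) => /=.
  by split; exists N => // n /= Nn; exists n.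
move=> [x y] /= [[n Nn ->] [p Np ->]].
rewrite -ball_normE /= -(ltr_pXn2r (n := 2))//; last 2 first.
- by rewrite nnegrE.
- by rewrite nnegrE ltW.
apply: (le_lt_trans (ue n p)).
have := hN n Nn; have := hN p Np; rewrite !sub0r !normrN !ltr_norml; lra.
Qed.

(** [Q] stands for the epigraph of a strongly convex, lower semicontinuous function on [H * H]; a
    predicate accommodates infinite values. The gain with factor [1 / 8] at midpoints is that of
    half the squared norm, and it makes minimizing sequences Cauchy. *)
Lemma strictly_convex_min (Q : H -> H -> R -> Prop) :
  (exists x y t, Q x y t) ->
  (forall x y t, Q x y t -> 0 <= t) ->
  (forall x y t x' y' t', Q x y t -> Q x' y' t' ->
    Q (2^-1 *: (x + x')) (2^-1 *: (y + y'))
      ((t + t') / 2 - (`|x - x'| ^+ 2 + `|y - y'| ^+ 2) / 8)) ->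
  (forall (x y : nat -> H) (t : nat -> R) a b c, (forall n, Q (x n) (y n) (t n)) ->
    x n @[n --> \oo] --> a -> y n @[n --> \oo] --> b ->
    t n @[n --> \oo] --> c -> Q a b c) ->
  exists x y t, Q x y t /\ forall x' y' t', Q x' y' t' -> t <= t'.
Proof.
move=> [x0 [y0 [t0 Q0]]] Qge0 Qmid Qcl.
pose S := [set t | exists x y, Q x y t].
have S0 : S !=set0 by exists t0, x0, y0.
have lbS : lbound S 0 by move=> t [x [y /Qge0]].
have hS : has_inf S by split => //; exists 0.
have step n : exists z : H * H * R, Q z.1.1 z.1.2 z.2 /\ z.2 < inf S + n.+1%:R^-1.
  have n0 : (0 : R) < n.+1%:R^-1 by rewrite invr_gt0.
  have [t [x [y Qt]] tlt] := inf_adherent n0 hS.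
  by exists (x, y, t).
have [z Hz] := choice step.
have infle x y t : Q x y t -> inf S <= t.
  by move=> Qt; apply: ge_inf; [exists 0 | exists x, y].
have e0 : (4 * n.+1%:R^-1 : R) @[n --> \oo] --> (0 : R).
  by rewrite -[X in _ --> X](mulr0 4); apply: cvgMr; exact: cvg_harmonic.
have key n p : `|(z n).1.1 - (z p).1.1| ^+ 2 + `|(z n).1.2 - (z p).1.2| ^+ 2 <=
    4 * n.+1%:R^-1 + 4 * p.+1%:R^-1.
  have [Qn tn] := Hz n; have [Qp tp] := Hz p.
  have := infle _ _ _ (Qmid _ _ _ _ _ _ Qn Qp).
  by move: tn tp; move: (n.+1%:R^-1) (p.+1%:R^-1) => i j; lra.
have [a ua] : exists a : H, (z n).1.1 @[n --> \oo] --> a.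
  apply: (cauchy_cvg e0) => n p; apply: le_trans (key n p).
  by rewrite lerDl exprn_ge0.
have [b ub] : exists b : H, (z n).1.2 @[n --> \oo] --> b.
  apply: (cauchy_cvg e0) => n p; apply: le_trans (key n p).
  by rewrite lerDr exprn_ge0.
have uc : (z n).2 @[n --> \oo] --> inf S.
  apply: (@squeeze_cvgr _ _ _ _ (fun=> inf S) (fun n => inf S + harmonic n)).
  - apply: nearW => n; have [Qn tn] := Hz n.
    by rewrite (infle _ _ _ Qn) ltW.
  - exact: cvg_cst.
  - by rewrite -[X in _ --> X]addr0; apply: cvgD; [exact: cvg_cst | exact: cvg_harmonic].
exists a, b, (inf S); split; last exact: infle.
by apply: Qcl ua ub uc => n; exact: (Hz n).1.
Qed.

Lemma norm_mid u v : `|2^-1 *: (u + v)| ^+ 2 =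
  (`|u| ^+ 2 + `|v| ^+ 2) / 2 - `|u - v| ^+ 2 / 4.
Proof. by rewrite !dot_norm !dotE (dotC v u); field. Qed.

(** The obtuse angle criterion, which is the form used in the estimates; [projection_specP] carries
    it over to the metric definition [projection]. *)
Definition projection_spec (C : set H) z p :=
  C p /\ forall c, C c -> dot (z - p) (c - p) <= 0.

Lemma projection_exists (C : set H) z : C !=set0 -> closed C ->
  (forall u v a, C u -> C v -> 0 <= a <= 1 -> C (a *: u + (1 - a) *: v)) ->
  exists p, projection_spec C z p.
Proof.
move=> [c0 Cc0] clC cvxC.
(* The second variable is frozen at 0, which leaves half the squared distance to [z] on [C]. *)
have [||||p [y [t [[Cp _ tp] tmin]]]] := @strictly_convex_min
    (fun x y t => [/\ C x, y = 0 & `|z - x| ^+ 2 / 2 <= t]).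
- by exists c0, 0, (`|z - c0| ^+ 2 / 2).
- by move=> x y t [_ _]; apply: le_trans; rewrite divr_ge0 ?exprn_ge0.
- move=> x y t x' y' t' [Cx -> xt] [Cx' -> xt']; split.
  + have := cvxC _ _ 2^-1 Cx Cx' ltac:(lra).
    by rewrite (_ : 1 - 2^-1 = 2^-1 :> R) -?scalerDr //; lra.
  + by rewrite addr0 scaler0.
  + have -> : z - 2^-1 *: (x + x') = 2^-1 *: ((z - x) + (z - x')).
      by apply: dot_ext => w; rewrite !dotE; field.
    rewrite norm_mid subr0 normr0 expr0n addr0.
    have -> : z - x - (z - x') = - (x - x') by rewrite opprB addrC addrA subrK opprB.
    by rewrite normrN; lra.
- move=> x y t a b c Q xa yb tc; split.
  + apply: (closed_cvg C clC _ _ xa); apply: nearW => n; by case: (Q n).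
  + have E : y = fun=> 0 by apply/funext => n; case: (Q n).
    by move: yb; rewrite E => /(cvg_lim (@norm_hausdorff _ _)) <-; rewrite lim_cst//.
  + rewrite -subr_ge0; apply: (@lim_ge_seq (fun n => t n - `|z - x n| ^+ 2 / 2)).
      apply: cvgB => //; apply: cvgMl; rewrite expr2; under eq_fun do rewrite expr2.
      by apply: cvgM; apply: cvg_norm; apply: cvgB => //; exact: cvg_cst.
    by move=> n; have [_ _] := Q n; rewrite subr_ge0.
exists p; split => // c Cc; rewrite leNgt; apply/negP => h.
pose N := `|c - p| ^+ 2 + 1.
have N0 : 0 < N by rewrite ltr_wpDl ?exprn_ge0.
(* A move of size [a] from [p] towards [c] must gain more to first order than the quadratic term
   [a ^+ 2 * |c - p| ^+ 2] costs, against the minimality of [p]. *)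
have [a a01 ah] : exists2 a : R, 0 < a <= 1 & a * N <= dot (z - p) (c - p).
  case: (leP N (dot (z - p) (c - p))) => hN; first by exists 1; lra.
  exists (dot (z - p) (c - p) / N); last by rewrite divfK // gt_eqF.
  by rewrite divr_gt0 //= ler_pdivrMr // mul1r ltW.
have := tmin (a *: c + (1 - a) *: p) 0 (`|z - (a *: c + (1 - a) *: p)| ^+ 2 / 2).
have -> : z - (a *: c + (1 - a) *: p) = z - p - a *: (c - p).
  by apply: dot_ext => w; rewrite !dotE; ring.
have Q : [/\ C (a *: c + (1 - a) *: p), (0 : H) = 0 &
    `|z - (a *: c + (1 - a) *: p)| ^+ 2 / 2 <= `|z - (a *: c + (1 - a) *: p)| ^+ 2 / 2].
  by split => //; apply: cvxC => //; lra.
move: Q; have -> : z - (a *: c + (1 - a) *: p) = z - p - a *: (c - p).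
  by apply: dot_ext => w; rewrite !dotE; ring.
move=> Q /(_ Q); apply/negP; rewrite -ltNge; apply: lt_le_trans tp.
have -> : `|z - p - a *: (c - p)| ^+ 2 =
    `|z - p| ^+ 2 - 2 * a * dot (z - p) (c - p) + a ^+ 2 * `|c - p| ^+ 2.
  move: (z - p) (c - p) => u v.
  by rewrite !dot_norm !dotE (dotC v u); ring.
suff : a ^+ 2 * `|c - p| ^+ 2 < 2 * a * dot (z - p) (c - p) by lra.
rewrite expr2 -mulrA (mulrC 2) -mulrA ltr_pM2l; last lra.
have : a * `|c - p| ^+ 2 < a * N by rewrite ltr_pM2l /N; lra.
lra.
Qed.


Lemma projection_spec_unique (C : set H) z p q :
  projection_spec C z p -> projection_spec C z q -> p = q.
Proof.
move=> [Cp hp] [Cq hq]; apply/eqP; rewrite -subr_eq0; apply/eqP; apply: dot_eq0.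
have := hp q Cq; have := hq p Cp; rewrite !dotE (dotC p q); lra.
Qed.

Lemma projection_spec_nearest (C : set H) z p c :
  projection_spec C z p -> C c -> `|z - p| <= `|z - c|.
Proof.
move=> [_ hp] /hp h; rewrite -(ler_pXn2r (n := 2))// ?nnegrE//.
have := dot_ge0 (c - p); rewrite !dot_norm.
move: h; rewrite !dotE (dotC p z) (dotC c z) (dotC p c); lra.
Qed.

Lemma projection_specP (C : set H) z p :
  projection_spec C z p -> projection_spec C z (projection C z).
Proof.
move=> pp; rewrite (_ : projection C z = p) //.
apply: get_unique => [|q [Cq hq]].
  by split; [exact: pp.1 | move=> c; exact: projection_spec_nearest].
have := hq p pp.1; have [Cp hp] := pp; have h := hp q Cq.
rewrite -(ler_pXn2r (n := 2))// ?nnegrE// !dot_norm => h2.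
apply/eqP; rewrite -subr_eq0; apply/eqP; apply: dot_eq0.
move: h h2; rewrite !dotE (dotC p z) (dotC q z) (dotC p q); lra.
Qed.

(** * Minty's theorem *)

Section maximal_monotone.
Variable A : H -> set H.
Hypothesis A_mono : monotone_op dot A.
Hypothesis A_max : forall x y,
  (forall a b, A a b -> 0 <= dot (x - a) (y - b)) -> A x y.
Hypothesis A_ne : exists a b, A a b.

(* Simons and Zalinescu's proof of Minty's theorem: [t] below runs over the
   values of [phi(x,y) + |x|^2/2 + |y|^2/2] or more, where [phi] is the
   Fitzpatrick function of [A]. *)
Lemma minty0 : exists x, A x (- x).
Proof.
have [a0 [b0 A0]] := A_ne.
pose Q x y t := forall a b, A a b ->
  dot x b + dot a y - dot a b + `|x| ^+ 2 / 2 + `|y| ^+ 2 / 2 <= t.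
(* Maximality enters here: the Fitzpatrick function dominates [dot x y], since a smaller value would
   put [(x, y)] in the graph, where equality holds. *)
have QA x y t : Q x y t -> dot x y + `|x| ^+ 2 / 2 + `|y| ^+ 2 / 2 <= t.
  move=> Qt; rewrite leNgt; apply/negP => h.
  have Axy : A x y.
    apply: A_max => a b /Qt; rewrite !dotE; lra.
  have := Qt x y Axy; lra.
have Aq a b : A a b -> Q a b (dot a b + `|a| ^+ 2 / 2 + `|b| ^+ 2 / 2).
  move=> Aab a' b' A'; have := A_mono Aab A'; rewrite !dotE; lra.
have [||||x0 [y0 [t [Q0 tmin]]]] := @strictly_convex_min Q.
- by exists a0, b0; eexists; exact: Aq A0.
- move=> x y t /QA; have := dot_ge0 (x + y).
  by rewrite !dot_norm !dotE (dotC y x); lra.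
- move=> x y t x' y' t' h h' a b Aab; have := h a b Aab; have := h' a b Aab.
  by rewrite !norm_mid !dotE; lra.
- move=> x y t a b c Qn xa yb tc a' b' A'; rewrite -subr_ge0.
  pose f n := t n - (dot (x n) b' + dot a' (y n) - dot a' b' +
    dot (x n) (x n) / 2 + dot (y n) (y n) / 2).
  apply: (@lim_ge_seq f); last first.
    by move=> n; have := Qn n a' b' A'; rewrite /f subr_ge0 !dot_norm.
  rewrite !dot_norm; apply: cvgB => //.
  apply: cvgD; last by apply: cvgMl; exact: cvg_dot.
  apply: cvgD; last by apply: cvgMl; exact: cvg_dot.
  apply: cvgB; last exact: cvg_cst.
  by apply: cvgD; apply: cvg_dot => //; exact: cvg_cst.
(* Optimality of [(x0, y0)] along the segment towards [(a, b)], where the Fitzpatrick function is at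
   most [dot a b]. The parameter [s] is so small that the quadratic terms contribute at most [e]. *)
have first_order a b : A a b -> dot x0 y0 + `|x0| ^+ 2 + `|y0| ^+ 2 <=
    dot a b + dot a x0 + dot b y0.
  move=> Aab; apply/ler_addgt0Pr => e e0.
  pose N := (`|a - x0| ^+ 2 + `|b - y0| ^+ 2) / 2 + e.
  have N0 : 0 < N by rewrite ltr_wpDl // divr_ge0 // addr_ge0 ?exprn_ge0.
  pose s := e / N.
  have s01 : 0 < s <= 1.
    rewrite divr_gt0 //= ler_pdivrMr // mul1r /N lerDr.
    by rewrite divr_ge0 // addr_ge0 ?exprn_ge0.
  have sN : s * N = e by rewrite divfK // gt_eqF.
  have Qs : Q (x0 + s *: (a - x0)) (y0 + s *: (b - y0))
    ((1 - s) * (t - `|x0| ^+ 2 / 2 - `|y0| ^+ 2 / 2) + s * dot a b +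
     `|x0 + s *: (a - x0)| ^+ 2 / 2 + `|y0 + s *: (b - y0)| ^+ 2 / 2).
    move=> a' b' A'; rewrite lerD2r lerD2r.
    have h1 : dot x0 b' + dot a' y0 - dot a' b' <= t - `|x0| ^+ 2 / 2 - `|y0| ^+ 2 / 2.
      have := Q0 a' b' A'; lra.
    have h2 : dot a b' + dot a' b - dot a' b' <= dot a b.
      have := A_mono Aab A'; rewrite !dotE; lra.
    have -> : dot (x0 + s *: (a - x0)) b' + dot a' (y0 + s *: (b - y0)) - dot a' b' =
      (1 - s) * (dot x0 b' + dot a' y0 - dot a' b') +
      s * (dot a b' + dot a' b - dot a' b') by rewrite !dotE; ring.
    by rewrite lerD // ler_wpM2l //; lra.
  have := tmin _ _ _ Qs.
  have := QA _ _ _ Q0; set tau := t - _ - _ => h.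
  have -> : t = tau + `|x0| ^+ 2 / 2 + `|y0| ^+ 2 / 2 by rewrite /tau; ring.
  have -> : `|x0 + s *: (a - x0)| ^+ 2 = `|x0| ^+ 2 + 2 * s * (dot a x0 - `|x0| ^+ 2)
      + s ^+ 2 * `|a - x0| ^+ 2.
    by rewrite !dot_norm !dotE (dotC x0 a); ring.
  have -> : `|y0 + s *: (b - y0)| ^+ 2 = `|y0| ^+ 2 + 2 * s * (dot b y0 - `|y0| ^+ 2)
      + s ^+ 2 * `|b - y0| ^+ 2.
    by rewrite !dot_norm !dotE (dotC y0 b); ring.
  move=> h2.
  have h3 : 0 <= s * (dot a b - tau + (dot a x0 - `|x0| ^+ 2) + (dot b y0 - `|y0| ^+ 2)
     + s * (N - e)) by rewrite /N; lra.
  have : 0 <= dot a b - tau + (dot a x0 - `|x0| ^+ 2) + (dot b y0 - `|y0| ^+ 2)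
     + s * (N - e) by rewrite pmulr_rge0 in h3; lra.
  rewrite mulrBr sN; have : 0 <= s * e by rewrite mulr_ge0; lra.
  by rewrite /tau in h *; lra.
have fo a b : A a b -> dot (x0 + y0) (x0 + y0) <= dot (a + y0) (b + x0).
  move=> /first_order; rewrite !dot_norm !dotE (dotC y0 x0) (dotC b y0); lra.
(* By [fo], the pair [(- y0, - x0)] is monotonically related to the graph. Once it belongs to the
   graph, [fo] at this very pair forces [x0 + y0 = 0]. *)
have Ax0 : A (- y0) (- x0).
  apply: A_max => a b /fo; have := dot_ge0 (x0 + y0).
  by rewrite !dotE; lra.
have := fo _ _ Ax0; rewrite addNr dot0l => /dot_eq0 /eqP.
by rewrite addrC addr_eq0 => /eqP yx; rewrite yx opprK in Ax0; exists x0.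
Qed.

End maximal_monotone.

Lemma maximal_monotone_mem (A : H -> set H) x y : maximal_monotone dot A ->
  (forall a b, A a b -> 0 <= dot (x - a) (y - b)) -> A x y.
Proof.
move=> [mA maxA] h; pose B z := [set w | A z w \/ (z = x /\ w = y)].
apply: (maxA B _ _ x y) => [z z' w w'|z w|]; [|by left|by right].
case=> [Azw|[-> ->]] [Azw'|[-> ->]].
- exact: mA.
- have := h _ _ Azw; rewrite !dotE; lra.
- exact: h.
- by rewrite !subrr dot0l.
Qed.

(** [minty0] applied to the operator [eps A - z], which is again monotone and maximal. *)
Lemma minty (A : H -> set H) eps z : maximal_monotone dot A ->
  (exists a b, A a b) -> 0 < eps -> exists y, A (z - eps *: y) y.
Proof.
move=> mA [a0 [b0 A0]] e0.
pose B (x : H) := [set w : H | A x (eps^-1 *: (w + z))].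
have en : eps != 0 by rewrite gt_eqF.
have [|x y h||x Bx] := @minty0 B.
- move=> x x' w w' Bx Bx'; have := mA.1 _ _ _ _ Bx Bx'.
  rewrite -scalerBr dotZr pmulr_rge0 ?invr_gt0 //.
  by congr (0 <= _); rewrite !dotE; ring.
- apply: (maximal_monotone_mem mA) => a b Aab.
  have := h a (eps *: b - z).
  rewrite /B /= subrK scalerA mulVf // scale1r => /(_ Aab).
  rewrite -(pmulr_rge0 _ (_ : 0 < eps^-1)) ?invr_gt0 //.
  by congr (0 <= _); rewrite !dotE; field.
- by exists a0, (eps *: b0 - z); rewrite /B /= subrK scalerA mulVf // scale1r.
exists (eps^-1 *: (- x + z)).
by rewrite scalerA mulfV // scale1r opprD opprK addrC subrK.
Qed.

Lemma resolvent_unique (A : H -> set H) eps z u u' y y' : monotone_op dot A -> 0 < eps ->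
  A u y -> u + eps *: y = z -> A u' y' -> u' + eps *: y' = z -> u = u'.
Proof.
move=> mA e0 Au uz Au' uz'.
have := mA _ _ _ _ Au Au'; rewrite -(pmulr_rge0 _ e0) => h.
apply/eqP; rewrite -subr_eq0; apply/eqP; apply: dot_eq0.
have E : u - u' = - (eps *: (y - y')).
  apply/eqP; rewrite -subr_eq0 opprK; apply/eqP.
  by rewrite scalerBr addrACA uz -opprD uz' subrr.
by rewrite [X in dot _ X]E dotNr dotZr; lra.
Qed.

(** * Resolvents and Yosida approximations *)

Section yosida.
Variable A : H -> set H.
Hypothesis A_maxmon : maximal_monotone dot A.
Hypothesis A_ne : exists a b, A a b.
Variable eps : R.
Hypothesis eps_gt0 : 0 < eps.

Local Notation J := (resolvent A eps).
Local Notation Ae := (yosida A eps).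

Lemma yosida_mem z : A (J z) (Ae z).
Proof.
have [y Ay] := minty z A_maxmon A_ne eps_gt0.
have Jz : J z = z - eps *: y.
  apply: get_unique => [|u [y' Au' u'z]]; first by exists y => //; rewrite subrK.
  by apply: (resolvent_unique A_maxmon.1 eps_gt0 Au' u'z Ay); rewrite subrK.
by rewrite /yosida Jz subKr scalerA mulVf ?scale1r ?gt_eqF.
Qed.

Lemma resolventE z : J z = z - eps *: Ae z.
Proof.
by rewrite /yosida scalerA mulfV ?gt_eqF // scale1r subKr.
Qed.

Lemma yosida_monotone z z' : 0 <= dot (z - z') (Ae z - Ae z').
Proof.
have := A_maxmon.1 _ _ _ _ (yosida_mem z) (yosida_mem z'); rewrite !resolventE.
have : 0 <= eps * dot (Ae z - Ae z') (Ae z - Ae z') by rewrite mulr_ge0 ?dot_ge0 // ltW.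
rewrite !dotE; lra.
Qed.

(** Monotonicity at the resolvents gives the cocoercivity [eps |Ae z - Ae z'|^2 <= dot (z - z') (Ae
    z - Ae z')]; Cauchy-Schwarz concludes. *)
Lemma yosida_lipschitz z z' : eps * `|Ae z - Ae z'| <= `|z - z'|.
Proof.
have := A_maxmon.1 _ _ _ _ (yosida_mem z) (yosida_mem z'); rewrite !resolventE.
move: (Ae z) (Ae z') => y y'.
have -> : z - eps *: y - (z' - eps *: y') = (z - z') - eps *: (y - y').
  by apply: dot_ext => w; rewrite !dotE; ring.
move: (z - z') (y - y') => u v; have := dot_le_norm u v.
rewrite !dotE -dot_norm => h1 h2.
have := normr_ge0 v; rewrite le_eqVlt => /orP[/eqP <-|h]; first by rewrite mulr0.
by rewrite -(ler_pM2r h); lra.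
Qed.

Lemma resolvent_nonexpansive z z' : `|J z - J z'| <= `|z - z'|.
Proof.
rewrite -(ler_pXn2r (n := 2))// ?nnegrE// !dot_norm.
have := A_maxmon.1 _ _ _ _ (yosida_mem z) (yosida_mem z').
have := dot_ge0 (eps *: (Ae z - Ae z')).
have -> : z - z' = (J z - J z') + eps *: (Ae z - Ae z').
  by rewrite !resolventE; apply: dot_ext => w; rewrite !dotE; ring.
move: (J z - J z') (Ae z - Ae z') => u y h1 h2.
have : 0 <= eps * dot u y by rewrite mulr_ge0 // ltW.
by rewrite dotDl !(dotDr _ u) (dotC _ u) !dotZr; move: h1; rewrite dotZr; lra.
Qed.

Lemma norm_yosida_le a b : A a b -> `|Ae a| <= `|b|.
Proof.
move=> Aab; have := A_maxmon.1 _ _ _ _ Aab (yosida_mem a); rewrite resolventE.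
rewrite subKr dotZl pmulr_rge0 // dotDr dotNr -dot_norm => h.
have := dot_le_norm (Ae a) b.
have := normr_ge0 (Ae a); rewrite le_eqVlt => /orP[/eqP <-//|n0] h'.
by rewrite -(ler_pM2l n0); lra.
Qed.

End yosida.


(** * The closed domain, and the effect of an interior point *)

Section domain.
Variable A : H -> set H.
Hypothesis A_maxmon : maximal_monotone dot A.
Hypothesis A_ne : exists a b, A a b.

(* The resolvents of a convex combination [z] of points of the domain
   converge to [z]. *)
Lemma dom_convex u v a : Dom A u -> Dom A v -> 0 <= a <= 1 ->
  closure (Dom A) (a *: u + (1 - a) *: v).
Proof.
move=> [b Aub] [b' Avb'] a01; set z := _ + _.
pose c := a *: b + (1 - a) *: b'.
pose K := `|z| * `|c| + `|a * dot b u + (1 - a) * dot b' v| + 1.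
have K0 : 0 < K by rewrite ltr_wpDl // addr_ge0 // mulr_ge0.
have main eps : 0 < eps -> eps <= 1 ->
    `|resolvent A eps z - z| ^+ 2 <= eps * (K + `|c| * `|resolvent A eps z - z|).
  move=> e0 e1.
  have h1 := A_maxmon.1 _ _ _ _ (yosida_mem A_maxmon A_ne e0 z) Aub.
  have h2 := A_maxmon.1 _ _ _ _ (yosida_mem A_maxmon A_ne e0 z) Avb'.
  have zE : z = resolvent A eps z + eps *: yosida A eps z.
    by rewrite resolventE // subrK.
  move: h1 h2 zE; move: (resolvent A eps z) (yosida A eps z) => j y h1 h2 zE.
  have nj : eps * `|y| = `|j - z|.
    by rewrite zE opprD addrA subrr sub0r normrN normrZ gtr0_norm.
  (* In the sum of the two monotonicity inequalities with weights [a] and [1 - a], the terms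
     quadratic in the unknowns combine to [- eps |y|^2], because [z = j + eps y]. *)
  have h3 : eps * `|y| ^+ 2 <= (a * dot b u + (1 - a) * dot b' v) - dot j c.
    have h1' : 0 <= a * dot (j - u) (y - b) by rewrite mulr_ge0; lra.
    have h2' : 0 <= (1 - a) * dot (j - v) (y - b') by rewrite mulr_ge0; lra.
    have h4 : dot j y + eps * dot y y = a * dot u y + (1 - a) * dot v y.
      by rewrite -dotZl -dotDl -zE /z !dotE.
    move: h1' h2'; rewrite dot_norm /c !dotE (dotC b u) (dotC b' v).
    by lra.
  have h5 := dot_ge_norm j c.
  have h6 : `|j| <= `|z| + `|j - z|.
    by have := ler_normD z (j - z); rewrite addrC subrK.
  have h7 : `|j| * `|c| <= (`|z| + `|j - z|) * `|c| by rewrite ler_wpM2r.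
  have h8 := ler_norm (a * dot b u + (1 - a) * dot b' v).
  rewrite -{1}nj exprMn expr2 -mulrA; apply: ler_wpM2l; first exact: ltW.
  by rewrite /K; lra.
apply/closureP_norm => e e0.
(* If the distance [d] were at least [e], this choice would keep each of the two terms of [main]
   below a quarter of [d ^+ 2]. *)
have [eps1 e1 [e11 e12]] := @exists_small R 1 (e ^+ 2 / (4 * K)) ltac:(lra)
  ltac:(by rewrite divr_gt0 ?exprn_gt0 // mulr_gt0).
have c0 := normr_ge0 c.
have [eps2 e2 [e21 e22]] := @exists_small R eps1 (e / (4 * (`|c| + 1))) e1
  ltac:(by rewrite divr_gt0 // mulr_gt0 //; lra).
exists (resolvent A eps2 z); first by exists (yosida A eps2 z); exact: yosida_mem.
have := main eps2 e2 ltac:(lra); rewrite ltNge; set d := `|_ - z| => h.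
apply/negP => ed.
have hK : eps2 * K <= e ^+ 2 / 4.
  have : eps2 * (4 * K) <= e ^+ 2 by rewrite -ler_pdivlMr; lra.
  lra.
have hc : eps2 * `|c| <= d / 4.
  have : eps2 * (4 * (`|c| + 1)) <= e by rewrite -ler_pdivlMr; lra.
  lra.
have : e ^+ 2 <= d ^+ 2 by rewrite ler_pXn2r // ?nnegrE; lra.
have : eps2 * `|c| * d <= d / 4 * d by rewrite ler_wpM2r; lra.
have : 0 < d ^+ 2 by rewrite exprn_gt0; lra.
by move: h; rewrite mulrDr mulrA expr2; lra.
Qed.

Lemma closure_dom_convex u v a : closure (Dom A) u -> closure (Dom A) v ->
  0 <= a <= 1 -> closure (Dom A) (a *: u + (1 - a) *: v).
Proof.
move=> /closureP_norm Cu /closureP_norm Cv a01; apply/closureP_norm => e e0.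
have [u' Du' uu'] := Cu (e / 2) ltac:(lra).
have [v' Dv' vv'] := Cv (e / 2) ltac:(lra).
have /closureP_norm Cw := dom_convex Du' Dv' a01.
have [w Dw ww'] := Cw (e / 2) ltac:(lra).
exists w => //.
have -> : w - (a *: u + (1 - a) *: v) = w - (a *: u' + (1 - a) *: v') +
  (a *: (u' - u) + (1 - a) *: (v' - v)).
  by apply: dot_ext => q; rewrite !dotE; ring.
apply: (le_lt_trans (ler_normD _ _)).
have h : `|a *: (u' - u) + (1 - a) *: (v' - v)| <= e / 2.
  apply: (le_trans (ler_normD _ _)); rewrite !normrZ !ger0_norm; try lra.
  have : a * `|u' - u| <= a * (e / 2) by rewrite ler_wpM2l; lra.
  have : (1 - a) * `|v' - v| <= (1 - a) * (e / 2) by rewrite ler_wpM2l; lra.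
  lra.
lra.
Qed.

Lemma resolvent_dom eps z : 0 < eps -> Dom A (resolvent A eps z).
Proof. by move=> e0; exists (yosida A eps z); exact: yosida_mem. Qed.

Lemma projection_dom z :
  projection_spec (closure (Dom A)) z (projection (closure (Dom A)) z).
Proof.
have [|||p pp] := @projection_exists (closure (Dom A)) z.
- have [a [b Aab]] := A_ne; exists a; apply: subset_closure; by exists b.
- exact: closed_closure.
- by move=> u v a; exact: closure_dom_convex.
exact: projection_specP pp.
Qed.

(* Baire's theorem applied to the sublevel sets of
   [sup {<y, x - z> / (1 + |z|)}], the supremum being taken over the graph. *)
Lemma interior_bound : (Dom A)^° !=set0 ->
  exists a1 b1 r mu, [/\ A a1 b1, 0 < r, 0 <= mu & forall z y, A z y ->
    r * `|y| <= dot y (z - a1) + mu * (1 + `|z - a1|)].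
Proof.
move=> [a0 /nbhs_ballP[r0 /= r00 hr0]].
pose F (n : nat) := [set x : H | forall z y, A z y -> dot y (x - z) <= n%:R * (1 + `|z|)].
(* The smaller ball ensures that every point of [E n] lies in the domain. *)
pose E n := F n `&` [set x | `|a0 - x| <= r0 / 2].
have clE n : closed (E n).
  move=> x /closureP_norm Cx; split => [z y Azy|] /=; apply/ler_addgt0Pr => e e0.
    have y0 : 0 < `|y| + 1 by rewrite ltr_wpDl.
    have [x' [Fx' _] xx'] := Cx (e / (`|y| + 1)) ltac:(by rewrite divr_gt0).
    have := Fx' z y Azy; have := dot_ge_norm y (x' - x).
    have : `|y| * `|x' - x| <= e.
      have h : (`|y| + 1) * `|x' - x| <= e by rewrite mulrC -ler_pdivlMr // ltW.
      by have := normr_ge0 (x' - x); lra.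
    by rewrite !dotE; lra.
  have [x' [_ /= Fx'] xx'] := Cx e e0.
  have := ler_normD (a0 - x') (x' - x); rewrite addrA subrK; lra.
have [n [a1 [r r0' hr]]] : exists n a1, exists2 r, 0 < r & ball a1 r `<=` E n.
  apply: contrapT => hn.
  have /Baire : forall n, open (~` E n) /\ dense (~` E n).
    move=> n; split; first by rewrite openC.
    move=> O [x Ox] openO; apply: contrapT => hO; apply: hn; exists n, x.
    have /nbhs_ballP[r /= r0' hr] : nbhs x O by exact: open_nbhs_nbhs.
    exists r => // q /hr Oq; apply: contrapT => nE; apply: hO; by exists q.
  move=> /(_ (ball a0 (r0 / 2))) [||x].
  - by exists a0; apply: ballxx; rewrite divr_gt0.
  - exact: ball_open.
  rewrite -ball_normE /= => -[xa0 xE].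
  have [v Axv] : Dom A x by apply: hr0; rewrite -ball_normE /=; lra.
  pose n := Num.truncn (`|v| * (1 + `|x|)).
  apply: (xE n.+1 I); split => /= [z y Azy|]; last lra.
  (* Monotonicity replaces [y] by the fixed value [v] at [x], so the supremum is finite at every
     point of the domain. This contradicts that [x] avoids all [E n]. *)
  have := A_maxmon.1 _ _ _ _ Axv Azy; have := dot_le_norm v (x - z).
  have : `|v| * `|x - z| <= n.+1%:R * (1 + `|z|).
    have h1 : `|v| * (1 + `|x|) <= n.+1%:R by apply: ltW; exact: truncnS_gt.
    have h2 : `|x - z| <= (1 + `|x|) * (1 + `|z|).
      have := ler_normB x z; have : 0 <= `|x| * `|z| by rewrite mulr_ge0.
      lra.
    have h3 := ler_wpM2l (normr_ge0 v) h2.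
    have h4 : `|v| * (1 + `|x|) * (1 + `|z|) <= n.+1%:R * (1 + `|z|).
      by rewrite ler_wpM2r // addr_ge0.
    by move: h3 h4; rewrite !mulrA; lra.
  by rewrite !dotE (dotC x v) (dotC x y) (dotC z v) (dotC z y); lra.
have Ea1 : E n a1 by apply: hr; exact: ballxx.
have [b1 Ab1] : Dom A a1.
  by apply: hr0; rewrite -ball_normE /=; have := Ea1.2; rewrite /=; lra.
exists a1, b1, (r / 2), (n%:R * (1 + `|a1|)); split => //.
- by rewrite divr_gt0.
move=> z y Azy.
have h1 : n%:R * (1 + `|z|) <= n%:R * (1 + `|a1|) * (1 + `|z - a1|).
  rewrite -mulrA ler_wpM2l //.
  have := ler_normD (z - a1) a1; rewrite subrK.
  have : 0 <= `|a1| * `|z - a1| by rewrite mulr_ge0.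
  lra.
have [->|y0] := eqVneq y 0.
  by rewrite normr0 mulr0 dot0l add0r mulr_ge0 ?addr_ge0 // mulr_ge0 ?addr_ge0.
have ny : 0 < `|y| by rewrite normr_gt0.
(* Moving the test point from [a1] by [r / 2] in the direction of [y] produces the term
   [r / 2 * |y|]. *)
have /hr[/(_ z y Azy)] : ball a1 r (a1 + (r / 2 / `|y|) *: y).
  rewrite -ball_normE /= opprD addrA subrr sub0r normrN normrZ ger0_norm; last first.
    by rewrite !divr_ge0 // ltW.
  by rewrite divfK ?normr_eq0 //; lra.
rewrite !dotE -dot_norm expr2 mulrA divfK ?normr_eq0 //; lra.
Qed.

End domain.

End inner_product.

Lemma subr_shift (W : zmodType) (v2 v1 o a2 a1 : W) :
  v2 - v1 - o = (a2 - a1 - o) + ((v2 - a2) - (v1 - a1)).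
Proof.
rewrite [RHS]addrAC; congr (_ - o); rewrite opprD opprK (addrACA v2) addrCA.
by rewrite (addrACA a2) subrr addNr !addr0.
Qed.

(** * Integrals of step functions *)

Section step_integrals.
Context {R : realType} {U V W : normedModType R}.
Variable op : U -> V -> W.
Hypothesis opDl : forall u u' v, op (u + u') v = op u v + op u' v.
Hypothesis opDr : forall u v v', op u (v + v') = op u v + op u v'.
Implicit Types (p : seq (R * R * U)).

Lemma op0r u : op u 0 = 0.
Proof. by apply: (@addrI _ (op u 0)); rewrite -opDr !addr0. Qed.

Lemma op0l v : op 0 v = 0.
Proof. by apply: (@addrI _ (op 0 v)); rewrite -opDl !addr0. Qed.

Lemma opNl u v : op (- u) v = - op u v.
Proof. by apply: (@addrI _ (op u v)); rewrite -opDl !subrr op0l. Qed.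

Lemma op_suml p (P : pred (R * R * U)) v :
  op (\sum_(q <- p | P q) q.2) v = \sum_(q <- p | P q) op q.2 v.
Proof. exact: (big_morph (fun u => op u v) (fun u u' => opDl u u' v) (op0l v)). Qed.

(** With [left_gap], this lets [interval_chain] subdivide at the endpoints of a step function
    without sorting them. *)
Lemma right_gap (l : seq R) a : exists2 d, 0 < d &
  forall b, a < b < a + d -> forall e, e \in l -> e <= a \/ b <= e.
Proof.
elim: l => [|e l [d d0 hd]]; first by exists 1.
case: (leP e a) => ea.
  exists d => // b ab e'; rewrite inE => /orP[/eqP ->|]; first by left.
  exact: hd.
case: (leP d (e - a)) => de.
  exists d => // b ab e'; rewrite inE => /orP[/eqP ->|]; first by right; lra.
  exact: hd.
exists (e - a); first lra.
move=> b ab e'; rewrite inE => /orP[/eqP ->|]; first by right; lra.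
by apply: hd; lra.
Qed.

Lemma left_gap (l : seq R) b : exists2 d, 0 < d &
  forall a, b - d < a < b -> forall e, e \in l -> e <= a \/ b <= e.
Proof.
elim: l => [|e l [d d0 hd]]; first by exists 1.
case: (leP b e) => ea.
  exists d => // a ab e'; rewrite inE => /orP[/eqP ->|]; first by right.
  exact: hd.
case: (leP d (b - e)) => de.
  exists d => // a ab e'; rewrite inE => /orP[/eqP ->|]; first by left; lra.
  exact: hd.
exists (b - e); first lra.
move=> a ab e'; rewrite inE => /orP[/eqP ->|]; first by left; lra.
by apply: hd; lra.
Qed.

Variables (mu : {measure set (measurableTypeR R) -> \bar R}) (g : R -> V).
Variables (M : R -> R) (s t : R).
Hypothesis muE : forall a b, s <= a -> a <= b -> b <= t ->
  mu (`]a, b]%classic : set (measurableTypeR R)) = (M b - M a)%:E.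
Hypothesis op_bound : forall u a b, s <= a -> a <= b -> b <= t ->
  `|op u (g b - g a)| <= `|u| * (M b - M a).

(** Clamping [a] and [b] in this way gives the endpoints of the part of [q] that meets []a, b]], and
    equal points if there is none. *)
Let clip (q : R * R * U) r := Num.max q.1.1 (Num.min q.1.2 r).

(** Measurability is chained together with the bound, since additivity of the integral asks for
    it. *)
Let step_bound p a b :=
  measurable_fun (`]a, b]%classic : set (measurableTypeR R)) (fun r => `|step_fun p r|) /\
  (`|\sum_(q <- p) op q.2 (g (clip q b) - g (clip q a))|%:E <=
   \int[mu]_(r in `]a, b]%classic) `|step_fun p r|%:E)%E.

Lemma mitv (a b : R) : measurable (`]a, b]%classic : set (measurableTypeR R)).
Proof. exact: measurable_itv. Qed.

(** As no endpoint is interior to []a, b]], each interval of [p] contains this cell or misses it,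
    and the step function is constant there. *)
Lemma step_bound_cell p a b : step_in s t p -> s <= a -> a < b -> b <= t ->
  (forall e, e \in [seq q.1.1 | q <- p] ++ [seq q.1.2 | q <- p] -> e <= a \/ b <= e) ->
  step_bound p a b.
Proof.
move=> pst sa ab bt gap.
pose act (q : R * R * U) := (q.1.1 <= a) && (b <= q.1.2).
have actP q : q \in p -> (act q /\ clip q b = b /\ clip q a = a) \/
    (~~ act q /\ clip q b = clip q a /\ (b <= q.1.1 \/ q.1.2 <= a)).
  move=> qp; have [] := pst q qp; rewrite /act /clip => h1 h2 h3.
  have g1 : q.1.1 <= a \/ b <= q.1.1
    by apply: gap; rewrite mem_cat; apply/orP; left; apply/mapP; exists q.
  have g2 : q.1.2 <= a \/ b <= q.1.2
    by apply: gap; rewrite mem_cat; apply/orP; right; apply/mapP; exists q.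
  case: g1 => g1; last first.
    right; split; first by rewrite negb_and -!ltNge; apply/orP; left; lra.
    split; last by left.
    by rewrite !max_l // ge_min; apply/orP; right; lra.
  case: g2 => g2; last first.
    left; split; first by rewrite g1 g2.
    by rewrite (min_r g2) (min_r (_ : a <= q.1.2)) ?max_r //; lra.
  right; split; first by rewrite negb_and -!ltNge; apply/orP; right; lra.
  split; last by right.
  by rewrite !min_l //; lra.
pose c := \sum_(q <- p | act q) q.2.
have stepE r : r \in (`]a, b]%classic : set (measurableTypeR R)) -> step_fun p r = c.
  rewrite inE /= in_itv /= => rab.
  rewrite /step_fun /c [LHS]big_seq_cond [RHS]big_seq_cond; apply: eq_bigl => q.
  case: (boolP (q \in p)) => //= qp.
  case: (actP q qp) => [[aq _]|[naq [_ h]]].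
    by rewrite aq; move: aq; rewrite /act; lra.
  rewrite (negbTE naq); apply/negbTE/negP => h'.
  by case: h => h; move: h'; lra.
split.
  apply: (eq_measurable_fun (fun=> `|c|)); first by move=> r /stepE ->.
  exact: measurable_cst.
under eq_integral => r rab do rewrite stepE //.
rewrite (integral_cst mu (mitv a b)) (muE sa (ltW ab) bt) -EFinM lee_fin.
apply: le_trans (op_bound c sa (ltW ab) bt).
rewrite /c op_suml big_seq [in leRHS]big_seq_cond.
rewrite (bigID act) /= [X in _ + X]big1 ?addr0; last first.
  move=> q /andP[qp naq]; case: (actP q qp) => [[aq _]|[_ [-> _]]].
    by rewrite aq in naq.
  by rewrite subrr op0r.
rewrite (_ : \sum_(_ <- p | _) _ = \sum_(q <- p | (q \in p) && act q) op q.2 (g b - g a)) //.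
apply: eq_bigr => q /andP[qp aq].
case: (actP q qp) => [[_ [-> ->]]|[naq _]] //.
by rewrite aq in naq.
Qed.

(** The intervals of [p] may overlap and their values cancel, so a termwise estimate would be too
    large; the bound is proved cell by cell and chained. *)
Lemma step_int_le p : step_in s t p -> s <= t ->
  measurable_fun (`]s, t]%classic : set (measurableTypeR R)) (fun r => `|step_fun p r|) /\
  (`|step_int op g p|%:E <= \int[mu]_(r in `]s, t]%classic) `|step_fun p r|%:E)%E.
Proof.
move=> pst; rewrite le_eqVlt => /orP[/eqP st|st].
  have e0 : (`]s, t]%classic : set (measurableTypeR R)) = set0.
    by rewrite st set_itvoc0.
  rewrite !e0; split; first exact: measurable_fun_set0.
  rewrite integral_set0 /step_int big_seq big1 ?normr0 // => q /pst[].
  rewrite -st => h1 h2 h3; rewrite (_ : q.1.2 = q.1.1) ?subrr ?op0r //; lra.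
have [m b] : step_bound p s t.
  apply: (@interval_chain _ (step_bound p)) => //.
  - move=> a c b sa ac cb bt [m1 h1] [m2 h2].
    have E : (`]a, b]%classic : set (measurableTypeR R)) = `]a, c] `|` `]c, b].
      by rewrite -itv_bndbnd_setU // bnd_simp ltW.
    have mm : measurable_fun (`]a, b]%classic : set (measurableTypeR R))
        (fun r => `|step_fun p r|).
      by rewrite E; apply/measurable_funU; [exact: mitv | exact: mitv | split].
    split => //; rewrite E ge0_integral_setU //; first last.
    + rewrite disj_set2E; apply/eqP; rewrite -subset0 => r [] /=.
      by rewrite !in_itv /=; lra.
    + by rewrite -E; exact/measurable_EFinP.
    apply: le_trans (leeD h1 h2); rewrite -EFinD lee_fin.
    apply: le_trans (ler_normD _ _); rewrite -big_split /=.
    rewrite le_eqVlt; apply/orP; left; apply/eqP; congr (`|_|); apply: eq_bigr => q _.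
    by rewrite -opDr; congr (op _ _); rewrite [RHS]addrC addrA subrK.
  - move=> a sab; have [d d0 hd] := right_gap ([seq q.1.1 | q <- p] ++ [seq q.1.2 | q <- p]) a.
    by exists d => // b ab bt; apply: step_bound_cell => //; try lra; exact: hd.
  - move=> b sab; have [d d0 hd] := left_gap ([seq q.1.1 | q <- p] ++ [seq q.1.2 | q <- p]) b.
    by exists d => // a ab sa; apply: step_bound_cell => //; try lra; exact: hd.
split => //; apply: le_trans b; rewrite lee_fin le_eqVlt.
apply/orP; left; apply/eqP; congr (`|_|).
rewrite /step_int big_seq [RHS]big_seq; apply: eq_bigr => q /pst[h1 h2 h3].
rewrite /clip (min_l h3) (max_r h2) min_r ?max_l //; lra.
Qed.

End step_integrals.

(** * First-order expansion of integrals *)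

Section approximation.
Context {R : realType} {U V W : normedModType R}.
Variable op : U -> V -> W.
Hypothesis opDl : forall u u' v, op (u + u') v = op u v + op u' v.
Hypothesis opDr : forall u v v', op u (v + v') = op u v + op u v'.
Implicit Types (p : seq (R * R * U)).

Definition opp_steps p : seq (R * R * U) := [seq (q.1, - q.2) | q <- p].

Lemma step_fun_cat p p' r : step_fun (p ++ p') r = step_fun p r + step_fun p' r.
Proof. by rewrite /step_fun big_cat. Qed.

Lemma step_fun1 a b u r : step_fun [:: (a, b, u)] r = if a < r <= b then u else 0 :> U.
Proof. by rewrite /step_fun big_mkcond big_seq1. Qed.

Lemma step_fun_opp p r : step_fun (opp_steps p) r = - step_fun p r.
Proof. by rewrite /step_fun big_map sumrN. Qed.

Lemma step_int_cat (g : R -> V) p p' :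
  step_int op g (p ++ p') = step_int op g p + step_int op g p'.
Proof. by rewrite /step_int big_cat. Qed.

Lemma step_int_opp (g : R -> V) p : step_int op g (opp_steps p) = - step_int op g p.
Proof.
rewrite /step_int big_map -sumrN; apply: eq_bigr => q _ /=.
by rewrite (opNl opDl).
Qed.

Lemma step_fun_out r0 s r p : step_in r0 s p -> s < r -> step_fun p r = 0.
Proof.
move=> pin sr; rewrite /step_fun big_seq_cond big1 // => q /andP[/pin[_ _ h] /andP[_ h']].
by exfalso; lra.
Qed.

Variables (mu : {measure set (measurableTypeR R) -> \bar R}) (g : R -> V) (f : R -> U).
Variables (M : R -> R) (r0 s t : R).
Hypotheses (r0s : r0 <= s) (st : s <= t).
Hypothesis muE : forall a b, r0 <= a -> a <= b -> b <= t ->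
  mu (`]a, b]%classic : set (measurableTypeR R)) = (M b - M a)%:E.
Hypothesis op_bound : forall u a b, r0 <= a -> a <= b -> b <= t ->
  `|op u (g b - g a)| <= `|u| * (M b - M a).

(** [step_int_le] for the single step function [p2 - p1 - u0 1_{]s, t]}]. On []r0, s]] it is a
    difference of approximation errors; on []s, t]], where [p1] vanishes, [f] is close to [u0]. *)
Lemma step_int_approx p1 p2 u0 w : 0 <= w ->
  step_in r0 s p1 -> step_in r0 t p2 ->
  measurable_fun (`]r0, s]%classic : set (measurableTypeR R)) (fun r => `|f r - step_fun p1 r|) ->
  measurable_fun (`]r0, t]%classic : set (measurableTypeR R)) (fun r => `|f r - step_fun p2 r|) ->
  (forall r, s < r <= t -> `|f r - u0| <= w) ->
  (`|step_int op g p2 - step_int op g p1 - op u0 (g t - g s)|%:E <=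
   \int[mu]_(r in `]r0, s]%classic) `|f r - step_fun p1 r|%:E +
   \int[mu]_(r in `]r0, t]%classic) `|f r - step_fun p2 r|%:E + (w * (M t - M s))%:E)%E.
Proof.
move=> w0 p1in p2in m1 m2 fu0.
pose P := p2 ++ (opp_steps p1 ++ [:: (s, t, - u0)]).
have Pin : step_in r0 t P.
  move=> q; rewrite !mem_cat => /orP[/p2in//|/orP[|]].
    by move=> /mapP[q' /p1in[h1 h2 h3] ->] /=; split => //; exact: le_trans h3 st.
  by rewrite inE => /eqP ->; split => //=.
have [mP hP] := step_int_le opDl opDr muE op_bound Pin (le_trans r0s st).
have -> : step_int op g p2 - step_int op g p1 - op u0 (g t - g s) = step_int op g P.
  rewrite /P !step_int_cat step_int_opp addrA; congr (_ + _).
  by rewrite /step_int big_seq1 /= (opNl opDl).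
apply: (le_trans hP).
have E : (`]r0, t]%classic : set (measurableTypeR R)) = `]r0, s] `|` `]s, t].
  by rewrite -itv_bndbnd_setU // bnd_simp.
have dis : [disjoint (`]r0, s]%classic : set (measurableTypeR R)) & `]s, t]%classic].
  rewrite disj_set2E; apply/eqP; rewrite -subset0 => r [] /=.
  by rewrite !in_itv /=; lra.
have mE (h : R -> R) : measurable_fun (`]r0, t]%classic : set (measurableTypeR R)) h ->
  measurable_fun (`]r0, s]%classic : set (measurableTypeR R)) (EFin \o h) /\
  measurable_fun (`]s, t]%classic : set (measurableTypeR R)) (EFin \o h).
  rewrite E => /(measurable_funU _ (mitv _ _) (mitv _ _)) [h1 h2].
  by split; exact/measurable_EFinP.
have [mP1 mP2] := mE _ mP; have [m21 m22] := mE _ m2.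
have split_int (h : R -> R) : measurable_fun (`]r0, t]%classic : set (measurableTypeR R)) h ->
  (forall r, 0 <= h r) ->
  (\int[mu]_(r in `]r0, t]%classic) (h r)%:E = \int[mu]_(r in `]r0, s]%classic) (h r)%:E +
   \int[mu]_(r in `]s, t]%classic) (h r)%:E)%E.
  move=> mh h0; rewrite E ge0_integral_setU //.
    by rewrite -E; exact/measurable_EFinP.
  by move=> r _; rewrite lee_fin.
rewrite (split_int _ mP) // (split_int _ m2) // addeA -addeA; apply: leeD.
  rewrite -ge0_integralD //; last exact/measurable_EFinP.
  apply: ge0_le_integral => //.
    by apply: emeasurable_funD => //; exact/measurable_EFinP.
  move=> r /=; rewrite in_itv /= => rr; rewrite -EFinD lee_fin.
  have -> : step_fun P r = (f r - step_fun p1 r) - (f r - step_fun p2 r).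
    rewrite /P !step_fun_cat step_fun_opp step_fun1 ifF; last by lra.
    by rewrite addr0 opprB [RHS]addrC addrA subrK.
  by rewrite (le_trans (ler_normB _ _)).
have -> : (w * (M t - M s))%:E = (\int[mu]_(r in `]s, t]%classic) w%:E)%E.
  by rewrite (integral_cst mu (mitv s t)) muE // EFinM.
rewrite -ge0_integralD //.
apply: ge0_le_integral => //.
  by apply: emeasurable_funD => //; exact: measurable_cst.
move=> r /=; rewrite in_itv /= => rr; rewrite -EFinD lee_fin.
have -> : step_fun P r = (f r - u0) - (f r - step_fun p2 r).
  rewrite /P !step_fun_cat step_fun_opp (step_fun_out p1in) ?oppr0 ?add0r; last lra.
  rewrite step_fun1 rr.
  by rewrite opprB [RHS]addrC addrA subrK.
rewrite (le_trans (ler_normB _ _)) // addrC lerD2l fu0 //.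
Qed.

(** All later uses of both kinds of integral go through this estimate. The two approximating
    sequences are compared at one common index. *)
Lemma has_integral_approx v1 v2 u0 w : 0 <= w ->
  has_integral mu op f g r0 s v1 -> has_integral mu op f g r0 t v2 ->
  (forall r, s < r <= t -> `|f r - u0| <= w) ->
  `|v2 - v1 - op u0 (g t - g s)| <= w * (M t - M s).
Proof.
move=> w0 [p1 [in1 m1 i1 c1]] [p2 [in2 m2 i2 c2]] fu0.
apply/ler_addgt0Pr => e e0.
have small (I : nat -> \bar R) : I n @[n --> \oo] --> 0%E ->
    \forall n \near \oo, (I n <= (e / 4)%:E)%E.
  move=> /fine_cvgP[fin /cvgrPdist_le /(_ (e / 4))]; rewrite divr_gt0 // => /(_ isT).
  move=> h; near=> n; have fn : I n \is a fin_num by near: n.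
  rewrite -(fineK fn) lee_fin.
  have : `|0 - fine (I n)| <= e / 4 by near: n.
  by rewrite sub0r normrN; apply: le_trans; exact: ler_norm.
have near1 : \forall n \near \oo, `|v1 - step_int op g (p1 n)| <= e / 4.
  by move/cvgrPdist_le : c1; apply; lra.
have near2 : \forall n \near \oo, `|v2 - step_int op g (p2 n)| <= e / 4.
  by move/cvgrPdist_le : c2; apply; lra.
have [n [[h1 h2] [h3 h4]]] := filter_ex (filterI (filterI (small _ i1) (small _ i2))
  (filterI near1 near2)).
have := step_int_approx w0 (in1 n) (in2 n) (m1 n) (m2 n) fu0.
move=> /le_trans /(_ (leeD (leeD h1 h2) (lexx _))).
rewrite -!EFinD lee_fin => h.
have -> : v2 - v1 - op u0 (g t - g s) =
  (step_int op g (p2 n) - step_int op g (p1 n) - op u0 (g t - g s)) +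
  ((v2 - step_int op g (p2 n)) - (v1 - step_int op g (p1 n))).
  exact: subr_shift.
apply: (le_trans (ler_normD _ _)).
have := ler_normB (v2 - step_int op g (p2 n)) (v1 - step_int op g (p1 n)).
lra.
Unshelve. all: by end_near. Qed.

End approximation.

(** * Variation functions *)

Section variation.
Context {R : realType} {V : normedModType R}.
Implicit Types (l : R -> V) (W : R -> R) (p : seq R).

Definition controls l W (a b : R) :=
  forall x y, a <= x -> x <= y -> y <= b -> `|l y - l x| <= W y - W x.

(** The partition sums of [tvar], in a form suited to induction on the partition. *)
Fixpoint psum l a p : R :=
  if p is c :: p' then `|l c - l a| + psum l c p' else 0.

Lemma psumE l a b p :
  \sum_(i < size p) `|l (nth b (a :: p) i.+1) - l (nth b (a :: p) i)| = psum l a p.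
Proof.
elim: p a => [|c p IH] a; first by rewrite big_ord0.
by rewrite big_ord_recl /= -IH.
Qed.

Lemma psum_rcons l a p y : psum l a (rcons p y) = psum l a p + `|l y - l (last a p)|.
Proof. by elim: p a => [|c p IH] a /=; rewrite ?addr0 ?add0r // IH addrA. Qed.

Lemma psum_le l W a b p : itv_partition a b p -> controls l W a b ->
  psum l a p <= W b - W a.
Proof.
elim: p a => [|c p IH] a /=.
  by move=> /itv_partition_nil -> _; rewrite subrr.
move=> pab Wab; have pc := itv_partition_cons pab.
have ac : a < c by case: pab => /andP[].
have cb := itv_partition_le pc.
have h1 := Wab a c (lexx _) (ltW ac) cb.
have h2 : psum l c p <= W b - W c.
  by apply: IH => // x y cx xy yb; apply: Wab => //; lra.
lra.
Qed.

Lemma tvar_le l W a b : controls l W a b -> (tvar l a b <= (W b - W a)%:E)%E.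
Proof.
move=> lW; apply: ge_ereal_sup => _ [p pab <-]; rewrite psumE lee_fin.
exact: psum_le.
Qed.

Lemma psum_le_tvar l a b p : itv_partition a b p -> ((psum l a p)%:E <= tvar l a b)%E.
Proof. by move=> pab; apply: ereal_sup_ubound; exists p => //; rewrite psumE. Qed.

Lemma tvar_ge0 l a b : a <= b -> (0 <= tvar l a b)%E.
Proof.
rewrite le_eqVlt => /orP[/eqP <-|ab].
  by apply: (@psum_le_tvar l a a [::]).
apply: le_trans (psum_le_tvar l (itv_partition1 ab)).
by rewrite lee_fin /= addr_ge0.
Qed.

Definition var l (t : R) : R := fine (tvar l 0 t).

Lemma varE l t : BV_loc l -> 0 <= t -> tvar l 0 t = (var l t)%:E.
Proof.
move=> bv t0; rewrite /var fineK // ge0_fin_numE; [exact: bv | exact: tvar_ge0].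
Qed.

Lemma var0 l : var l 0 = 0.
Proof.
apply/eqP; rewrite /var fine_eq0; last first.
  rewrite ge0_fin_numE ?tvar_ge0 //; apply: (@le_lt_trans _ _ 0%:E); last exact: ltry.
  apply: le_trans (@tvar_le l (fun=> 0) 0 0 _) _; last by rewrite subrr.
  by move=> x y x0 xy y0; rewrite (_ : x = y) ?subrr ?normr0 //; lra.
rewrite eq_le tvar_ge0 // andbT.
apply: le_trans (@tvar_le l (fun=> 0) 0 0 _) _; last by rewrite subrr.
by move=> x y x0 xy y0; rewrite (_ : x = y) ?subrr ?normr0 //; lra.
Qed.

Lemma var_le l W t : BV_loc l -> 0 <= t -> controls l W 0 t -> var l t <= W t - W 0.
Proof. by move=> bv t0 /tvar_le; rewrite varE // lee_fin. Qed.

Lemma var_step l x y : BV_loc l -> 0 <= x -> x <= y -> `|l y - l x| <= var l y - var l x.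
Proof.
move=> bv x0; rewrite le_eqVlt => /orP[/eqP <-|xy]; first by rewrite !subrr normr0.
have y0 : 0 <= y by lra.
rewrite lerBrDl -lerBrDr -lee_fin -varE //.
apply: ge_ereal_sup => _ [p px <-]; rewrite psumE lee_fin lerBrDr.
have py : itv_partition 0 y (rcons p y).
  by rewrite -cats1; apply: itv_partition_cat px (itv_partition1 xy).
have := psum_le_tvar l py; rewrite varE // lee_fin psum_rcons.
by case: px => _ /eqP ->.
Qed.

Lemma var_nd l x y : BV_loc l -> 0 <= x -> x <= y -> var l x <= var l y.
Proof. by move=> bv x0 xy; have := var_step bv x0 xy; have := normr_ge0 (l y - l x); lra. Qed.

Lemma var_ge0 l t : BV_loc l -> 0 <= t -> 0 <= var l t.
Proof. by move=> bv t0; rewrite -(var0 l) var_nd. Qed.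

(** Additivity of the variation is bypassed: [var l] up to [s], continued by [G], controls [l] on
    [[0, t]]. *)
Lemma var_incr_le l G s t : BV_loc l -> 0 <= s -> s <= t -> controls l G s t ->
  var l t - var l s <= G t - G s.
Proof.
move=> bv s0 st lG.
pose W r := if r <= s then var l r else var l s + (G r - G s).
have lW : controls l W 0 t.
  move=> x y x0 xy yt; rewrite /W.
  case: (leP y s) => ys.
    by rewrite (le_trans xy ys) //; exact: var_step.
  case: (leP x s) => xs; last by have := lG x y (ltW xs) xy yt; lra.
  have h1 := var_step bv x0 xs; have h2 := lG s y (lexx _) (ltW ys) yt.
  have := ler_normD (l y - l s) (l s - l x); rewrite addrA subrK; lra.
have := var_le bv (le_trans s0 st) lW.
rewrite /W s0 var0 subr0; case: (leP t s) => ts; last lra.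
by have -> : s = t by [lra]; lra.
Qed.

(** Inserting [s] and [u] in the partition isolates the increment of [l] just after [s]. For a
    nearly optimal partition this gives the right continuity of [var l]. *)
Lemma psum_split l a b p s : BV_loc l -> 0 <= a -> itv_partition a b p ->
  a <= s -> s < b ->
  exists2 u0, s < u0 & forall u, s < u <= u0 ->
    psum l a p <= var l s - var l a + `|l u - l s| + (var l b - var l u).
Proof.
move=> bv; elim: p a => [|c p IH] a a0 /= pab as_ sb.
  by move: pab as_ sb => /itv_partition_nil ->; lra.
have pc := itv_partition_cons pab.
have ac : a < c by case: pab => /andP[].
have cb := itv_partition_le pc.
case: (leP c s) => cs.
  have [u0 su0 hu] := IH c ltac:(lra) pc cs sb.
  exists u0 => // u /hu; have := var_step bv a0 (ltW ac); lra.
exists c => // u /andP[su uc].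
have h1 := var_step bv a0 as_; have h2 := @var_step l u c bv ltac:(lra) uc.
have h3 : psum l c p <= var l b - var l c.
  by apply: psum_le pc _ => x y cx xy yb; apply: var_step => //; lra.
have := ler_normD (l c - l u) (l u - l s); rewrite addrA subrK.
have := ler_normD (l c - l s) (l s - l a); rewrite addrA subrK; lra.
Qed.

Lemma var_right_cont l s w : BV_loc l -> right_cont l s -> 0 <= s -> 0 < w ->
  exists2 d, 0 < d & forall u, s <= u < s + d -> var l u <= var l s + w.
Proof.
move=> bv rc s0 w0; have b0 : 0 <= s + 1 by lra.
have : ((var l (s + 1) - w / 2)%:E < tvar l 0 (s + 1))%E.
  by rewrite varE // lte_fin; lra.
move=> /ereal_sup_gt[_ [p pb <-]]; rewrite psumE lte_fin => hp.
have [u0 su0 hu] := psum_split bv (lexx _) pb s0 ltac:(lra).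
have [d d0 hd] := rc (w / 2) ltac:(lra).
have [e e0 [e1 e2]] : exists2 e, 0 < e & e <= d /\ e <= u0 - s.
  by case: (leP d (u0 - s)) => h; [exists d | exists (u0 - s)]; try split; lra.
exists e => // u /andP[su ue].
move: su; rewrite le_eqVlt => /orP[/eqP <-|su]; first lra.
have := hu u ltac:(lra); have := hd u ltac:(lra); rewrite var0; lra.
Qed.

Lemma lipschitz_BV_loc l : (forall T, 0 <= T -> exists B, controls l (fun r => B * r) 0 T) ->
  BV_loc l.
Proof. by move=> h T T0; have [B hB] := h T T0; apply: le_lt_trans (tvar_le hB) (ltry _). Qed.

Lemma jump_le_var l u r : cadlag l -> BV_loc l -> 0 <= u -> u < r ->
  `|jump_at l r| <= var l r - var l u.
Proof.
move=> cl bv u0 ur.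
have ll := cadlag_has_left_lim cl (le_lt_trans u0 ur).
apply: (@le_of_has_left_lim _ (fun v => `|l r - l v|) r) => [w w0|].
  have [d d0 hd] := ll w w0; exists d => // v vr.
  have := hd v vr; have := ler_normD (l r - l v) (l v - left_lim l r).
  by rewrite addrA subrK /jump_at; lra.
exists (r - u); first lra.
move=> v vr; have h1 := @var_step l v r bv ltac:(lra) ltac:(lra).
by have := @var_nd l u v bv u0 ltac:(lra); lra.
Qed.

Lemma jump0 l : jump_at l 0 = 0.
Proof. by rewrite /jump_at left_lim0 subrr. Qed.

Lemma jump_sum_le_path l s t (E : seq R) : cadlag l -> BV_loc l -> 0 <= s -> s <= t ->
  path <%R s E -> (forall r, r \in E -> r <= t) ->
  \sum_(r <- E) `|jump_at l r| <= var l t - var l s.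
Proof.
move=> cl bv; elim: E s => [|r E IH] s s0 st /=.
  by move=> _ _; rewrite big_nil subr_ge0 var_nd.
move=> /andP[sr pE] Et; rewrite big_cons.
have rt : r <= t by apply: Et; rewrite mem_head.
have := jump_le_var cl bv s0 sr.
have := IH r ltac:(lra) rt pE (fun q qE => Et q (mem_behead (s := r :: E) qE)); lra.
Qed.

End variation.

(** * The jump part of a path of bounded variation *)

Section jump_part.
Context {R : realType} {V : completeNormedModType R}.
Implicit Types (l : R -> V).
Import summability.

Lemma partial_sumE (Z : zmodType) (f : R -> Z) (A : {fset R}) :
  partial_sum f A = \sum_(r <- A) f r.
Proof. by rewrite /partial_sum big_seq_fsetE. Qed.

(** A finite set whose absolute sum is within [e] of the supremum leaves less than [e] to any
    disjoint finite set, so the net of partial sums is Cauchy. *)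
Lemma abs_summable_cvg (f : R -> V) (C : R) :
  (forall A : {fset R}, \sum_(r <- A) `|f r| <= C) ->
  cvg (partial_sum f @ totally).
Proof.
move=> fC.
pose S := [set x | exists A : {fset R}, x = \sum_(r <- A) `|f r|].
have hS : has_sup S.
  split; first by exists (\sum_(r <- fset0) `|f r|), fset0.
  by exists C => _ [A ->].
have PF : ProperFilter (partial_sum f @ totally).
  by apply: fmap_proper_filter; exact: totally_filter.
apply/cauchy_cvgP/cauchy_exP => e e0.
have [_ [A ->] hA] := sup_adherent e0 hS.
exists (partial_sum f A); exists A => // B /= AB.
rewrite -ball_normE /= !partial_sumE.
have split_sum (Z : zmodType) (h : R -> Z) :
    \sum_(r <- B) h r = \sum_(r <- A) h r + \sum_(r <- (B `\` A)%fset) h r.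
  rewrite (big_fsetID _ (mem A)) /=; congr (_ + _); apply: eq_fbigl => r.
    by rewrite !inE /=; apply/andP/idP => [[]//|rA]; split => //; exact: (fsubsetP AB).
  by rewrite !inE /= andbC.
rewrite (split_sum _ f) opprD addrA subrr sub0r normrN.
apply: (le_lt_trans (ler_norm_sum _ _ _)).
have : \sum_(r <- B) `|f r| <= sup S by apply: (ub_le_sup hS.2); exists B.
rewrite (split_sum _ (fun r => `|f r|)); lra.
Qed.

Lemma jump_sum_le l (s t : R) (A : {fset R}) : cadlag l -> BV_loc l -> 0 <= s -> s <= t ->
  \sum_(r <- A | s < r <= t) `|jump_at l r| <= var l t - var l s.
Proof.
move=> cl bv s0 st; rewrite -big_filter.
rewrite -(perm_big _ (permEl (perm_sort <=%R _))) /=.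
apply: jump_sum_le_path => //; last first.
  by move=> r; rewrite mem_sort mem_filter => /andP[/andP[]].
rewrite path_min_sorted; last first.
  by apply/allP => r; rewrite mem_sort mem_filter => /andP[/andP[]].
rewrite lt_sorted_uniq_le sort_uniq filter_uniq ?fset_uniq //=.
by apply: sort_sorted => x y; exact: le_total.
Qed.

Let J l (t s : R) := if 0 <= s <= t then jump_at l s else 0.

Lemma jump_part_cvg l t : cadlag l -> BV_loc l -> 0 <= t ->
  partial_sum (J l t) @ totally --> jump_part l t.
Proof.
move=> cl bv t0; apply: (@abs_summable_cvg _ (var l t)) => A.
have := jump_sum_le A cl bv (lexx _) t0; rewrite var0 subr0; apply: le_trans.
rewrite [leRHS]big_mkcond; apply: ler_sum => r _ /=; rewrite /J.
case: (ltP 0 r) => r0 /=; first by rewrite (ltW r0) /=; case: ifP; rewrite ?normr0.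
case: ifP => [/andP[r0' _]|]; rewrite ?normr0 //.
(* The index 0 belongs to [[0, t]] but not to []0, t]]; the convention on left limits makes its jump
   vanish. *)
by rewrite (_ : r = 0) ?jump0 ?normr0 //; lra.
Qed.

(** Closed conditions pass from finite sums of jumps to the limit. This serves both for a norm bound
    and for the normality of the jumps. *)
Lemma jump_part_incr_mem l s t (C : set V) : cadlag l -> BV_loc l -> 0 <= s -> s <= t ->
  closed C -> (forall A : {fset R}, C (\sum_(r <- A | s < r <= t) jump_at l r)) ->
  C (jump_part l t - jump_part l s).
Proof.
move=> cl bv s0 st clC hC.
have TF : ProperFilter (@totally R) by exact: totally_filter.
have c1 := jump_part_cvg cl bv (le_trans s0 st).
have c2 := jump_part_cvg cl bv s0.
apply: (@closed_cvg _ _ _ TF _ C clC _ _ (cvgB c1 c2)).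
apply: nearW => A /=.
rewrite [X in C X](_ : _ = \sum_(r <- A | s < r <= t) jump_at l r) //.
rewrite -[LHS]/(partial_sum (J l t) A - partial_sum (J l s) A) !partial_sumE -sumrB.
rewrite [RHS]big_mkcond; apply: eq_bigr => r _; rewrite /J.
case: (leP r s) => rs /=.
  case: (leP 0 r) => r0 /=; last by rewrite subrr.
  by rewrite (le_trans rs st) subrr.
by rewrite andbF subr0 (le_trans s0 (ltW rs)).
Qed.

Lemma jump_part_incr_norm l s t : cadlag l -> BV_loc l -> 0 <= s -> s <= t ->
  `|jump_part l t - jump_part l s| <= var l t - var l s.
Proof.
move=> cl bv s0 st.
apply: (@jump_part_incr_mem l s t [set v | `|v| <= var l t - var l s]) => //.
  move=> x /closureP_norm h /=; apply/ler_addgt0Pr => e e0.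
  have [y /= hy xy] := h e e0.
  by have := ler_normB y (y - x); rewrite subKr; lra.
move=> A /=; apply: le_trans (jump_sum_le A cl bv s0 st); exact: ler_norm_sum.
Qed.

End jump_part.

(** * Half-open intervals and increments of Bochner integrals *)

Lemma lebesgue_stieltjes_oc {R : realType} (F : cumulative R R) (a b : R) : a <= b ->
  lebesgue_stieltjes_measure F (`]a, b]%classic : set (measurableTypeR R)) = (F b - F a)%:E.
Proof.
move=> ab; rewrite /lebesgue_stieltjes_measure /measure_extension measurable_mu_extE /=.
  by rewrite wlength_itv_bnd.
by exists (a, b).
Qed.

Lemma lebesgue_oc {R : realType} (a b : R) : a <= b ->
  lebesgue_measure (`]a, b]%classic : set (measurableTypeR R)) = (b - a)%:E.
Proof.
move=> ab; rewrite lebesgue_measure_itv /= lte_fin; case: ltP => ba //.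
by rewrite (_ : a = b) ?subrr //; lra.
Qed.

Lemma has_integral_empty {R : realType} {U V W : normedModType R}
  (mu : {measure set (measurableTypeR R) -> \bar R}) (op : U -> V -> W) f g s :
  has_integral mu op f g s s 0.
Proof.
have e0 : (`]s, s]%classic : set (measurableTypeR R)) = set0 by rewrite set_itvoc0.
exists (fun=> [::]); split => [n q //|n||]; rewrite ?e0.
- exact: measurable_fun_set0.
- under eq_fun do rewrite integral_set0; exact: cvg_cst.
- rewrite /step_int; under eq_fun do rewrite big_nil; exact: cvg_cst.
Qed.

Lemma Bochner_increment {R : realType} {V : normedModType R} (f : R -> V)
    (s t : R) v1 v2 u0 w : 0 <= s -> s <= t -> 0 <= w ->
  has_Bochner_integral f 0 s v1 -> has_Bochner_integral f 0 t v2 ->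
  (forall r, s < r <= t -> `|f r - u0| <= w) ->
  `|v2 - v1 - (t - s) *: u0| <= w * (t - s).
Proof.
move=> s0 st w0 h1 h2 h.
apply: (has_integral_approx _ _ s0 st _ _ w0 h1 h2 h (M := id)).
- by move=> u u' r; rewrite scalerDr.
- by move=> u r r'; rewrite scalerDl.
- by move=> a b a0 ab bt; exact: lebesgue_oc.
- by move=> u a b a0 ab bt; rewrite normrZ mulrC ger0_norm //= subr_ge0.
Qed.

(** * The Skorokhod problem *)

Section skorokhod.
Context {R : realType} {H : completeNormedModType R}.
Variable dot : {dot H for idfun}.
Hypothesis dot_norm : forall u : H, `|u| ^+ 2 = dot u u.
Variable A : H -> set H.
Hypothesis A_maxmon : maximal_monotone dot A.
Hypothesis A_ne : exists a b, A a b.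
Variables (m x k : R -> H).
Hypothesis m_cadlag : cadlag m.
Hypothesis SPxk : SP dot A (projection (closure (Dom A))) m x k.

Let C := closure (Dom A).
Let xc : cadlag x. Proof. by case: SPxk => -[]. Qed.
Let kc : cadlag k. Proof. by case: SPxk => -[]. Qed.
Let kbv : BV_loc k. Proof. by case: SPxk => _ _ []. Qed.
Let xkm t : 0 <= t -> x t + k t = m t. Proof. by case: SPxk => _ _ _ h _; exact: h. Qed.

Lemma SP_kE t : 0 <= t -> k t = m t - x t.
Proof. by move=> /xkm <-; rewrite addrAC subrr add0r. Qed.

Lemma SP_left_lim t : 0 <= t -> left_lim x t + left_lim k t = left_lim m t.
Proof.
rewrite le_eqVlt => /orP[/eqP <-|t0]; first by rewrite !left_lim0 xkm.
apply: (@has_left_lim_unique _ _ m t).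
  move=> w w0; have [d d0 hd] := has_left_limD (cadlag_has_left_lim xc t0)
    (cadlag_has_left_lim kc t0) w0.
  have [e e0 [e1 e2]] := exists_small d0 t0.
  by exists e => // r rt; rewrite -xkm; [apply: hd; lra | lra].
exact: cadlag_has_left_lim.
Qed.

Lemma SP_projection t : 0 <= t -> projection_spec dot C (m t - left_lim k t) (x t).
Proof.
move=> t0; case: SPxk => _ _ _ _ [_ /(_ t t0) ->].
have -> : left_lim x t + jump_at m t = m t - left_lim k t.
  by rewrite /jump_at -(SP_left_lim t0) opprD addrCA addNKr.
exact: projection_dom.
Qed.

Lemma SP_jumpE t : 0 <= t -> jump_at k t = (m t - left_lim k t) - x t.
Proof. by move=> t0; rewrite /jump_at (SP_kE t0) addrAC. Qed.

Lemma SP_jump_normal t c : 0 <= t -> C c -> dot (c - x t) (jump_at k t) <= 0.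
Proof.
move=> t0 Cc; rewrite (dotC dot) SP_jumpE //.
by case: (SP_projection t0) => _ /(_ c Cc).
Qed.

(** The inclusion for all of [dk], with the integrand frozen at [x s]. In the factor 3, two units
    come from the continuous part, whose increments are at most twice those of [var k], and one from
    the jumps. *)
Lemma SP_increment s t al be w : 0 <= s -> s <= t -> 0 <= w -> A al be ->
  (forall r, s < r <= t -> `|x r - x s| <= w) ->
  dot (al - x s) (k t - k s) <= (t - s) * dot (al - x s) be +
    w * (3 * (var k t - var k s) + `|be| * (t - s)).
Proof.
move=> s0 st w0 Aab xw.
have t0 := le_trans s0 st.
have [v [F [hF hv]] v0] : exists2 v : R^o, has_LS_integral (W := R^o) dot
    (fun r => x r - al) (fun r => cont_part k r - r *: be) s t v & 0 <= v.
  by case: SPxk => _ _ _ _ [h _]; exact: h.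
set l := fun r => _ in hF hv.
have lbv : BV_loc l by move=> T T0; rewrite -hF // ltry.
have FE r : 0 <= r -> F r = var l r.
  by move=> r0; apply: EFin_inj; rewrite hF // varE.
have jn a b : 0 <= a -> a <= b -> `|jump_part k b - jump_part k a| <= var k b - var k a.
  by move=> a0 ab; exact: jump_part_incr_norm.
have lG : controls l (fun r => 2 * var k r + `|be| * r) s t.
  move=> a b sa ab bt; have a0 := le_trans s0 sa.
  have -> : l b - l a = (k b - k a) - (jump_part k b - jump_part k a) - (b - a) *: be.
    by rewrite /l /cont_part; apply: (dot_ext dot_norm) => q; rewrite !(dotE dot); ring.
  have h1 := ler_normB (k b - k a - (jump_part k b - jump_part k a)) ((b - a) *: be).
  have h2 := ler_normB (k b - k a) (jump_part k b - jump_part k a).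
  have h3 := var_step kbv a0 ab; have h4 := jn a b a0 ab.
  have h5 : `|(b - a) *: be| = (b - a) * `|be| by rewrite normrZ ger0_norm // subr_ge0.
  lra.
have lv := var_incr_le lbv s0 st lG.
have h : `|v - 0 - dot (x s - al) (l t - l s)| <= w * (F t - F s).
  apply: (has_integral_approx (W := R^o) (f := fun r => x r - al) _ _ (lexx s) st _ _ w0
    (has_integral_empty _ _ _ _ _) hv).
  - by move=> u u' q; rewrite (dotDl dot).
  - by move=> u q q'; rewrite (dotDr dot).
  - by move=> a b _ ab _; exact: lebesgue_stieltjes_oc.
  - move=> u a b sa ab bt; apply: le_trans (norm_dot_le dot_norm _ _) _.
    have a0 := le_trans s0 sa; have b0 := le_trans a0 ab.
    by rewrite ler_wpM2l // !FE // var_step.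
  - by move=> r /xw; congr (_ <= _); congr (`|_|); rewrite opprB addrA subrK.
rewrite !FE // subr0 ler_norml in h; move/andP: h => [_ h].
have h2 : w * (var l t - var l s) <= w * (2 * (var k t - var k s) + `|be| * (t - s)).
  by apply: ler_wpM2l => //; lra.
(* The jump at [r] is normal at [x r] rather than at [x s]; the exchange costs at most [w] times its
   norm. *)
have jmp : dot (al - x s) (jump_part k t - jump_part k s) <= w * (var k t - var k s).
  apply: (@jump_part_incr_mem _ _ k s t
     [set q | dot (al - x s) q <= w * (var k t - var k s)]) => //.
    move=> z /closureP_norm hz /=; apply/ler_addgt0Pr => e e0.
    have n0 : 0 < `|al - x s| + 1 by rewrite ltr_wpDl.
    have [z' /= hz' zz'] := hz (e / (`|al - x s| + 1)) ltac:(by rewrite divr_gt0).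
    have := dot_ge_norm dot_norm (al - x s) (z' - z).
    have : `|al - x s| * `|z' - z| <= e.
      have q : (`|al - x s| + 1) * `|z' - z| <= e by rewrite mulrC -ler_pdivlMr // ltW.
      by have := normr_ge0 (z' - z); lra.
    by rewrite (dotDr dot) (dotNr dot); lra.
  move=> B.
  have sum_le : dot (al - x s) (\sum_(r <- B | s < r <= t) jump_at k r) <=
      w * (\sum_(r <- B | s < r <= t) `|jump_at k r|).
    rewrite (linear_sumr dot) mulr_sumr; apply: ler_sum => r sr.
    have r0 : 0 <= r by lra.
    have h3 : dot (al - x r) (jump_at k r) <= 0.
      by apply: SP_jump_normal => //; apply: subset_closure; exists be.
    have h4 := dot_le_norm dot_norm (x r - x s) (jump_at k r).
    have h5 : `|x r - x s| * `|jump_at k r| <= w * `|jump_at k r|.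
      by rewrite ler_wpM2r // xw.
    have q : dot (al - x s) (jump_at k r) <= w * `|jump_at k r|.
      rewrite (_ : al - x s = (al - x r) + (x r - x s)); last by rewrite addrA subrK.
      by rewrite (dotDl dot); lra.
    exact: q.
  by apply: (le_trans sum_le); rewrite ler_wpM2l // jump_sum_le.
have E : dot (al - x s) (k t - k s) = - dot (x s - al) (l t - l s) +
   dot (al - x s) (jump_part k t - jump_part k s) + (t - s) * dot (al - x s) be.
  by rewrite /l /cont_part !(dotE dot); ring.
lra.
Qed.

End skorokhod.

Lemma subr_interchange {Z : zmodType} (a b c d : Z) : a - b - (c - d) = a - c - (b - d).
Proof. by rewrite !opprD !opprK addrACA. Qed.

(** * Left limits as filter limits *)

Section left_limits.
Context {R : realType} {V : normedModType R}.

Lemma cvg_left_of (x : R -> V) t l : has_left_lim x t l -> x u @[u --> t^'-] --> l.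
Proof.
move=> h; apply/cvgrPdist_le => e e0; have [d d0 hd] := h e e0.
exists d => //= u; rewrite /ball_ /= => ut u_t; rewrite distrC; apply: hd.
by move: ut; rewrite ltr_norml; lra.
Qed.

Lemma left_limit_le (f : R -> R) a t l c : a < t -> f u @[u --> t^'-] --> l ->
  (forall u, a <= u < t -> f u <= c) -> l <= c.
Proof.
move=> at_ fl fc; rewrite -(cvg_lim (@norm_hausdorff _ _) fl).
apply: limr_le; first by apply/cvg_ex; exists l.
exists (t - a); first by rewrite /= subr_gt0.
move=> u; rewrite /ball_ /= => ut u_t; apply: fc.
by move: ut; rewrite ltr_norml; lra.
Qed.

Lemma lipschitz_left (f : R -> V) a t B : a < t ->
  (forall u, a <= u < t -> `|f t - f u| <= B * (t - u)) -> has_left_lim f t (f t).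
Proof.
move=> at_ fB w w0.
have [d d0 [d1 d2]] := @exists_small R (t - a) (w / (`|B| + 1)) ltac:(lra)
  ltac:(by rewrite divr_gt0 // ltr_wpDl).
exists d => // u ut; rewrite distrC.
have h := fB u ltac:(lra).
have B1 : 0 < `|B| + 1 by rewrite ltr_wpDl.
have h2 : d * (`|B| + 1) <= w by rewrite -ler_pdivlMr.
have h3 : B * (t - u) <= (`|B| + 1) * (t - u).
  by rewrite ler_wpM2r; [lra | lra | have := ler_norm B; lra].
have h4 : (`|B| + 1) * (t - u) <= (`|B| + 1) * d by rewrite ler_wpM2l; lra.
lra.
Qed.

End left_limits.

Lemma cvg_sqr_norm {R : realType} {H : normedModType R} (F : set_system R)
    (FF : Filter F) (y : R -> H) l :
  y u @[u --> F] --> l ->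
  `|y u| ^+ 2 @[u --> F] --> (`|l| ^+ 2 : R).
Proof.
by move=> yl; under eq_fun do rewrite expr2; rewrite expr2; apply: cvgM; apply: cvg_norm.
Qed.

Lemma left_shift {R : realType} {V : normedModType R} (f : R -> V) (t h : R) :
  f u @[u --> (t + h)^'-] --> f (t + h) ->
  f (u + h) @[u --> t^'-] --> f (t + h).
Proof.
move=> /cvgrPdist_le fl; apply/cvgrPdist_le => e e0.
have [d /= d0 hd] := fl e e0; exists d => //= u ut u_t; apply: hd; last by rewrite ltrD2r.
by move: ut; rewrite /ball_ /= opprD addrACA subrr addr0.
Qed.

(** Arithmetic for [var_growth]: at least half of the dissipation [3 / 2 * r * g] survives the
    factor [th], and this pays for [r / 2 * dL]. *)
Lemma growth_step {R : realFieldType} (dpsi psi th dt rate g r w w1 Y dL : R) :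
  0 <= dt -> 2^-1 <= th <= 1 -> 0 <= rate -> 0 <= psi -> 0 <= g -> 0 < r -> 0 <= w1 ->
  0 <= Y -> 0 <= w ->
  dpsi <= dt * (rate * psi - 3 / 2 * r * g) + (2 * Y * w1 + w / 2) * dt ->
  dL <= (g + w1) * dt -> w1 * (2 * (2 * Y + r / 2 + 1)) <= w ->
  dpsi * th - rate * dt * psi + r / 2 * dL <= w * dt.
Proof.
move=> dt0 th1 rate0 psi0 g0 r0 w10 Y0 w0 hpsi hL hw.
have th0 : 0 <= th by lra.
have p1 := ler_wpM2r th0 hpsi.
have p2 : dt * (rate * psi) * th <= dt * (rate * psi).
  by rewrite ler_piMr ?mulr_ge0 //; case/andP: th1.
have p3 : (2 * Y * w1 + w / 2) * dt * th <= (2 * Y * w1 + w / 2) * dt.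
  rewrite ler_piMr //; last by case/andP: th1.
  by rewrite mulr_ge0 // addr_ge0 ?mulr_ge0 ?divr_ge0.
have p4 : dt * (3 / 2 * r * g) * 2^-1 <= dt * (3 / 2 * r * g) * th.
  rewrite ler_wpM2l //; last by case/andP: th1.
  by rewrite !mulr_ge0 ?invr_ge0 // ltW.
have r20 : 0 <= r / 2 by lra.
have p5 := ler_wpM2l r20 hL.
have p6 := ler_wpM2r dt0 hw.
have p7 : 0 <= dt * (r * g) by rewrite !mulr_ge0 // ltW.
have p8 : 0 <= w1 * dt by rewrite mulr_ge0.
lra.
Qed.

(** * The approximate solution and its integral term *)

Section yosida_path.
Context {R : realType} {H : completeNormedModType R}.
Variable dot : {dot H for idfun}.
Hypothesis dot_norm : forall u : H, `|u| ^+ 2 = dot u u.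
Variable A : H -> set H.
Hypothesis A_maxmon : maximal_monotone dot A.
Hypothesis A_ne : exists a b, A a b.
Variables (m : R -> H) (eps : R) (xe : R -> H).
Hypothesis eps_gt0 : 0 < eps.
Hypothesis sol : yosida_solution A eps m xe.

Let K r := m r - xe r.
Let g r := yosida A eps (xe r).
Let L := var K.

Lemma path_increment s t u0 w : 0 <= s -> s <= t -> 0 <= w ->
  (forall r, s < r <= t -> `|g r - u0| <= w) ->
  `|K t - K s - (t - s) *: u0| <= w * (t - s).
Proof.
move=> s0 st w0 gw; have [_ solt] := sol.
have [v1 h1 E1] := solt s s0; have [v2 h2 E2] := solt t (le_trans s0 st).
have -> : K t = v2 by rewrite /K -E2 addrAC subrr add0r.
have -> : K s = v1 by rewrite /K -E1 addrAC subrr add0r.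
exact: Bochner_increment h1 h2 gw.
Qed.

Lemma path0 : K 0 = 0.
Proof.
have [_ /(_ 0 (lexx _))[v hv E]] := sol.
have -> : K 0 = v by rewrite /K -E addrAC subrr add0r.
have := @Bochner_increment _ _ _ 0 0 0 v 0 0 (lexx _) (lexx _) (lexx _)
  (has_integral_empty _ _ _ _ _) hv.
rewrite !subr0 scaler0 mulr0 subr0 => h; apply/eqP; rewrite -normr_le0; apply: h.
by move=> r; lra.
Qed.

Lemma g_right_cont s : 0 <= s -> right_cont g s.
Proof.
move=> s0 w w0; have [d d0 hd] := cadlag_right_cont sol.1 s0 (mulr_gt0 eps_gt0 w0).
exists d => // r /hd h; rewrite -(ler_pM2l eps_gt0); apply: le_trans h.
exact: yosida_lipschitz.
Qed.

Lemma path_bounded_rate T : 0 <= T ->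
  exists2 B, 0 <= B & forall r, 0 <= r <= T -> `|g r| <= B.
Proof.
move=> T0; have [B B0 hB] := cadlag_bounded sol.1 T0.
exists (eps^-1 * (B + B) + `|g 0|) => [|r rT].
  by rewrite addr_ge0 // mulr_ge0 ?invr_ge0 ?addr_ge0 // ltW.
have h := yosida_lipschitz dot_norm A_maxmon A_ne eps_gt0 (xe r) (xe 0).
have h1 := hB r rT; have h2 := hB 0 ltac:(lra).
have h3 : `|g r - g 0| <= eps^-1 * (B + B).
  rewrite -(ler_pM2l eps_gt0) mulrA mulfV ?gt_eqF // mul1r; apply: (le_trans h).
  by apply: (le_trans (ler_normB _ _)); lra.
have := ler_normD (g r - g 0) (g 0); rewrite subrK; lra.
Qed.

Lemma path_lipschitz T : 0 <= T -> exists2 B, 0 <= B & controls K (fun r => B * r) 0 T.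
Proof.
move=> T0; have [B B0 hB] := path_bounded_rate T0; exists B => // s t s0 st tT.
have := @path_increment s t 0 B s0 st B0; rewrite scaler0 subr0 mulrBr; apply.
by move=> r rst; rewrite subr0; apply: hB; lra.
Qed.

Lemma path_BV : BV_loc K.
Proof.
by apply: lipschitz_BV_loc => T T0; have [B _ hB] := path_lipschitz T0; exists B.
Qed.

Lemma path_left t : 0 < t -> has_left_lim K t (K t).
Proof.
move=> t0; have [B _ hB] := path_lipschitz (ltW t0).
apply: (lipschitz_left (B := B) t0) => u ut.
by have := hB u t; rewrite mulrBr; apply; lra.
Qed.

Lemma path_cvg_left t : 0 < t -> K u @[u --> t^'-] --> K t.
Proof. by move=> t0; apply/cvg_left_of/path_left. Qed.

Lemma path_var_cvg_left t : 0 < t -> L u @[u --> t^'-] --> (L t : R).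
Proof.
move=> t0; apply: (@cvg_left_of R R^o); have [B _ hB] := path_lipschitz (ltW t0).
apply: (@lipschitz_left R R^o L 0 t B t0) => u ut.
have h : L t - L u <= B * t - B * u.
  apply: var_incr_le path_BV _ _ _; [lra|lra|].
  by move=> x y ux xy yt; apply: hB; lra.
have := var_nd path_BV (x := u) (y := t) ltac:(lra) ltac:(lra).
by move=> h2; rewrite ger0_norm ?subr_ge0 // mulrBr.
Qed.

Lemma path_right s w : 0 <= s -> 0 < w -> exists2 d, 0 < d & forall t, s <= t < s + d ->
  [/\ `|K t - K s - (t - s) *: g s| <= w * (t - s),
      `|K t - K s| <= (`|g s| + w) * (t - s),
      (`|g s| - w) * (t - s) <= L t - L s &
      L t - L s <= (`|g s| + w) * (t - s)].
Proof.
move=> s0 w0; have [d d0 hd] := g_right_cont s0 w0.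
exists d => // t st.
have h1 : `|K t - K s - (t - s) *: g s| <= w * (t - s).
  by apply: path_increment => //; [lra|lra|move=> r rst; apply: hd; lra].
have gE : `|(t - s) *: g s| = `|g s| * (t - s).
  by rewrite normrZ mulrC ger0_norm //; lra.
have h2 : `|K t - K s| <= (`|g s| + w) * (t - s).
  have := ler_normD (K t - K s - (t - s) *: g s) ((t - s) *: g s).
  by rewrite subrK; lra.
have h3 := var_step path_BV s0 (_ : s <= t).
split => //.
- have := ler_normB (K t - K s) (K t - K s - (t - s) *: g s).
  rewrite subKr; have := h3 ltac:(lra); rewrite -/L; lra.
- rewrite mulrBr; apply: (@var_incr_le _ _ K (fun r => (`|g s| + w) * r) s t path_BV s0).
    lra.
  move=> x y sx xy yt; rewrite -mulrBr.
  have := @path_increment x y 0 (`|g s| + w) ltac:(lra) xy ltac:(by rewrite addr_ge0 // ltW).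
  rewrite scaler0 subr0; apply => r rxy; rewrite subr0.
  have := hd r ltac:(lra); have := ler_normD (g r - g s) (g s); rewrite subrK; lra.
Qed.

Lemma path_norm_le t : 0 <= t -> `|K t| <= L t.
Proof.
by move=> t0; have := var_step path_BV (lexx 0) t0; rewrite path0 var0 !subr0.
Qed.

(* If [|g| > Q] on the whole interval then [var K] grows faster than [Q t]. *)
Lemma exists_small_rate a d C0 : 0 <= a -> 0 < d -> L (a + d) <= C0 ->
  exists2 c, a <= c < a + d & `|g c| <= (C0 + 1) / d.
Proof.
move=> a0 d0 LC; apply: contrapT => hn.
have big c : a <= c < a + d -> (C0 + 1) / d <= `|g c|.
  by move=> cd; rewrite leNgt; apply/negP => h; apply: hn; exists c => //; exact: ltW.
pose Q := (C0 + 1) / d.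
have : Q * (a + d) - L (a + d) <= Q * a - L a.
  apply: (@nonincreasing_of_right_approx _ (fun t => Q * t - L t) (fun=> 0)) => //; first lra.
    move=> w s w0 sad; have s0 : 0 <= s by lra.
    have [e e0 he] := path_right s0 w0.
    exists e => // t st tad; have [_ _ h _] := he t ltac:(lra).
    have : Q * (t - s) <= `|g s| * (t - s) by apply: ler_wpM2r; [lra | apply: big; lra].
    lra.
  move=> t c tad fc; apply: (left_limit_le (a := a) (f := fun t => Q * t - L t) (t := t) _ _ fc).
    lra.
  apply: cvgB; last by apply: path_var_cvg_left; lra.
  by apply: cvgMr; apply: cvg_at_left_filter; exact: cvg_id.
have -> : Q * (a + d) = Q * a + (C0 + 1) by rewrite mulrDr divfK // gt_eqF.
have := var_ge0 path_BV a0; rewrite -/L; lra.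
Qed.

Section growth.
Variables (a1 b1 : H) (r1 mu : R).
Hypothesis Aab1 : A a1 b1.
Hypothesis r1_gt0 : 0 < r1.
Hypothesis mu_ge0 : 0 <= mu.
Hypothesis int_bound : forall z y, A z y ->
  r1 * `|y| <= dot y (z - a1) + mu * (1 + `|z - a1|).
Hypothesis eps_le1 : eps <= 1.

Lemma resolvent_dist z : `|resolvent A eps z - a1| <= `|z - a1| + `|b1|.
Proof.
have h1 := resolvent_nonexpansive dot_norm A_maxmon A_ne eps_gt0 z a1.
have h2 := norm_yosida_le dot_norm A_maxmon A_ne eps_gt0 Aab1.
have h3 : `|resolvent A eps a1 - a1| <= `|b1|.
  rewrite resolventE // addrAC subrr add0r normrN normrZ gtr0_norm //.
  have : eps * `|yosida A eps a1| <= 1 * `|yosida A eps a1| by rewrite ler_wpM2r.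
  lra.
have := ler_normD (resolvent A eps z - resolvent A eps a1) (resolvent A eps a1 - a1).
rewrite addrA subrK; lra.
Qed.

Lemma yosida_size z : eps * `|yosida A eps z| <= 2 * `|z - a1| + `|b1|.
Proof.
have -> : eps * `|yosida A eps z| = `|(z - a1) - (resolvent A eps z - a1)|.
  have -> : z - a1 - (resolvent A eps z - a1) = eps *: yosida A eps z.
    by rewrite resolventE //; apply: (dot_ext dot_norm) => q; rewrite !(dotE dot); ring.
  by move: (yosida A eps z) => y; rewrite normrZ gtr0_norm.
by have := ler_normB (z - a1) (resolvent A eps z - a1); have := resolvent_dist z; lra.
Qed.

(** Chosen so that [2 mu (1 + |J (xe s) - a1|)] is at most this multiple of [1 + |y s - a1|^2] in
    [var_growth]; the last summand keeps it positive. *)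
Definition growth_rate := 2 * mu * (2 + `|b1| + r1) + 1.

(** By the interior point, [dot (y - a1) g] controls [|g|], so the decrease of [|y - a1|^2] pays for
    the growth of [L]. Freezing [m] at [a] makes [y] continuous, and the half-open condition leaves
    room for a jump of [m] at [b]. *)
Lemma var_growth a b : 0 <= a -> a <= b -> growth_rate * (b - a) <= 2^-1 ->
  (forall r, a <= r < b -> `|m r - m a| <= r1 / 4) ->
  L b - L a <= 2 / r1 * (1 + `|m a - K a - a1| ^+ 2).
Proof.
move=> a0 ab cba osc.
have [r10 mu0 e10] := And3 r1_gt0 mu_ge0 eps_gt0.
pose y r := m a - K r.
pose psi r := 1 + `|y r - a1| ^+ 2.
have c0 : 0 < growth_rate by rewrite ltr_wpDl // !mulr_ge0 // !addr_ge0 // ltW.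
have psi1 r : 1 <= psi r by rewrite lerDl exprn_ge0.
(* Twice [int_bound]; replacing [xe] by [y] costs [r1 / 2 * |g s|] of the term [2 * r1 * |g s|]. *)
have drift s : a <= s < b ->
    3 / 2 * r1 * `|g s| - growth_rate * psi s <= 2 * dot (y s - a1) (g s).
  move=> sab.
  have Am : A (resolvent A eps (xe s)) (g s) by exact: yosida_mem.
  have h := int_bound Am; have hJ := resolvent_dist (xe s).
  have ys : `|(xe s - a1) - (y s - a1)| <= r1 / 4.
    have -> : xe s - a1 - (y s - a1) = m s - m a.
      by rewrite /y /K; apply: (dot_ext dot_norm) => q; rewrite !(dotE dot); ring.
    exact: osc.
  have xy : `|xe s - a1| <= `|y s - a1| + r1 / 4.
    by have := ler_normD (xe s - a1 - (y s - a1)) (y s - a1); rewrite subrK; lra.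
  have h2 := dot_le_norm dot_norm (g s) (xe s - a1 - (y s - a1)).
  have h3 : `|g s| * `|xe s - a1 - (y s - a1)| <= `|g s| * (r1 / 4) by rewrite ler_wpM2l.
  have h4 : 0 <= eps * dot (g s) (g s) by rewrite mulr_ge0 ?dot_ge0 // ltW.
  have h5 : dot (g s) (resolvent A eps (xe s) - a1) =
      dot (g s) (xe s - a1) - eps * dot (g s) (g s).
    by rewrite resolventE // -/(g s) !(dotE dot); ring.
  have yp : `|y s - a1| <= psi s.
    rewrite /psi; have := sqr_ge0 (`|y s - a1| - 1); have := sqr_ge0 (`|y s - a1|).
    by rewrite !expr2; lra.
  have h6 : 2 * (mu * (1 + `|resolvent A eps (xe s) - a1|)) <= growth_rate * psi s.
    have b0 := normr_ge0 b1; have p1 := psi1 s.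
    have q1 : 1 + `|resolvent A eps (xe s) - a1| <= (2 + `|b1| + r1) * psi s.
      have : `|b1| <= `|b1| * psi s by rewrite ler_peMr.
      have : r1 <= r1 * psi s by rewrite ler_peMr // ltW.
      lra.
    have q2 := ler_wpM2l mu_ge0 q1.
    rewrite /growth_rate; lra.
  have h7 : dot (g s) (xe s - a1) = dot (g s) (xe s - a1 - (y s - a1)) + dot (y s - a1) (g s).
    move: (xe s - a1) (y s - a1) (g s) => p q w.
    by rewrite (dotC dot q w) -(dotDr dot) subrK.
  lra.
(* A linear substitute for the integrating factor [exp (- growth_rate (t - a))]; by the bound on
   [b - a] it stays above one half. *)
pose Phi t := psi t * (1 - growth_rate * (t - a)) + r1 / 2 * L t.
have : Phi b <= Phi a.
  apply: (@nonincreasing_of_right_approx _ Phi (fun=> 0)) => //.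
    move=> w s w0 sab; have s0 : 0 <= s by lra.
    pose G := `|g s| + 1.
    have G0 : 0 < G by rewrite ltr_wpDl.
    pose c := 2 * `|y s - a1| + r1 / 2 + 1.
    have cc0 : 0 < c by rewrite ltr_wpDl // addr_ge0 ?mulr_ge0 ?divr_ge0 // ltW.
    have [w1 w10 [w11 w1c]] := @exists_small R 1 (w / (2 * c)) ltac:(lra)
      ltac:(by rewrite divr_gt0 // mulr_gt0).
    have [d d0 hd] := path_right s0 w10.
    have [e e0 [ed eG]] := @exists_small R d (w / (2 * G ^+ 2)) d0
      ltac:(by rewrite divr_gt0 // mulr_gt0 // exprn_gt0).
    exists e => // t st tb; have [h1 h2 _ h4] := hd t ltac:(lra).
    rewrite subrr addr0.
    have dt0 : 0 <= t - s by rewrite subr_ge0; case/andP: st => /ltW.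
    have w1c' : w1 * (2 * c) <= w by rewrite -ler_pdivlMr ?mulr_gt0.
    have eG' : e * (2 * G ^+ 2) <= w by rewrite -ler_pdivlMr // mulr_gt0 // exprn_gt0.
    have K2 : `|K t - K s| ^+ 2 <= w / 2 * (t - s).
      have q1 : `|K t - K s| <= G * (t - s).
        apply: (le_trans h2); apply: ler_wpM2r => //; rewrite /G; lra.
      have q2 : `|K t - K s| ^+ 2 <= (G * (t - s)) ^+ 2.
        by rewrite ler_pXn2r // nnegrE // mulr_ge0 // ltW.
      apply: (le_trans q2); rewrite exprMn (expr2 (t - s)) mulrA.
      apply: ler_wpM2r => //.
      have : G ^+ 2 * (t - s) <= G ^+ 2 * e by rewrite ler_wpM2l ?exprn_ge0 //; lra.
      lra.
    have dpsi : psi t - psi s <= (t - s) * (growth_rate * psi s - 3 / 2 * r1 * `|g s|) +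
        (2 * `|y s - a1| * w1 + w / 2) * (t - s).
      have e1 : psi t - psi s = - 2 * dot (y s - a1) (K t - K s) + `|K t - K s| ^+ 2.
        rewrite /psi /y !dot_norm.
        have -> : m a - K t - a1 = (m a - K s - a1) - (K t - K s).
          by apply: (dot_ext dot_norm) => q; rewrite !(dotE dot); ring.
        move: (m a - K s - a1) (K t - K s) => u v.
        by rewrite !(dotE dot) (dotC dot v u); ring.
      have e2 : dot (y s - a1) (K t - K s) = (t - s) * dot (y s - a1) (g s) +
          dot (y s - a1) (K t - K s - (t - s) *: g s).
        by rewrite !(dotE dot); ring.
      have e3 := dot_ge_norm dot_norm (y s - a1) (K t - K s - (t - s) *: g s).
      have e4 := ler_wpM2l (normr_ge0 (y s - a1)) h1.
      have e5 := ler_wpM2l dt0 (drift s sab).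
      lra.
    pose th := 1 - growth_rate * (t - a).
    have th1 : 2^-1 <= th <= 1.
      have at_ : a <= t.
        by case/andP: sab => as_ _; apply: le_trans as_ _; rewrite -subr_ge0.
      have q1 : growth_rate * (t - a) <= growth_rate * (b - a).
        by rewrite ler_wpM2l ?lerD2r // ltW.
      have q2 : 0 <= growth_rate * (t - a) by rewrite mulr_ge0 ?subr_ge0 // ltW.
      apply/andP; split; last by rewrite gerBl.
      by rewrite lerBrDl -lerBrDr (le_trans q1) // (le_trans cba) //; lra.
    have -> : Phi t = Phi s + ((psi t - psi s) * th - growth_rate * (t - s) * psi s +
        r1 / 2 * (L t - L s)) by rewrite /Phi /th; ring.
    rewrite lerD2l; apply: (growth_step dt0 th1 (ltW c0) (le_trans ler01 (psi1 s))
      (normr_ge0 (g s)) r10 (ltW w10) (normr_ge0 (y s - a1)) (ltW w0) dpsi h4 w1c').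
  move=> t c tab fc.
  apply: (left_limit_le (a := a) (f := Phi) (t := t) (l := Phi t) _ _ fc); first lra.
  rewrite /Phi; apply: cvgD; last by apply: cvgMr; apply: path_var_cvg_left; lra.
  apply: cvgM.
    rewrite /psi; apply: cvgD; first exact: cvg_cst.
    apply: cvg_sqr_norm; apply: cvgB; last exact: cvg_cst.
    by apply: cvgB; [exact: cvg_cst | apply: path_cvg_left; lra].
  apply: cvgB; first exact: cvg_cst.
  apply: cvgMr; apply: cvgB; last exact: cvg_cst.
  by apply: cvg_at_left_filter; exact: cvg_id.
rewrite /Phi subrr mulr0 subr0 mulr1 => h.
have h1 : 0 <= psi b * (1 - growth_rate * (b - a)).
  by rewrite mulr_ge0 //; [have := psi1 b; lra | lra].
have h2 : r1 / 2 * (L b - L a) <= psi a by lra.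
rewrite -(ler_pM2l (_ : 0 < r1 / 2)) ?divr_gt0 //.
apply: (le_trans h2); rewrite mulrA (_ : r1 / 2 * (2 / r1) = 1) ?mul1r //.
by field; lra.
Qed.

End growth.

(* Both [xe] and its translate solve the same equation up to the oscillation
   of [m]. *)
Lemma shift_le a b s r h eta : 0 <= a -> a <= s -> s <= r -> 0 <= h -> r + h < b ->
  0 <= eta -> (forall u v, a <= u < b -> a <= v < b -> `|m u - m v| <= eta) ->
  `|K (r + h) - K r| ^+ 2 <= `|K (s + h) - K s| ^+ 2 + 2 * eta * (L (r + h) + L r).
Proof.
move=> a0 as_ sr h0 rhb eta0 osc.
have s0 := le_trans a0 as_.
pose D u := K (u + h) - K u.
(* In the derivative [2 dot D (g (u + h) - g u)], the part of [D] from [xe] has a favourable sign by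
   monotonicity. The part from [m] costs at most [2 eta (|g (u + h)| + |g u|)], the rate of the
   subtracted term. *)
pose Phi u := `|D u| ^+ 2 - 2 * eta * (L (u + h) + L u).
have : Phi r <= Phi s.
  apply: (@nonincreasing_of_right_approx _ Phi (fun=> 0)) => //.
    move=> w u w0 sur; have u0 : 0 <= u by lra.
    have uh0 : 0 <= u + h by lra.
    pose c := 4 * `|D u| + 4 * eta + 1.
    have c0 : 0 < c by rewrite ltr_wpDl // addr_ge0 ?mulr_ge0.
    pose G := `|g u| + `|g (u + h)| + 2.
    have G0 : 0 < G by rewrite ltr_wpDl // addr_ge0.
    have [w1 w10 [w11 w1c]] := @exists_small R 1 (w / (2 * c)) ltac:(lra)
      ltac:(by rewrite divr_gt0 // mulr_gt0).
    have [d1 d10 hd1] := path_right u0 w10.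
    have [d2 d20 hd2] := path_right uh0 w10.
    have [d d0 [dd1 dd2]] := exists_small d10 d20.
    have [e e0 [ed eG]] := @exists_small R d (w / (2 * G ^+ 2)) d0
      ltac:(by rewrite divr_gt0 // mulr_gt0 // exprn_gt0).
    exists e => // t ut tr; have [h1 h2 h3 _] := hd1 t ltac:(lra).
    have [k1 k2 k3 _] := hd2 (t + h) ltac:(lra).
    rewrite subrr addr0.
    have tE : t + h - (u + h) = t - u by rewrite opprD addrACA subrr addr0.
    rewrite tE in k1 k2 k3.
    have dt0 : 0 <= t - u by rewrite subr_ge0; case/andP: ut => /ltW.
    have w1c' : w1 * (2 * c) <= w by rewrite -ler_pdivlMr ?mulr_gt0.
    have eG' : e * (2 * G ^+ 2) <= w by rewrite -ler_pdivlMr // mulr_gt0 // exprn_gt0.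
    have DD : D t - D u = (K (t + h) - K (u + h)) - (K t - K u).
      by rewrite /D subr_interchange.
    have D2 : `|D t - D u| ^+ 2 <= w / 2 * (t - u).
      have q1 : `|D t - D u| <= G * (t - u).
        rewrite DD; apply: (le_trans (ler_normB _ _)).
        have : w1 * (t - u) <= 1 * (t - u) by rewrite ler_wpM2r.
        move: h2 k2; rewrite /G; lra.
      have q2 : `|D t - D u| ^+ 2 <= (G * (t - u)) ^+ 2.
        by rewrite ler_pXn2r // nnegrE // mulr_ge0 // ltW.
      apply: (le_trans q2); rewrite exprMn (expr2 (t - u)) mulrA.
      apply: ler_wpM2r => //.
      have : G ^+ 2 * (t - u) <= G ^+ 2 * e by rewrite ler_wpM2l ?exprn_ge0 //; lra.
      lra.
    have lin : dot (D u) (D t - D u) <= (t - u) * (eta * (`|g (u + h)| + `|g u|)) +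
        2 * `|D u| * w1 * (t - u).
      pose rho := (K (t + h) - K (u + h) - (t - u) *: g (u + h)) -
        (K t - K u - (t - u) *: g u).
      have -> : D t - D u = (t - u) *: (g (u + h) - g u) + rho.
        rewrite DD /rho; move: (K (t + h) - K (u + h)) (K t - K u) (g (u + h)) (g u) => p q p' q'.
        by apply: (dot_ext dot_norm) => z; rewrite !(dotE dot); ring.
      have r1 : `|rho| <= 2 * w1 * (t - u).
        by apply: (le_trans (ler_normB _ _)); lra.
      have r2 := dot_le_norm dot_norm (D u) rho.
      have r3 := ler_wpM2l (normr_ge0 (D u)) r1.
      have Dx : D u = (m (u + h) - m u) - (xe (u + h) - xe u).
        by rewrite /D /K subr_interchange.
      have r4 : 0 <= dot (xe (u + h) - xe u) (g (u + h) - g u) by exact: yosida_monotone.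
      have r5 := dot_le_norm dot_norm (m (u + h) - m u) (g (u + h) - g u).
      have r6 : `|m (u + h) - m u| * `|g (u + h) - g u| <= eta * (`|g (u + h)| + `|g u|).
        by apply: ler_pM => //; [apply: osc; lra | exact: ler_normB].
      have r7 : dot (D u) (g (u + h) - g u) <= eta * (`|g (u + h)| + `|g u|).
        rewrite Dx (dotDl dot) (dotNl dot).
        lra.
      have r8 := ler_wpM2l dt0 r7.
      rewrite (dotDr dot) (dotZr dot); move: r2 r3 r8; lra.
    have -> : Phi t = Phi u + (2 * dot (D u) (D t - D u) + `|D t - D u| ^+ 2)
       - 2 * eta * ((L (t + h) - L (u + h)) + (L t - L u)).
      rewrite /Phi !dot_norm.
      have -> : dot (D t) (D t) = dot (D u) (D u) + (2 * dot (D u) (D t - D u)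
          + dot (D t - D u) (D t - D u)).
        move: (D t) (D u) => p q.
        by rewrite !(dotE dot) (dotC dot q p); ring.
      by ring.
    have l1 := ler_wpM2l eta0 h3; have l2 := ler_wpM2l eta0 k3.
    have p6 : w1 * (2 * c) * (t - u) <= w * (t - u) by rewrite ler_wpM2r.
    have p8 : 0 <= w1 * (t - u) by rewrite mulr_ge0 // ltW.
    rewrite /c in p6; lra.
  move=> t c tsr fc.
  apply: (left_limit_le (a := s) (f := Phi) (t := t) (l := Phi t) _ _ fc); first lra.
  have t0 : 0 < t by lra.
  have th0 : 0 < t + h by lra.
  rewrite /Phi; apply: cvgB.
    apply: cvg_sqr_norm; apply: cvgB; last exact: path_cvg_left.
    exact: left_shift (path_cvg_left th0).
  apply: cvgMr; apply: cvgD; last exact: path_var_cvg_left.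
  exact: (@left_shift R R^o) (path_var_cvg_left th0).
have L1 := var_ge0 path_BV s0; have L2 := var_ge0 path_BV (_ : 0 <= s + h).
have : 0 <= 2 * eta * (L (s + h) + L s).
  by rewrite !mulr_ge0 // addr_ge0 //; apply: L2; lra.
move=> q hPhi; move: hPhi q; rewrite /Phi /D; lra.
Qed.

(** By [shift_le], a large increment of [K] on [[r - h, r]] forces nearly as large increments on all
    earlier windows of length [h]. As [n] disjoint windows fit into [[a, a + delta]], the bound on
    [L] limits each of them to [C0 / n]. *)
Lemma window_small a b delta C0 sigma (n : nat) r h : 0 <= a -> 0 <= C0 -> 0 < sigma ->
  (0 < n)%N -> n%:R * h <= delta -> 0 <= h ->
  (forall t, 0 <= t <= b -> L t <= C0) ->
  (forall u v, a <= u < b -> a <= v < b -> `|m u - m v| <= sigma ^+ 2) ->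
  a + delta <= r -> r < b ->
  `|K r - K (r - h)| <= (2 * C0 + 1) * sigma + C0 / n%:R.
Proof.
move=> a0 C00 s0 n0 nh h0 LC osc ar rb.
have nR : (0 : R) < n%:R by rewrite ltr0n.
set M := `|K r - K (r - h)|.
(* With [eta = sigma ^+ 2], the loss in [shift_le] is at most [4 * C0 * sigma ^+ 2], hence at most
   [(c * sigma) ^+ 2]. *)
pose c := 2 * C0 + 1.
have c0 : 0 < c by rewrite ltr_wpDl // mulr_ge0.
case: (leP M (c * sigma)) => Mc.
  by apply: (le_trans Mc); rewrite lerDl divr_ge0 // ltW.
pose q := M - c * sigma.
have d0 : 0 <= delta := le_trans (mulr_ge0 (ltW nR) h0) nh.
have r0 : 0 <= r by lra.
have step j : (j <= n)%N -> L a + j%:R * q <= L (a + j%:R * h).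
  elim: j => [|j IH] jn; first by rewrite !mul0r !addr0.
  have jh : (j.+1)%:R * h <= n%:R * h by rewrite ler_wpM2r // ler_nat.
  have jh0 : 0 <= j%:R * h by rewrite mulr_ge0.
  have E : a + j.+1%:R * h = a + j%:R * h + h by rewrite -natr1; ring.
  rewrite E; rewrite -natr1 mulrDl mul1r in jh.
  have := IH (ltnW jn); rewrite -natr1 mulrDl mul1r.
  set s := a + j%:R * h.
  have sr : s + h <= r by rewrite /s; lra.
  have s0' : 0 <= s by rewrite /s addr_ge0.
  have hs := var_step path_BV s0' (_ : s <= s + h).
  have {}hs := hs ltac:(by rewrite lerDl).
  have as_ : a <= s by rewrite /s lerDl.
  have := @shift_le a b s (r - h) h
    (sigma ^+ 2) a0 as_ ltac:(lra) h0 ltac:(by rewrite subrK) (sqr_ge0 _) osc.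
  rewrite subrK -/M.
  set W := `|K (s + h) - K s| in hs * => hM.
  suff qW : q <= W.
    by move=> IHj; rewrite addrA; apply: (le_trans (lerD IHj qW)); rewrite -lerBrDl.
  rewrite leNgt; apply/negP => Wq.
  have l1 : L r <= C0 by apply: LC; lra.
  have l2 : L (r - h) <= C0 by apply: LC; lra.
  have q0 : 0 <= q by rewrite /q subr_ge0 ltW.
  have W2 : W ^+ 2 <= q ^+ 2 by rewrite ler_pXn2r ?nnegrE ?normr_ge0 // ltW.
  have e1 : sigma ^+ 2 * (L r + L (r - h)) <= sigma ^+ 2 * (2 * C0).
    by rewrite ler_wpM2l ?sqr_ge0 //; lra.
  have e2 : c * sigma * (c * sigma) < M * (c * sigma) by rewrite ltr_pM2r // mulr_gt0.
  have e3 : sigma ^+ 2 * (4 * C0) <= c * sigma * (c * sigma).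
    have -> : c * sigma * (c * sigma) = sigma ^+ 2 * c ^+ 2 by ring.
    rewrite ler_wpM2l ?sqr_ge0 //.
    have -> : c ^+ 2 = 4 * C0 + (4 * C0 ^+ 2 + 1) by rewrite /c; ring.
    by rewrite lerDl addr_ge0 // mulr_ge0 // exprn_ge0.
  have e4 : q ^+ 2 = M ^+ 2 - 2 * (M * (c * sigma)) + c * sigma * (c * sigma).
    by rewrite /q; ring.
  lra.
have La := var_ge0 path_BV a0.
have nh0 : 0 <= n%:R * h by rewrite mulr_ge0.
have Ln : L (a + n%:R * h) <= C0 by apply: LC; lra.
have := step n (leqnn n); rewrite -/L in La => hn.
have : q <= C0 / n%:R by rewrite ler_pdivlMr // mulrC; lra.
by rewrite /q lerBlDl.
Qed.

(** On a window of length [eps], [xe] moves by at most [M + sigma], so [g], being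
    [1 / eps]-Lipschitz in [xe], is nearly constant there and [eps g] is close to an increment of
    [K]. That increment is at most [M] by [window_small]; the total is [2 M + sigma]. *)
Lemma residual_small a b delta C0 sigma (n : nat) r : 0 <= a -> 0 <= C0 -> 0 < sigma ->
  sigma <= 1 -> (0 < n)%N -> n%:R * eps <= delta ->
  (forall t, 0 <= t <= b -> L t <= C0) ->
  (forall u v, a <= u < b -> a <= v < b -> `|m u - m v| <= sigma ^+ 2) ->
  a + delta <= r -> r < b ->
  eps * `|g r| <= (4 * C0 + 3) * sigma + 2 * (C0 / n%:R).
Proof.
move=> a0 C00 s0 s1 n0 ne LC osc ar rb.
have e0 := eps_gt0.
have nR : (1 : R) <= n%:R by rewrite ler1n.
have ed : eps <= delta by apply: le_trans ne; apply: ler_peMl nR; exact: ltW.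
pose M := (2 * C0 + 1) * sigma + C0 / n%:R.
have M0 : 0 <= M.
  by apply: addr_ge0; [apply: mulr_ge0; lra | apply: divr_ge0; lra].
have win h : 0 <= h -> h <= eps -> `|K r - K (r - h)| <= M.
  move=> h0 he; apply: (@window_small a b delta C0 sigma n r h) => //.
  by apply: le_trans ne; rewrite ler_wpM2l.
have ss : sigma ^+ 2 <= sigma by rewrite expr2 ler_piMl // ltW.
have w0 : 0 <= (M + sigma) / eps by apply: divr_ge0; lra.
have := @path_increment (r - eps) r (g r) ((M + sigma) / eps)
  ltac:(lra) ltac:(lra) w0.
rewrite subKr => hinc.
have {}hinc : `|K r - K (r - eps) - eps *: g r| <= M + sigma.
  move: hinc; rewrite divfK ?gt_eqF //; apply => u ur.
  rewrite ler_pdivlMr // mulrC.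
  apply: (le_trans (yosida_lipschitz dot_norm A_maxmon A_ne e0 _ _)).
  have -> : xe u - xe r = (K r - K u) + (m u - m r).
    by rewrite /K; apply: (dot_ext dot_norm) => z; rewrite !(dotE dot); ring.
  apply: (le_trans (ler_normD _ _)); apply: lerD.
    have -> : K u = K (r - (r - u)) by rewrite subKr.
    by apply: win; lra.
  by apply: le_trans ss; apply: osc; lra.
have hw := win eps (ltW e0) (lexx _).
have -> : eps * `|g r| = `|(K r - K (r - eps)) - (K r - K (r - eps) - eps *: g r)|.
  by rewrite subKr; move: (g r) => y; rewrite normrZ gtr0_norm.
apply: (le_trans (ler_normB _ _)).
apply: (@le_trans _ _ (M + (M + sigma))); first exact: lerD.
by rewrite /M; move: (C0 / n%:R) => z; lra.
Qed.

End yosida_path.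

(** * Squared distance to the closed domain *)

Section distance.
Context {R : realType} {H : completeNormedModType R}.
Variable dot : {dot H for idfun}.
Hypothesis dot_norm : forall u : H, `|u| ^+ 2 = dot u u.
Variable A : H -> set H.
Hypothesis A_maxmon : maximal_monotone dot A.
Hypothesis A_ne : exists a b, A a b.

Let C := closure (Dom A).
Let projC z : projection_spec dot C z (projection C z) :=
  projection_dom dot_norm A_maxmon A_ne z.

(** Its norm is the distance to [C]; twice the vector is a subgradient of the squared distance, as
    [dist_sqr_convex] states. *)
Definition residue z := z - projection C z.

Lemma dist_le z c : C c -> `|residue z| <= `|z - c|.
Proof. exact: projection_spec_nearest. Qed.

Lemma dist_lipschitz u v : `| `|residue u| - `|residue v| | <= `|u - v|.
Proof.
have h p q : `|residue p| <= `|p - q| + `|residue q|.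
  have := @dist_le p _ (projC q).1; have := ler_normD (p - q) (residue q).
  by rewrite /residue addrA subrK; lra.
have h1 := h u v; have h2 := h v u; rewrite (distrC v u) in h2.
by rewrite ler_norml; lra.
Qed.

Lemma dist_sqr_convex y y' :
  `|residue y| ^+ 2 + 2 * dot (residue y) (y' - y) <= `|residue y'| ^+ 2.
Proof.
have h := (projC y).2 _ (projC y').1.
rewrite -/(residue y) in h.
have e : y' - y = residue y' - residue y + (projection C y' - projection C y).
  by rewrite /residue; apply: (dot_ext dot_norm) => z; rewrite !(dotE dot); ring.
rewrite e !dot_norm; move: h; move: (projection C y' - projection C y) (residue y) (residue y').
move=> p n n' h; have := dot_ge0 dot_norm (n' - n).
by rewrite !(dotE dot) (dotC dot n' n) (dotC dot n p) in h *; move: h; rewrite (dotC dot p n); lra.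
Qed.

Lemma dist_le_yosida eps z : 0 < eps -> `|residue z| <= eps * `|yosida A eps z|.
Proof.
move=> e0; have Cj : C (resolvent A eps z).
  by apply: subset_closure; exact: resolvent_dom.
have := dist_le z Cj; rewrite resolventE // subKr.
by move: (yosida A eps z) => y; rewrite normrZ gtr0_norm.
Qed.

(* The increase of [|xe - x|^2 - dist(xe)^2] at a jump, where [x] is replaced
   by the projection of [z] and [xe] by [z + e]. *)
Lemma dist_sqr_jump z e p : projection_spec dot C z p ->
  `|z + e - p| ^+ 2 - `|residue (z + e)| ^+ 2 <= `|e| ^+ 2.
Proof.
move=> [Cp hp]; have [Cq hq] := projC (z + e).
have h1 := hp _ Cq; have h2 := hq _ Cp.
rewrite /residue; move: h1 h2; move: (projection C (z + e)) => q h1 h2.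
have := dot_ge0 dot_norm (z + e - q - (z - p)).
rewrite !dot_norm.
have -> : dot e e = dot (q - p + ((z + e - q) - (z - p))) (q - p + ((z + e - q) - (z - p))).
  by congr (dot _ _); apply: (dot_ext dot_norm) => w; rewrite !(dotE dot); ring.
have -> : z + e - p = (z + e - q) + (q - p) by rewrite addrA subrK.
have E : p - q = - (q - p) by rewrite opprB.
rewrite E in h2; move: h1 h2; move: (z + e - q) (q - p) (z - p) => n' d n h1 h2.
move: h1 h2; rewrite !(dotE dot) (dotC dot d n') (dotC dot d n) (dotC dot n n'); lra.
Qed.

End distance.

Lemma comparison_step {R : realFieldType} (de dd th F dV dL dt eta w w1 g en G eg : R) :
  0 <= th <= 1 -> 0 <= eta -> 0 <= dV -> 0 <= dt -> 0 <= dL -> 0 <= w1 -> 0 <= eg -> 0 <= G ->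
  w1 * (8 + 3 * g + 2 * en + (2 * eta + 2 * (eg + eta))) <= w ->
  dd <= 2 * G * dt + 2 * eta * dL + w1 * (2 * eta + 2 * (eg + eta)) * dt ->
  de <= 2 * F * dV - 2 * G * dt + w1 * (8 + 3 * g + 2 * en) * (dV + dt) ->
  de + th * dd - 2 * F * dV - 2 * eta * dL <= w * (dt + dV).
Proof.
move=> /andP[th0 th1] eta0 dV0 dt0 dL0 w10 eg0 G0 hw hd he.
have Gt : 0 <= G * dt by rewrite mulr_ge0.
have etaL : 0 <= eta * dL by rewrite mulr_ge0.
have q0 : 0 <= w1 * (2 * eta + 2 * (eg + eta)) by rewrite mulr_ge0 //; lra.
have q1 : 0 <= w1 * (2 * eta + 2 * (eg + eta)) * dt by rewrite mulr_ge0.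
have q2 : 0 <= w1 * (2 * eta + 2 * (eg + eta)) * dV by rewrite mulr_ge0.
have hth : th * dd <= 2 * G * dt + 2 * eta * dL + w1 * (2 * eta + 2 * (eg + eta)) * dt.
  apply: (le_trans (ler_wpM2l th0 hd)); rewrite ler_piMl //; lra.
have Vt : 0 <= dV + dt by rewrite addr_ge0.
have := ler_wpM2r Vt hw.
lra.
Qed.

(** * Comparison of [k] with [K] *)

Section comparison.
Context {R : realType} {H : completeNormedModType R}.
Variable dot : {dot H for idfun}.
Hypothesis dot_norm : forall u : H, `|u| ^+ 2 = dot u u.
Variable A : H -> set H.
Hypothesis A_maxmon : maximal_monotone dot A.
Hypothesis A_ne : exists a b, A a b.
Variables (m x k : R -> H).
Hypothesis m_cadlag : cadlag m.
Hypothesis SPxk : SP dot A (projection (closure (Dom A))) m x k.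
Variables (eps : R) (xe : R -> H).
Hypothesis eps_gt0 : 0 < eps.
Hypothesis sol : yosida_solution A eps m xe.

Let K r := m r - xe r.
Let g r := yosida A eps (xe r).
Let L := var K.
Let V := var k.
Let xc : cadlag x. Proof. by case: SPxk => -[]. Qed.
Let kc : cadlag k. Proof. by case: SPxk => -[]. Qed.
Let kbv : BV_loc k. Proof. by case: SPxk => _ _ []. Qed.
Let KBV : BV_loc K := path_BV dot_norm A_maxmon A_ne eps_gt0 sol.
Let Kright s w : 0 <= s -> 0 < w -> exists2 d, 0 < d & forall t, s <= t < s + d ->
  [/\ `|K t - K s - (t - s) *: g s| <= w * (t - s),
      `|K t - K s| <= (`|g s| + w) * (t - s),
      (`|g s| - w) * (t - s) <= L t - L s &
      L t - L s <= (`|g s| + w) * (t - s)].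
Proof. exact: (path_right dot_norm A_maxmon A_ne eps_gt0 sol). Qed.
Let Kleft t : 0 < t -> K u @[u --> t^'-] --> K t.
Proof. exact: (path_cvg_left dot_norm A_maxmon A_ne eps_gt0 sol). Qed.
Let Lleft t : 0 < t -> L u @[u --> t^'-] --> (L t : R).
Proof. exact: (path_var_cvg_left dot_norm A_maxmon A_ne eps_gt0 sol). Qed.

Let e r := k r - K r.
(** With [m] frozen at [c] the squared distance is continuous in [r], unlike that of [xe r]. *)
Let d2 r c := `|residue A (c - K r)| ^+ 2.

Lemma gap_E r : 0 <= r -> e r = xe r - x r.
Proof.
move=> r0; rewrite /e /K (SP_kE SPxk r0).
by apply: (dot_ext dot_norm) => z; rewrite !(dotE dot); ring.
Qed.

Lemma gap_increment s t w : 0 <= s -> s <= t -> 0 <= w ->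
  (forall r, s < r <= t -> `|x r - x s| <= w) ->
  `|K t - K s - (t - s) *: g s| <= w * (t - s) ->
  `|e t - e s| <= w ->
  `|e t| ^+ 2 - `|e s| ^+ 2 <=
    2 * (eps * `|g s|) * (V t - V s) - 2 * eps * `|g s| ^+ 2 * (t - s)
    + w * (7 + 3 * `|g s| + 2 * `|e s| + w) * (V t - V s + (t - s)).
Proof.
move=> s0 st w0 xw Kw ew.
have dt0 : 0 <= t - s by rewrite subr_ge0.
have V0 : 0 <= V t - V s by rewrite subr_ge0 var_nd.
have e0 := eps_gt0.
pose al := resolvent A eps (xe s).
have Aal : A al (g s) by exact: yosida_mem.
have alE : al = xe s - eps *: g s by rewrite /al resolventE.
have sp := SP_increment dot_norm A_maxmon A_ne m_cadlag SPxk s0 st w0 Aal xw.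
rewrite -/V in sp.
have kV : `|k t - k s| <= V t - V s by exact: var_step.
have es := gap_E s0.
have i1 : dot (e s) (k t - k s) <= eps * `|g s| * (V t - V s) +
    ((t - s) * dot (al - x s) (g s) + w * (3 * (V t - V s) + `|g s| * (t - s))).
  have -> : e s = eps *: g s + (al - x s).
    rewrite es alE; move: (g s) => y.
    by apply: (dot_ext dot_norm) => z; rewrite !(dotE dot); ring.
  rewrite (dotDl dot); apply: lerD sp.
  apply: (le_trans (dot_le_norm dot_norm _ _)).
  move: (g s) => y; rewrite normrZ gtr0_norm //.
  by rewrite ler_wpM2l // mulr_ge0 // ltW.
have i2 : - dot (e s) (K t - K s) <= - ((t - s) * dot (e s) (g s)) + `|e s| * (w * (t - s)).
  have h := dot_ge_norm dot_norm (e s) (K t - K s - (t - s) *: g s).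
  have h2 := ler_wpM2l (normr_ge0 (e s)) Kw.
  by move: h; rewrite (dotDr dot) (dotNr dot) (dotZr dot); lra.
have i3 : dot (al - x s) (g s) - dot (e s) (g s) = - (eps * `|g s| ^+ 2).
  rewrite es alE; move: (g s) => y.
  rewrite -(dotNl dot) -(dotDl dot) dot_norm -(dotZl dot) -(dotNl dot); congr (dot _ _).
  by apply: (dot_ext dot_norm) => z; rewrite !(dotE dot); ring.
have i4 : `|e t - e s| ^+ 2 <= w * ((V t - V s) + (`|g s| + w) * (t - s)).
  rewrite expr2; apply: ler_pM => //.
  have -> : e t - e s = (k t - k s) - (K t - K s) by rewrite /e subr_interchange.
  apply: (le_trans (ler_normB _ _)); apply: lerD => //.
  have := ler_normD (K t - K s - (t - s) *: g s) ((t - s) *: g s); rewrite subrK.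
  by move: Kw; move: (g s) => y; rewrite normrZ ger0_norm //; lra.
have -> : `|e t| ^+ 2 - `|e s| ^+ 2 = 2 * dot (e s) (k t - k s)
   + 2 * - dot (e s) (K t - K s) + `|e t - e s| ^+ 2.
  rewrite !dot_norm.
  have ts : e t = e s + (e t - e s) by rewrite addrC subrK.
  have ee : dot (e s) (k t - k s) + - dot (e s) (K t - K s) = dot (e s) (e t - e s).
    rewrite -(dotNr dot) -(dotDr dot); congr (dot _ _).
    by rewrite /e; apply: (dot_ext dot_norm) => z; rewrite !(dotE dot); ring.
  rewrite -mulrDr ee {1 2}ts; move: (e s) (e t - e s) => p q.
  by rewrite !(dotE dot) (dotC dot q p); ring.
have i5 : (t - s) * (dot (al - x s) (g s) - dot (e s) (g s)) = (t - s) * - (eps * `|g s| ^+ 2).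
  by rewrite i3.
have gV : 0 <= w * (`|g s| * (V t - V s)) by rewrite !mulr_ge0.
have eV : 0 <= w * (`|e s| * (V t - V s)) by rewrite !mulr_ge0.
have wV : 0 <= w * (w * (V t - V s)) by rewrite !mulr_ge0.
have w1V : 0 <= w * (V t - V s) by rewrite !mulr_ge0.
have w1t : 0 <= w * (t - s) by rewrite !mulr_ge0.
lra.
Qed.

(** The decomposition [e t = eps g + (al - x t)] again: the jump is normal at [x t], so only [eps g]
    contributes. *)
Lemma gap_jump t F : 0 <= t -> eps * `|g t| <= F ->
  `|e t| ^+ 2 <= `|left_lim k t - K t| ^+ 2 + 2 * F * `|jump_at k t|.
Proof.
move=> t0 gF.
pose al := resolvent A eps (xe t).
have alE : al = xe t - eps *: g t by rewrite /al resolventE.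
have Cal : closure (Dom A) al by apply: subset_closure; exact: resolvent_dom.
have nn := SP_jump_normal dot_norm A_maxmon A_ne m_cadlag SPxk t0 Cal.
have eE : left_lim k t - K t = e t - jump_at k t.
  by rewrite /e /jump_at; apply: (dot_ext dot_norm) => z; rewrite !(dotE dot); ring.
rewrite eE.
have i1 : dot (e t) (jump_at k t) <= F * `|jump_at k t|.
  have -> : e t = eps *: g t + (al - x t).
    rewrite gap_E // alE; move: (g t) => y.
    by apply: (dot_ext dot_norm) => z; rewrite !(dotE dot); ring.
  rewrite (dotDl dot); have := dot_le_norm dot_norm (eps *: g t) (jump_at k t).
  have -> : `|eps *: g t| = eps * `|g t|.
    by move: (g t) => y; rewrite normrZ gtr0_norm.
  have := ler_wpM2r (normr_ge0 (jump_at k t)) gF.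
  lra.
move: i1; move: (e t) (jump_at k t) => p q i1.
have := dot_ge0 dot_norm q.
by rewrite !dot_norm !(dotE dot) (dotC dot q p); lra.
Qed.

Lemma gap_increment_bound s t w F : 0 <= s -> s <= t -> 0 <= w -> w <= 1 ->
  eps * `|g s| <= F ->
  (forall r, s < r <= t -> `|x r - x s| <= w) ->
  `|K t - K s - (t - s) *: g s| <= w * (t - s) ->
  `|e t - e s| <= w ->
  `|e t| ^+ 2 - `|e s| ^+ 2 <=
    2 * F * (V t - V s) - 2 * eps * `|g s| ^+ 2 * (t - s)
    + w * (8 + 3 * `|g s| + 2 * `|e s|) * (V t - V s + (t - s)).
Proof.
move=> s0 st w0 w1 gF xw Kw ew.
apply: (le_trans (gap_increment s0 st w0 xw Kw ew)).
have dt0 : 0 <= t - s by rewrite subr_ge0.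
have V0 : 0 <= V t - V s by rewrite subr_ge0 var_nd.
apply: lerD.
  by rewrite lerD2r; apply: ler_wpM2r => //; rewrite ler_wpM2l.
apply: ler_wpM2r; first exact: addr_ge0.
by apply: ler_wpM2l => //; lra.
Qed.

(** The point [c - K s] is within [eta] of [xe s], whose distance to the domain is at most
    [eps |g|]. So the squared distance decreases at rate at most [2 (eps |g| + eta) |g|], whose main
    part equals the dissipation in [gap_increment]. *)
Lemma dist_increment s t c w eta : 0 <= s -> s <= t -> 0 <= w -> `|m s - c| <= eta ->
  `|K t - K s - (t - s) *: g s| <= w * (t - s) ->
  (`|g s| - w) * (t - s) <= L t - L s ->
  d2 s c - d2 t c <= 2 * eps * `|g s| ^+ 2 * (t - s) + 2 * eta * (L t - L s)
     + w * (2 * eta + 2 * (eps * `|g s| + eta)) * (t - s).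
Proof.
move=> s0 st w0 mc Kw Lw.
have eta0 : 0 <= eta by apply: le_trans mc.
have dt0 : 0 <= t - s by rewrite subr_ge0.
set n := residue A (c - K s).
have nle : `|n| <= eps * `|g s| + eta.
  have h1 := dist_lipschitz dot_norm A_maxmon A_ne (c - K s) (xe s).
  have h2 := dist_le_yosida dot_norm A_maxmon A_ne (xe s) eps_gt0.
  have E : c - K s - xe s = - (m s - c).
    by rewrite /K; apply: (dot_ext dot_norm) => z; rewrite !(dotE dot); ring.
  rewrite E normrN -/n -/(g s) in h1 h2.
  by move: h1; rewrite ler_norml; lra.
have cv := dist_sqr_convex dot_norm A_maxmon A_ne (c - K s) (c - K t).
have E : c - K t - (c - K s) = - (K t - K s).
  by apply: (dot_ext dot_norm) => z; rewrite !(dotE dot); ring.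
rewrite E (dotNr dot) -/n in cv.
have i1 : dot n (K t - K s) <= (t - s) * (eps * `|g s| ^+ 2 + eta * `|g s|)
   + (eps * `|g s| + eta) * (w * (t - s)).
  have -> : K t - K s = (t - s) *: g s + (K t - K s - (t - s) *: g s).
    by rewrite [RHS]addrC subrK.
  rewrite (dotDr dot) (dotZr dot); apply: lerD.
    apply: ler_wpM2l => //; apply: (le_trans (dot_le_norm dot_norm _ _)).
    by have := ler_wpM2r (normr_ge0 (g s)) nle; rewrite expr2; lra.
  apply: (le_trans (dot_le_norm dot_norm _ _)).
  by apply: ler_pM.
have i2 := ler_wpM2l eta0 Lw.
rewrite /d2 -/n.
lra.
Qed.

Lemma gap_right s w : 0 <= s -> 0 < w -> w <= 1 -> exists2 d, 0 < d &
  forall t, s < t < s + d ->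
  [/\ forall r, s < r <= t -> `|x r - x s| <= w,
      `|K t - K s - (t - s) *: g s| <= w * (t - s),
      (`|g s| - w) * (t - s) <= L t - L s & `|e t - e s| <= w].
Proof.
move=> s0 w0 w1; have w20 : 0 < w / 2 by lra.
have [d1 d10 hd1] := Kright s0 w0.
have [d2' d20 hd2] := cadlag_right_cont xc s0 w0.
have [d3 d30 hd3] := cadlag_right_cont kc s0 w20.
have [d4 d40 [d41 d42]] := exists_small d10 d20.
have [d5 d50 [d51 d52]] := exists_small d30 d40.
have g1 : 0 < `|g s| + 1 by rewrite ltr_wpDl.
(* Since [w <= 1], [K] moves by at most [(|g s| + 1) (t - s)], hence by at most [w / 2] over this
   length. *)
have d60 : 0 < w / 2 / (`|g s| + 1) by rewrite !divr_gt0.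
have [d d0 [dd1 dd2]] := exists_small d50 d60.
exists d => // t st; have [h1 h2 h3 _] := hd1 t ltac:(lra); split => //.
  by move=> r rst; apply: hd2; lra.
have -> : e t - e s = (k t - k s) - (K t - K s) by rewrite /e subr_interchange.
apply: (le_trans (ler_normB _ _)).
have -> : w = w / 2 + w / 2 by lra.
apply: lerD; first by apply: hd3; lra.
apply: (le_trans h2); rewrite mulrC -ler_pdivlMr; last by rewrite ltr_wpDl.
apply: (@le_trans _ _ d); first lra.
apply: (le_trans dd2); apply: ler_wpM2l; first exact: ltW.
by rewrite lef_pV2 ?posrE ?ltr_wpDl // lerD2l.
Qed.

(** [th = 1] serves the initial layer, where the dissipation is spent on the distance, and [th = 0]
    the remaining time. *)
Lemma comparison a b c F eta th : 0 <= a -> a <= b -> 0 <= F -> 0 <= eta -> 0 <= th <= 1 ->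
  (forall r, a <= r <= b -> eps * `|g r| <= F) ->
  (forall r, a <= r <= b -> `|m r - c| <= eta) ->
  `|e b| ^+ 2 - th * d2 b c <= `|e a| ^+ 2 - th * d2 a c + 2 * F * (V b - V a)
    + 2 * eta * (L b - L a).
Proof.
move=> a0 ab F0 eta0 th01 gF osc; have eps0 := eps_gt0.
pose Phi t := `|e t| ^+ 2 - th * d2 t c - 2 * F * V t - 2 * eta * L t.
suff : Phi b <= Phi a by rewrite /Phi; lra.
apply: (@nonincreasing_of_right_approx _ Phi V) => //.
- by move=> s t as_ st _; apply: var_nd => //; lra.
- move=> w s w0 sab; have s0 : 0 <= s by lra.
  have sab' : a <= s <= b by lra.
  pose q := 8 + 3 * `|g s| + 2 * `|e s| + (2 * eta + 2 * (eps * `|g s| + eta)).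
  have q0 : 0 < q.
    by rewrite /q ltr_wpDr ?ltr_wpDr ?addr_ge0 ?mulr_ge0 ?addr_ge0 ?mulr_ge0 // ltW.
  have wq0 : 0 < w / q by rewrite divr_gt0.
  have [w1 w10 [w11 w1q]] := exists_small (@ltr01 R) wq0.
  rewrite ler_pdivlMr // in w1q.
  have [d d0 hd] := gap_right s0 w10 w11.
  exists d => // t st tb; have [xw Kw Lw ew] := hd t st.
  have st' : s <= t by case/andP: st => /ltW.
  have := gap_increment_bound s0 st' (ltW w10) w11 (gF s sab') xw Kw ew.
  have := dist_increment s0 st' (ltW w10) (osc s sab') Kw Lw.
  have -> : Phi t = Phi s + ((`|e t| ^+ 2 - `|e s| ^+ 2) + th * (d2 s c - d2 t c)
     - 2 * F * (V t - V s) - 2 * eta * (L t - L s)) by rewrite /Phi; ring.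
  move=> di gi; rewrite lerD2l.
  apply: (comparison_step (w1 := w1) (g := `|g s|) (en := `|e s|) (G := eps * `|g s| ^+ 2)
    (eg := eps * `|g s|) th01 eta0) => //.
  + by rewrite subr_ge0 var_nd.
  + by rewrite subr_ge0.
  + by rewrite subr_ge0; apply: var_nd.
  + exact: ltW.
  + by rewrite mulr_ge0 // ltW.
  + by rewrite mulr_ge0 ?exprn_ge0 // ltW.
  + by rewrite (mulrA 2).
  + by rewrite (mulrA 2).
- move=> t c0 tab Pu.
  have t0 : 0 < t by lra.
  have kl := cadlag_has_left_lim kc t0.
  have gj := gap_jump (ltW t0) (gF t ltac:(lra)).
  (* The left limit of [V] is avoided: [V u] is at most [V t - |k t - k u|], whose limit leaves
     exactly the [|jump_at k t|] that [gap_jump] costs. *)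
  pose psi u := `|k u - K u| ^+ 2 - th * d2 u c - 2 * F * (V t - `|k t - k u|) - 2 * eta * L u.
  have : `|left_lim k t - K t| ^+ 2 - th * d2 t c - 2 * F * (V t - `|k t - left_lim k t|)
      - 2 * eta * L t <= c0.
    apply: (left_limit_le (a := a) (f := psi) (t := t)); first lra; last first.
      move=> u uat; apply: le_trans (Pu u uat); rewrite /psi /Phi -/(e u) lerD2r lerD2l lerN2.
      apply: ler_wpM2l; first by rewrite mulr_ge0.
      by have := var_step kbv (x := u) (y := t) ltac:(lra) ltac:(lra); rewrite -/V; lra.
    have kcv := cvg_left_of kl.
    apply: cvgB; last by apply: cvgMr; apply: Lleft.
    apply: cvgB; last first.
      apply: cvgMr; apply: cvgB; first exact: cvg_cst.
      by apply: cvg_norm; apply: cvgB; [exact: cvg_cst | exact: kcv].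
    apply: cvgB; first by apply: cvg_sqr_norm; apply: cvgB; [exact: kcv | exact: Kleft].
    apply: cvgMr; rewrite /d2.
    have dc : `|residue A (c - K u)| @[u --> t^'-] --> `|residue A (c - K t)|.
      apply/cvgrPdist_le => w w0.
      have /cvgrPdist_le /(_ w w0) := Kleft t0.
      apply: filterS => u hu; apply: le_trans (dist_lipschitz dot_norm A_maxmon A_ne _ _) _.
      have -> // : c - K t - (c - K u) = - (K t - K u).
        by apply: (dot_ext dot_norm) => z; rewrite !(dotE dot); ring.
      by rewrite normrN.
    by under eq_fun do rewrite expr2; rewrite expr2; apply: cvgM.
  rewrite -/(jump_at k t) /Phi.
  lra.
Qed.

End comparison.

(** * Uniform bounds and passage to the limit *)

Section convergence.
Context {R : realType} {H : completeNormedModType R}.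
Variable dot : {dot H for idfun}.
Hypothesis dot_norm : forall u : H, `|u| ^+ 2 = dot u u.
Variable A : H -> set H.
Hypothesis A_maxmon : maximal_monotone dot A.
Hypothesis A_int : (Dom A)^° !=set0.
Variables (m x k : R -> H) (xe : R -> R -> H).
Hypothesis m_cadlag : cadlag m.
Hypothesis xe_sol : forall eps : R, 0 < eps -> yosida_solution A eps m (xe eps).
Hypothesis SPxk : SP dot A (projection (closure (Dom A))) m x k.

Let K eps r := m r - xe eps r.
Let L eps := var (K eps).
Let V := var k.
Let xc : cadlag x. Proof. by case: SPxk => -[]. Qed.
Let kc : cadlag k. Proof. by case: SPxk => -[]. Qed.
Let kbv : BV_loc k. Proof. by case: SPxk => _ _ []. Qed.
Let A_ne : exists a b, A a b.
Proof.
have [z /interior_subset [y Azy]] := A_int.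
by exists z, y.
Qed.

(** The left limit of [k] against the continuous [K]: in this form local estimates start and end
    with the same quantity and can be chained across jumps. *)
Let E eps t := `|left_lim k t - K eps t| ^+ 2.

Lemma right_osc s w : 0 <= s -> 0 < w -> exists2 d, 0 < d &
  forall u v, s <= u < s + d -> s <= v < s + d -> `|m u - m v| <= w.
Proof.
move=> s0 w0; have w2 : 0 < w / 2 by lra.
have [d d0 hd] := cadlag_right_cont m_cadlag s0 w2; exists d => // u v us vs.
have := hd u us; have := hd v vs; have := ler_normB (m u - m s) (m v - m s).
by rewrite opprB addrA subrK; lra.
Qed.

Lemma left_osc t w : 0 < t -> 0 < w -> exists2 d, 0 < d &
  forall u v, t - d < u < t -> t - d < v < t -> `|m u - m v| <= w.
Proof.
move=> t0 w0; have w2 : 0 < w / 2 by lra.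
have [d d0 hd] := cadlag_has_left_lim m_cadlag t0 w2; exists d => // u v us vs.
have := hd u us; have := hd v vs.
have := ler_normB (m u - left_lim m t) (m v - left_lim m t).
by rewrite opprB addrA subrK; lra.
Qed.

Lemma uniform_var_bound T : 0 < T ->
  exists C0, forall eps, 0 < eps -> eps <= 1 -> L eps T <= C0.
Proof.
move=> T0.
have [a1 [b1 [r1 [mu [Aab r10 mu0 hint]]]]] := interior_bound dot_norm A_maxmon A_int.
pose c := growth_rate b1 r1 mu.
have c0 : 0 < c by rewrite ltr_wpDl // !mulr_ge0 // !addr_ge0 // ltW.
(* Uniform bounds at [s] are transported to [t]; quantifying over [R0] makes the relation
   transitive. The initial value needed by [var_growth] is bounded through [|K| <= L]. *)
pose P s t := forall R0, exists C, forall eps, 0 < eps -> eps <= 1 ->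
  L eps s <= R0 -> L eps t <= C.
have r14 : 0 < r1 / 4 by lra.
have ic : 0 < 2^-1 / c by rewrite divr_gt0 // invr_gt0.
have local s t : 0 <= s -> s <= t -> t - s <= 2^-1 / c ->
    (forall r, s <= r < t -> `|m r - m s| <= r1 / 4) -> P s t.
  move=> s0 st tsc osc R0.
  exists (R0 + 2 / r1 * (1 + (`|m s - a1| + R0) ^+ 2)) => eps e0 e1 LR.
  have := var_growth dot_norm A_maxmon A_ne e0 (xe_sol e0) Aab r10 mu0 hint e1 s0 st _ osc.
  rewrite -/(K eps) -/(L eps) -/c => h.
  have {}h := h ltac:(by rewrite mulrC -ler_pdivlMr).
  have h2 := path_norm_le dot_norm A_maxmon A_ne e0 (xe_sol e0) s0.
  rewrite -/(K eps s) -/(L eps s) in h2.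
  have h3 : `|m s - K eps s - a1| <= `|m s - a1| + R0.
    rewrite addrAC; apply: (le_trans (ler_normB _ _)); lra.
  have h4 : `|m s - K eps s - a1| ^+ 2 <= (`|m s - a1| + R0) ^+ 2.
    by rewrite ler_pXn2r ?nnegrE //; apply: le_trans h3.
  have h5 : 2 / r1 * (1 + `|m s - K eps s - a1| ^+ 2) <=
      2 / r1 * (1 + (`|m s - a1| + R0) ^+ 2).
    by apply: ler_wpM2l; [rewrite divr_ge0 // ltW | rewrite lerD2l].
  by move: (h) LR h5; move: (2 / r1 * _) (2 / r1 * _) => p q; lra.
have PT : P 0 T.
  apply: (@interval_chain _ P) => //.
  - move=> s u t _ _ _ _ P1 P2 R0; have [C1 h1] := P1 R0; have [C2 h2] := P2 C1.
    by exists C2 => eps e0 e1 /(h1 _ e0 e1) /(h2 _ e0 e1).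
  - move=> s s0T; have s0 : 0 <= s by lra.
    have [d d0 hd] := right_osc s0 r14.
    have [d' d0' [dd1 dd2]] := exists_small d0 ic.
    exists d' => // t st tT; apply: local; [lra|lra|lra|].
    by move=> r rst; apply: hd; lra.
  - move=> t t0T; have t0 : 0 < t by lra.
    have [d d0 hd] := left_osc t0 r14.
    have [d' d0' [dd1 dd2]] := exists_small d0 ic.
    exists d' => // s st s0; apply: local; [lra|lra|lra|].
    by move=> r rst; apply: hd; lra.
have [C hC] := PT 0.
by exists C => eps e0 e1; apply: hC => //; rewrite /L var0.
Qed.

(** For use in the initial layers, where no smallness of the residual is available. *)
Lemma uniform_residual_bound T : 0 < T ->
  exists2 F, 0 <= F & forall eps r, 0 < eps -> eps <= 1 -> 0 <= r <= T ->
    eps * `|yosida A eps (xe eps r)| <= F.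
Proof.
move=> T0.
have [a1 [b1 Aab]] := A_ne.
have [C0 hC] := uniform_var_bound T0.
have [B B0 hB] := cadlag_bounded m_cadlag (ltW T0).
have C0' : 0 <= C0.
  apply: le_trans (hC 1 ltr01 (lexx _)); apply: var_ge0; last exact: ltW.
  exact: (path_BV dot_norm A_maxmon A_ne ltr01 (xe_sol ltr01)).
exists (2 * (B + C0 + `|a1|) + `|b1|).
  by rewrite addr_ge0 // mulr_ge0 // !addr_ge0.
move=> eps r e0 e1 rT.
have h := yosida_size dot_norm A_maxmon A_ne e0 Aab e1 (xe eps r).
have r0 : 0 <= r by lra.
have h2 := path_norm_le dot_norm A_maxmon A_ne e0 (xe_sol e0) r0.
have h3 : L eps r <= L eps T.
  apply: var_nd; [|lra|lra].
  exact: (path_BV dot_norm A_maxmon A_ne e0 (xe_sol e0)).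
rewrite -/(K eps) -/(L eps) in h2.
have h4 := hC eps e0 e1; have h5 := hB r rT.
have h6 : `|xe eps r - a1| <= `|m r| + `|K eps r| + `|a1|.
  have -> : xe eps r - a1 = m r - K eps r - a1 by rewrite /K subKr.
  apply: (le_trans (ler_normB _ _)); rewrite lerD2r; exact: ler_normB.
lra.
Qed.

Lemma gap_at_jump eps a : 0 < eps -> 0 <= a ->
  `|k a - K eps a| ^+ 2 - `|residue A (m a - K eps a)| ^+ 2 <= E eps a.
Proof.
move=> e0 a0.
have := dist_sqr_jump dot_norm A_maxmon A_ne (left_lim k a - K eps a)
  (SP_projection dot_norm A_maxmon A_ne m_cadlag SPxk a0).
have -> : m a - left_lim k a + (left_lim k a - K eps a) = m a - K eps a.
  by rewrite addrA subrK.
have -> // : m a - K eps a - x a = k a - K eps a.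
by rewrite (SP_kE SPxk a0) addrAC.
Qed.

Let e eps r := k r - K eps r.

(** [comparison] with [th = 1]. At [a] the distance term turns [|e|^2] into [E] by [gap_at_jump]; at
    [c] the distance is at most [2 w], half from the residual and half from the oscillation of
    [m]. *)
Lemma layer_step C0 F w eps a c : 0 < eps -> 0 <= w -> w <= 1 -> 0 <= C0 -> 0 <= F ->
  0 <= a -> a <= c -> L eps c <= C0 -> V c - V a <= w ->
  (forall r, a <= r <= c -> eps * `|yosida A eps (xe eps r)| <= F) ->
  eps * `|yosida A eps (xe eps c)| <= w ->
  (forall r, a <= r <= c -> `|m r - m a| <= w) ->
  `|e eps c| ^+ 2 <= E eps a + w * (2 * F + 2 * C0 + 4).
Proof.
move=> eps0 w0 w1 C00 F0 a0 ac LC Vw gF gc osc.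
have KBV : BV_loc (K eps) := path_BV dot_norm A_maxmon A_ne eps0 (xe_sol eps0).
have La0 : 0 <= L eps a := var_ge0 KBV a0.
have th : 0 <= (1 : R) <= 1 by rewrite lexx ler01.
have cmp : `|e eps c| ^+ 2 - 1 * `|residue A (m a - K eps c)| ^+ 2 <=
    `|e eps a| ^+ 2 - 1 * `|residue A (m a - K eps a)| ^+ 2 + 2 * F * (V c - V a)
    + 2 * w * (L eps c - L eps a).
  exact: (comparison dot_norm A_maxmon A_ne m_cadlag SPxk eps0 (xe_sol eps0) a0 ac F0 w0 th gF osc).
have gj := gap_at_jump eps0 a0.
rewrite -/(e eps a) in gj.
have dc : `|residue A (m a - K eps c)| ^+ 2 <= 4 * w.
  have h1 := dist_lipschitz dot_norm A_maxmon A_ne (m a - K eps c) (xe eps c).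
  have h2 := dist_le_yosida dot_norm A_maxmon A_ne (xe eps c) eps0.
  have Eq : m a - K eps c - xe eps c = - (m c - m a).
    by rewrite /K; apply: (dot_ext dot_norm) => z; rewrite !(dotE dot); ring.
  rewrite Eq normrN in h1.
  have h3 : `|m c - m a| <= w by apply: osc; rewrite ac lexx.
  have h5 : `|residue A (m a - K eps c)| <= 2 * w.
    by move: h1; rewrite ler_norml => /andP[_ h1]; lra.
  have : `|residue A (m a - K eps c)| ^+ 2 <= (2 * w) ^+ 2.
    by rewrite ler_pXn2r ?nnegrE // mulr_ge0.
  have : w ^+ 2 <= w by rewrite expr2 ler_piMl.
  rewrite exprMn; lra.
have FV : F * (V c - V a) <= F * w by apply: ler_wpM2l.
have wL : w * (L eps c - L eps a) <= w * C0 by apply: ler_wpM2l => //; lra.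
lra.
Qed.

(** [comparison] with [th = 0] up to [t < b], followed by the limit at [b] from the left, so that
    jumps at [b] do not enter the estimate of [e]. *)
Lemma bulk_step F eta eps c b : 0 < eps -> 0 <= F -> 0 <= eta -> 0 <= c -> c < b ->
  (forall r, c <= r < b -> eps * `|yosida A eps (xe eps r)| <= F) ->
  (forall r, c <= r < b -> `|m r - m c| <= eta) ->
  E eps b <= `|e eps c| ^+ 2 + 2 * F * (V b - V c) + 2 * eta * (L eps b - L eps c).
Proof.
move=> eps0 F0 eta0 c0 cb gF osc.
have KBV : BV_loc (K eps) := path_BV dot_norm A_maxmon A_ne eps0 (xe_sol eps0).
have b0 : 0 < b := le_lt_trans c0 cb.
have kb := cvg_left_of (cadlag_has_left_lim kc b0).
have Kb : K eps u @[u --> b^'-] --> K eps b.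
  exact: (path_cvg_left dot_norm A_maxmon A_ne eps0 (xe_sol eps0) b0).
apply: (left_limit_le (a := c) (f := fun t => `|e eps t| ^+ 2) (t := b)) => //.
  exact: cvg_sqr_norm (cvgB kb Kb).
move=> t /andP[ct tb].
have th : 0 <= (0 : R) <= 1 by rewrite lexx ler01.
have gF' r : c <= r <= t -> eps * `|yosida A eps (xe eps r)| <= F.
  by move=> /andP[cr rt]; apply: gF; rewrite cr (le_lt_trans rt tb).
have osc' r : c <= r <= t -> `|m r - m c| <= eta.
  by move=> /andP[cr rt]; apply: osc; rewrite cr (le_lt_trans rt tb).
have := comparison dot_norm A_maxmon A_ne m_cadlag SPxk eps0 (xe_sol eps0) c0 ct F0 eta0 th
  gF' osc'.
rewrite !mul0r !subr0 => h; apply: (le_trans h).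
have t0 := le_trans c0 ct.
apply: lerD; last by apply: ler_wpM2l; [rewrite mulr_ge0 | rewrite lerD2r var_nd // ltW].
rewrite lerD2l; apply: ler_wpM2l; first by rewrite mulr_ge0.
by rewrite lerD2r var_nd // ltW.
Qed.

(** The errors after the layer are charged to increments of [V] and [L], so that they add up over
    adjacent intervals; those of the layer go into the free [kap]. *)
Lemma local_step C0 F sigma a b : 0 <= C0 -> 0 <= F -> 0 < sigma -> sigma <= 1 ->
  0 <= a -> a < b ->
  (forall eps r, 0 < eps -> eps <= 1 -> 0 <= r <= b -> L eps r <= C0) ->
  (forall eps r, 0 < eps -> eps <= 1 -> 0 <= r <= b ->
    eps * `|yosida A eps (xe eps r)| <= F) ->
  (forall u v, a <= u < b -> a <= v < b -> `|m u - m v| <= sigma ^+ 2) ->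
  forall kap, 0 < kap -> exists2 e0, 0 < e0 & forall eps, 0 < eps -> eps <= e0 ->
    E eps b <= E eps a + 2 * ((4 * C0 + 5) * sigma) * (V b - V a) +
      2 * sigma ^+ 2 * (L eps b - L eps a) + kap.
Proof.
move=> C00 F0 s0 s1 a0 ab LC gF osc kap kap0.
pose q := 2 * F + 2 * C0 + 4.
have q0 : 0 < q by rewrite /q; lra.
have [w w0 [w1 wq]] := @exists_small R 1 (kap / q) ltac:(lra) ltac:(by rewrite divr_gt0).
have wq' : w * q <= kap by rewrite -ler_pdivlMr.
have [d1 d10 hd1] := cadlag_right_cont m_cadlag a0 w0.
have [d2 d20 hd2] := var_right_cont kbv (cadlag_right_cont kc a0) a0 w0.
have [d3 d30 [d31 d32]] := exists_small d10 d20.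
have ba0 : 0 < b - a by lra.
have [d4 d40 [d41 d42]] := exists_small d30 ba0.
(* The first third lets the residual decay, the second contains the end [c] of the layer, and the
   third keeps [c] before [b] and within the range where [m] and [V] vary by at most [w]. *)
pose del := d4 / 3.
have del0 : 0 < del by rewrite /del; lra.
have del1 : 3 * del <= d4 by rewrite /del; lra.
(* With [C0 / n <= sigma], the bound of [residual_small] becomes [(4 * C0 + 5) * sigma]. *)
pose n := (Num.truncn (C0 / sigma)).+1.
have nR : (0 : R) < n%:R by rewrite ltr0n.
have C0n : C0 / n%:R <= sigma.
  rewrite ler_pdivrMr // mulrC -ler_pdivrMr //; apply: ltW; exact: truncnS_gt.
have i1 : 0 < del / n%:R by rewrite divr_gt0.
have i2 : 0 < w / ((C0 + 1) / del) by rewrite !divr_gt0 //; lra.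
have [e1 e10 [e11 e12]] := exists_small i1 i2.
have [e0 e00 [e01 e02]] := exists_small (@ltr01 R) e10.
exists e0 => // eps eps0 epse.
have eps1 : eps <= 1 by lra.
have epsn : n%:R * eps <= del.
  rewrite mulrC -ler_pdivlMr //; apply: le_trans epse _; exact: le_trans e02 e11.
have epsw : eps * ((C0 + 1) / del) <= w.
  rewrite -ler_pdivlMr ?divr_gt0 //; last lra.
  by apply: le_trans epse _; exact: le_trans e02 e12.
have KBV : BV_loc (K eps) := path_BV dot_norm A_maxmon A_ne eps0 (xe_sol eps0).
have ad0 : 0 <= a + del by rewrite addr_ge0 // ltW.
have a2b : a + del + del < b by lra.
(* At [c] a bound by a multiple of [sigma] would not suffice, as [kap] is arbitrary. The rate at [c]
   is bounded independently of [eps], so [eps |g c| <= w] for small [eps]. *)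
have [c ca gc] : exists2 c, a + del <= c < a + del + del &
    `|yosida A eps (xe eps c)| <= (C0 + 1) / del.
  apply: (exists_small_rate dot_norm A_maxmon A_ne eps0 (xe_sol eps0)) => //.
  by apply: LC => //; rewrite (ltW a2b) andbT addr_ge0 // ltW.
have ac : a <= c by lra.
have c0 := le_trans a0 ac.
have cb : c < b by lra.
have cd : c < a + d3 by lra.
have layer : `|e eps c| ^+ 2 <= E eps a + w * q.
  apply: layer_step => //; [exact: ltW | | | | |].
  - by apply: LC => //; rewrite c0 ltW.
  - by have := hd2 c; rewrite -/V lerBlDl; apply; rewrite ac (lt_le_trans cd) // lerD2l.
  - move=> r /andP[ar rc]; apply: gF => //.
    by rewrite (le_trans a0 ar) (le_trans rc (ltW cb)).
  - by apply: le_trans epsw; rewrite ler_pM2l.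
  - move=> r /andP[ar rc]; apply: hd1; rewrite ar (le_lt_trans rc) //.
    by rewrite (lt_le_trans cd) // lerD2l.
pose F1 := (4 * C0 + 5) * sigma.
have F10 : 0 <= F1 by rewrite mulr_ge0 ?addr_ge0 ?mulr_ge0 // ltW.
have gs r : c <= r < b -> eps * `|yosida A eps (xe eps r)| <= F1.
  move=> /andP[cr rb].
  have adr : a + del <= r by case/andP: ca => adc _; exact: le_trans adc cr.
  have := residual_small dot_norm A_maxmon A_ne eps0 (xe_sol eps0) a0 C00 s0 s1 (ltn0Sn _) epsn
    (fun t ht => LC eps t eps0 eps1 ht) osc adr rb.
  move=> h; apply: (le_trans h).
  have -> : F1 = (4 * C0 + 3) * sigma + 2 * sigma by rewrite /F1; ring.
  by rewrite lerD2l ler_wpM2l.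
have osc' r : c <= r < b -> `|m r - m c| <= sigma ^+ 2.
  move=> /andP[cr rb]; apply: osc; last by rewrite ac.
  by rewrite (le_trans ac cr).
have bulk := bulk_step eps0 F10 (sqr_ge0 sigma) c0 cb gs osc'.
have VV : 2 * F1 * (V b - V c) <= 2 * F1 * (V b - V a).
  by apply: ler_wpM2l; [rewrite mulr_ge0 | rewrite lerD2l lerN2 var_nd].
have LL : 2 * sigma ^+ 2 * (L eps b - L eps c) <= 2 * sigma ^+ 2 * (L eps b - L eps a).
  by apply: ler_wpM2l; [rewrite mulr_ge0 ?sqr_ge0 | rewrite lerD2l lerN2 var_nd].
rewrite -/F1; apply: (le_trans bulk).
have h := le_trans layer (lerD (lexx (E eps a)) wq').
apply: (le_trans (lerD (lerD h VV) LL)).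
by rewrite -(addrA _ _ kap) -addrA -(addrA (E eps a)) [kap + _]addrC; lra.
Qed.

Lemma gap_cvg T : 0 < T -> forall kap, 0 < kap -> exists2 e0, 0 < e0 &
  forall eps, 0 < eps -> eps <= e0 -> E eps T <= kap.
Proof.
move=> T0 kap kap0.
have [C hC] := uniform_var_bound T0.
have [F F0 hF] := uniform_residual_bound T0.
have KBV eps (eps0 : 0 < eps) := path_BV dot_norm A_maxmon A_ne eps0 (xe_sol eps0).
have C0 : 0 <= C.
  by apply: le_trans (hC 1 ltr01 (lexx _)); apply: var_ge0; [exact: KBV | exact: ltW].
have LC eps r : 0 < eps -> eps <= 1 -> 0 <= r <= T -> L eps r <= C.
  move=> e0 e1 rT; apply: le_trans (hC eps e0 e1); apply: var_nd; [exact: KBV|lra|lra].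
have VT0 : 0 <= V T by apply: var_ge0 => //; exact: ltW.
(* The chained errors total at most [2 (4 C + 5) sigma V T + 2 sigma^2 C], hence at most
   [sigma * q]. *)
pose q := 2 * (4 * C + 5) * V T + 2 * C + 1.
have q0 : 0 < q.
  have : 0 <= 2 * (4 * C + 5) * V T by rewrite mulr_ge0 //; lra.
  rewrite /q; lra.
have [sigma s0 [s1 sq]] := @exists_small R 1 (kap / 2 / q) ltac:(lra)
  ltac:(by rewrite !divr_gt0).
have sq' : sigma * q <= kap / 2 by rewrite -ler_pdivlMr.
pose P s t := forall kap, 0 < kap -> exists2 e0, 0 < e0 & forall eps, 0 < eps -> eps <= e0 ->
    E eps t <= E eps s + 2 * ((4 * C + 5) * sigma) * (V t - V s) +
      2 * sigma ^+ 2 * (L eps t - L eps s) + kap.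
have sig2 : 0 < sigma ^+ 2 by rewrite exprn_gt0.
have local s t : 0 <= s -> s < t -> t <= T ->
    (forall u v, s <= u < t -> s <= v < t -> `|m u - m v| <= sigma ^+ 2) -> P s t.
  move=> s0' st tT osc; apply: (@local_step C F sigma s t) => //.
    by move=> eps r e0 e1 rt; apply: LC => //; lra.
  by move=> eps r e0 e1 rt; apply: hF => //; lra.
have PT : P 0 T.
  apply: (@interval_chain _ P) => //.
  - move=> s u t _ _ _ _ P1 P2 w w0; have w2 : 0 < w / 2 by lra.
    have [e1 e10 h1] := P1 _ w2; have [e2 e20 h2] := P2 _ w2.
    have [e0 e00 [e01 e02]] := exists_small e10 e20.
    exists e0 => // eps ep el.
    have := h1 eps ep (le_trans el e01); have := h2 eps ep (le_trans el e02).
    lra.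
  - move=> s s0T; have s0' : 0 <= s by lra.
    have [d d0 hd] := right_osc s0' sig2.
    exists d => // t st tT; apply: local; [lra|lra|lra|].
    by move=> u v us vs; apply: hd; lra.
  - move=> t t0T; have t0 : 0 < t by lra.
    have [d d0 hd] := left_osc t0 sig2.
    exists d => // s st s0'; apply: local; [lra|lra|lra|].
    by move=> u v us vs; apply: hd; lra.
have kap2 : 0 < kap / 2 by lra.
have [e1 e10 h1] := PT _ kap2.
have [e0 e00 [e01 e02]] := exists_small (@ltr01 R) e10.
exists e0 => // eps ep el; have eps1 := le_trans el e01.
have := h1 eps ep (le_trans el e02).
have E0 : E eps 0 = 0.
  rewrite /E left_lim0 /K (path0 (xe_sol ep)) subr0.
  by have [_ _ [_ ->] _ _] := SPxk; rewrite normr0 expr0n.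
have L0 : L eps 0 = 0 by exact: var0.
have V0 : V 0 = 0 by exact: var0.
rewrite E0 L0 V0 !subr0 add0r => h; apply: (le_trans h).
have LT := hC eps ep eps1.
have ss : sigma ^+ 2 <= sigma by rewrite expr2 ler_piMl // ltW.
have l1 : sigma ^+ 2 * L eps T <= sigma * C.
  by apply: ler_pM => //; [exact: sqr_ge0 | apply: var_ge0; [exact: KBV | exact: ltW]].
rewrite /q in sq'; lra.
Qed.

Lemma yosida_pointwise_cvg T : 0 <= T ->
  xe eps T @[eps --> 0^'+] --> left_lim x T + jump_at m T.
Proof.
move=> T0.
have lE : left_lim x T + jump_at m T = m T - left_lim k T.
  by rewrite /jump_at -(SP_left_lim m_cadlag SPxk T0) opprD addrCA addNKr.
rewrite lE; apply/cvgrPdist_le => w w0.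
move: T0; rewrite le_eqVlt => /orP[/eqP T0|T0].
  (* At time 0 the convention gives the left limit [k 0 = 0], and [K eps 0 = 0], so the
     approximations already equal the limit. *)
  exists 1 => //= eps _ ep; rewrite -T0 left_lim0.
  have [_ _ [_ ->] _ _] := SPxk; rewrite subr0.
  by have := path0 (xe_sol ep) => ->; rewrite normr0 ltW.
have w2 : 0 < w ^+ 2 by rewrite exprn_gt0.
have [e0 e00 he] := gap_cvg T0 w2.
exists e0 => //= eps eb ep.
have -> : m T - left_lim k T - xe eps T = - (left_lim k T - K eps T).
  by rewrite /K; apply: (dot_ext dot_norm) => z; rewrite !(dotE dot); ring.
rewrite normrN -(ler_pXn2r (n := 2)) ?nnegrE //; last exact: ltW.
apply: he => //.
by move: eb; rewrite /ball_ /= sub0r normrN => /ltW; rewrite gtr0_norm.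
Qed.

(** The left limit of [x] lies in the closed domain and is therefore its own projection. *)
Lemma SP_no_jump T : 0 <= T -> jump_at m T = 0 -> x T = left_lim x T + jump_at m T.
Proof.
move=> T0 mT.
have lE : left_lim x T + jump_at m T = m T - left_lim k T.
  by rewrite /jump_at -(SP_left_lim m_cadlag SPxk T0) opprD addrCA addNKr.
have Cl : closure (Dom A) (left_lim x T).
  have [_ xC _ _ _] := SPxk.
  move: T0; rewrite le_eqVlt => /orP[/eqP <-|T0]; first by rewrite left_lim0; apply: xC.
  apply: (has_left_lim_closure (x := x) (@closed_closure _ _) T0) (cadlag_has_left_lim xc T0).
  by move=> r rT; apply: xC; lra.
apply: (projection_spec_unique dot_norm (SP_projection dot_norm A_maxmon A_ne m_cadlag SPxk T0)).
rewrite -lE mT addr0; split => // c _.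
by rewrite subrr (dot0l dot).
Qed.

End convergence.

Theorem mainTheorem3 (R : realType) (H : completeNormedModType R)
    (dot : {dot H for idfun})
    (dot_norm : forall u : H, `|u| ^+ 2 = dot u u)
    (H_separable : exists2 D : set H, countable D & dense D)
    (A : H -> set H)
    (A_maxmon : maximal_monotone dot A)
    (A_int : (Dom A)^° !=set0)
    (m : R -> H) (m_cadlag : cadlag m) (m0 : closure (Dom A) (m 0))
    (xe : R -> R -> H)
    (xe_sol : forall eps : R, 0 < eps -> yosida_solution A eps m (xe eps))
    (x k : R -> H)
    (xk_SP : SP dot A (projection (closure (Dom A))) m x k)
    (t : R) (t_ge0 : 0 <= t) :
  xe eps t @[eps --> 0^'+] -->
    (`|jump_at m t| == 0)%R%:R *: x t
    + (0 < `|jump_at m t|)%R%:R *: (left_lim x t + jump_at m t).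
Proof.
have xe_cvg := yosida_pointwise_cvg dot_norm A_maxmon A_int m_cadlag xe_sol xk_SP t_ge0.
have [j0|j0] := eqVneq `|jump_at m t| 0.
  rewrite j0 ltxx /= scale1r scale0r addr0.
  by rewrite (SP_no_jump dot_norm A_maxmon A_int m_cadlag xk_SP t_ge0 (normr0_eq0 j0)).
by rewrite lt_neqAle eq_sym j0 normr_ge0 scale0r scale1r add0r.
Qed.
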